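(* Let $R$ be a finite chain ring of nilpotency index $m$ with maximal ideal $N$ and $R/N\cong\mathbb{F}_q$, and let $\Sigma=\mathrm{PHG}(n-1,R)$ with $n\ge3$. Let $t,k,n$ be integers with $1\le t<k\le n/2$, and let $\tau=m^t$, $\kappa=m^k$. Let $\mathcal{F}$ be a $\tau$-intersecting family of subspaces of shape $\kappa$ in $\Sigma$. Then \[|\mathcal{F}|\le q^{(m-1)(k-t)(n-k)}\begin{bmatrix} n-t\\ k-t\end{bmatrix}_q,\] this number being equal to the number of free rank-$(k-t)$ submodules of the free module $R^{n-t}$. In case of equality, $\mathcal{F}$ is one of the following: (a) all Hjelmslev subspaces of dimension $k-1$ through a fixed Hjelmslev subspace of dimension $t-1$; (b) if $2k=n$, all Hjelmslev subspaces of dimension $k-1$ contained in a fixed subspace of $\Sigma$ of dimension $2k-t-1=n-t-1$.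
   Context: A finite chain ring is a finite ring $R$ with identity whose left ideals are totally ordered by inclusion; its ideals are $R>N>\dots>N^{m-1}>N^m=0$, with $N$ the unique maximal ideal, $m$ the nilpotency index, $R/N\cong\mathbb{F}_q$, $|R|=q^m$. Every finite left $R$-module is isomorphic to a unique direct sum $\bigoplus_j R/N^{\lambda_j}$ ($m\ge\lambda_1\ge\dots\ge1$); its shape is written $m^{a_m}\cdots 1^{a_1}$ with $a_i$ the number of $j$ with $\lambda_j=i$; shape $m^s$ means free of rank $s$. The projective Hjelmslev geometry $\mathrm{PHG}(n-1,R)$ has as points the free rank-1 submodules of the left module $R^n$; each submodule $U\le R^n$ determines the subspace consisting of the points contained in $U$, with the shape of $U$ as its shape. A subspace associated with a free submodule of rank $s$ is a Hjelmslev subspace of (projective) dimension $s-1$. Intersections of subspaces correspond to intersections of submodules. A family of subspaces of shape $\kappa$ is $\tau$-intersecting if every two distinct members meet in a subspace containing a subspace of shape $\tau$. The Gaussian coefficient is $\begin{bmatrix} a\\ b\end{bmatrix}_q=\prod_{j=0}^{b-1}\frac{q^{a-j}-1}{q^{j+1}-1}$. *)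

(* Defs.v *)
From HB Require Import structures.
From mathcomp Require Import all_boot all_order all_algebra.

Set Implicit Arguments.
Unset Strict Implicit.
Unset Printing Implicit Defensive.

Import GRing.Theory.
Local Open Scope ring_scope.

Definition submodule (R : finNzRingType) (V : finLmodType R) (U : {set V}) :
  bool :=
  [&& 0 \in U,
      [forall x in U, forall y in U, x + y \in U]
    & [forall a : R, forall x in U, a *: x \in U]].

Section ChainRing.

Variable R : finNzRingType.

(* R^o is R acting on itself by left multiplication. *)
Definition left_ideal (I : {set R}) : bool := submodule (I : {set R^o}).

Definition chain_ring : Prop :=
  forall I J : {set R}, left_ideal I -> left_ideal J ->
    (I \subset J) || (J \subset I).

Definition maximal_ideal (N : {set R}) : bool :=
  maxset (fun I : {set R} => left_ideal I && (I != [set: R])) N.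

(* The left ideal generated by the products x * y. *)
Definition ideal_mul (I J : {set R}) : {set R} :=
  \bigcap_(K : {set R} |
      left_ideal K && [forall x in I, forall y in J, x * y \in K]) K.

Definition ideal_exp (N : {set R}) (i : nat) : {set R} :=
  iter i (ideal_mul N) [set: R].

Definition nilpotency_index (N : {set R}) (m : nat) : Prop :=
  ideal_exp N m = [set 0] /\
  forall i : nat, (i < m)%N -> ideal_exp N i <> [set 0].

(* R / N is isomorphic to the field with q elements: a surjective ring
   morphism with kernel N is an isomorphism from the quotient. *)
Definition residue_field (N : {set R}) (q : nat) : Prop :=
  exists (F : finFieldType) (pi : {rmorphism R -> F}),
    [/\ #|F| = q,
        forall y : F, exists x : R, pi x = y
      & forall x : R, pi x = 0 <-> x \in N].

(* For c : 'rV_s and g : 'M_(s, n), c *m g is the left linear combination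
   \sum_j c_j g_j of the rows of g, so c |-> c *m g is an arbitrary
   homomorphism of left modules R^s -> R^n. *)
Definition free_of_rank (n s : nat) (U : {set 'rV[R]_n}) : bool :=
  [exists g : 'M[R]_(s, n),
    injectiveb (fun c : 'rV[R]_s => c *m g)
    && (U == [set c *m g | c : 'rV[R]_s])].

Definition is_shape (m : nat) (lam : seq nat) : bool :=
  sorted geq lam && all (fun l => (0 < l <= m)%N) lam.

(* U is isomorphic to \bigoplus_j R / N^(lam_j): a homomorphism from
   R^(size lam) onto U whose kernel is \bigoplus_j N^(lam_j) is the same as
   an isomorphism from the quotient.  The shape m^(a_m) ... 1^(a_1) is the
   sequence with a_m entries m, ..., a_1 entries 1; thus m^s is nseq s m. *)
Definition has_shape (N : {set R}) (m : nat) (lam : seq nat) (n : nat)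
    (U : {set 'rV[R]_n}) : bool :=
  is_shape m lam &&
  [exists g : 'M[R]_(size lam, n),
    (U == [set c *m g | c : 'rV[R]_(size lam)])
    && [forall c : 'rV[R]_(size lam),
         (c *m g == 0)
         == [forall j, c 0 j \in ideal_exp N (nth 0%N lam j)]]].

(* In PHG(n-1, R) a point is a submodule of R^n, and a subspace is a set of
   points. *)
Definition points_of (n : nat) (U : {set 'rV[R]_n}) : {set {set 'rV[R]_n}} :=
  [set P : {set 'rV[R]_n} | free_of_rank 1 P & P \subset U].

Definition subspace_of_shape (N : {set R}) (m : nat) (lam : seq nat) (n : nat)
    (S : {set {set 'rV[R]_n}}) : bool :=
  [exists U : {set 'rV[R]_n},
    [&& submodule U, has_shape N m lam U & S == points_of U]].

Definition Hjelmslev_subspace (n d : nat) (S : {set {set 'rV[R]_n}}) : bool :=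
  [exists U : {set 'rV[R]_n}, free_of_rank d.+1 U && (S == points_of U)].

Definition intersecting_family (N : {set R}) (m : nat) (tau kappa : seq nat)
    (n : nat) (F : {set {set {set 'rV[R]_n}}}) : Prop :=
  (forall S, S \in F -> subspace_of_shape N m kappa S) /\
  (forall S T, S \in F -> T \in F -> S <> T ->
     exists W, subspace_of_shape N m tau W /\ W \subset S :&: T).

End ChainRing.

Definition gauss_coef (q a b : nat) : rat :=
  \prod_(j < b) ((q%:R ^+ (a - j) - 1) / (q%:R ^+ j.+1 - 1)).

(* Main.v *)
From HB Require Import structures.
Require Import Defs.
From mathcomp Require Import all_boot all_order all_algebra all_field.
From mathcomp Require Import zify ring lra.

Set Implicit Arguments.
Unset Strict Implicit.
Unset Printing Implicit Defensive.

Import GRing.Theory Num.Theory Order.TTheory.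
Local Open Scope ring_scope.

(* Over the field F = R/N the bound and the extremal families come from the
   spectrum of the q-Kneser scheme.  The disjointness operator, composed with a
   suitable polynomial of degree < t in the shadow operator and added to the
   identity, is a quadratic form that takes the value |A| on a t-intersecting
   family A, vanishes on the harmonic components of degree 1, ..., t and is
   positive on the others; so a family of maximal size has degree at most t.
   Such a family has the same local counts as a pencil, which forces it to be a
   pencil or, if n = 2k, the set of all k-spaces of a (2k-t)-space.
   Over R, the reductions mod N of the members form a t-intersecting family over
   F, and at most q^((m-1)(k-t)(n-k)) members have a given reduction, since at each
   level N^i/N^(i+1) they give k x (n-k) matrices with differences of rank at
   most k-t, a set whose translates by a maximum rank-distance code are disjoint.
   In case of equality the reductions form one of the two extremal families, and
   their common subspace is lifted to R level by level. *)

(** * Counting subspaces *)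

(** The polynomial interpolates minus the inverse of the disjointness eigenvalue at the shadow
    eigenvalues of degrees 1, ..., t. These are t nodes, hence degree < t, which is the range in
    which the value |A| survives: fewer than t shadow steps from a member cannot reach a space
    disjoint from any member. The hard point is positivity beyond degree t, a numerical estimate
    that uses 2k <= n and still has to hold for q = 2. The same locality shows that, in degree at
    most t, a spectral functional evaluated at a member depends only on the size of the family; this
    is why the local counts agree with those of a pencil. Over R the obstacle in the equality case
    is that the members are known only through their reductions. Containment of, or in, the common
    subspace is expressed by the vanishing of an additive map [ev], shown modulo N^i by induction on
    i. R need not be commutative, so powers of the uniformizer pass through a matrix only at the
    price of twisting it. *)

Section FinVspace.
Import VectorInternalTheory.
HB.instance Definition _ (F : finFieldType) (vT : vectType (F : fieldType)) :=
  [Countable of {vspace vT} by <:].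
HB.instance Definition _ (F : finFieldType) (vT : vectType (F : fieldType)) :=
  [Finite of {vspace vT} by <:].
End FinVspace.

Section VspaceFacts.
Variables (K : fieldType) (vT : vectType K).
Implicit Types (S T U X Y : {vspace vT}).

Lemma capv_between S S' X U : (S <= S')%VS -> (S' <= X)%VS ->
  (X :&: U = S :&: U)%VS -> (S' :&: U = S :&: U)%VS.
Proof.
move=> SS' S'X E; apply/eqP; rewrite eqEsubv -{1}E; apply/andP; split; exact: capvS.
Qed.

Lemma dimv_add_line U v : v \notin U -> \dim (U + <[v]>) = (\dim U).+1.
Proof.
move=> vU; have v0 : v != 0 by apply: contraNneq vU => ->; rewrite mem0v.
rewrite dimv_disjoint_sum ?dim_vline ?v0 ?addn1 //.
apply/eqP; rewrite -subv0; apply/subvP => x; rewrite memv_cap => /andP[xU].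
move=> /vlineP[a xa]; rewrite memv0; apply: contraNT vU => x0.
have a0 : a != 0 by apply: contraNneq x0 => a0; rewrite xa a0 scale0r.
have -> : v = a^-1 *: x by rewrite xa scalerA mulVf // scale1r.
by rewrite memvZ.
Qed.

End VspaceFacts.

Section Counting.
Variables (F : finFieldType) (vT : vectType (F : fieldType)).
Local Notation L := {vspace vT}.
Local Notation fT := (finvect_type vT).
Local Notation n := (\dim {: vT}).
Implicit Types (S T U X Y : L).
Local Notation q := #|F|.

(** The q-analogue of a, that is, the number of lines of an a-space; rational-valued so that
    differences are not truncated. *)
Definition q_int (a : nat) : rat := (q%:R ^+ a - 1) / (q%:R - 1).

Lemma q_gt1 : (1 < q)%N. Proof. exact: finNzRing_gt1. Qed.
Lemma qr_gt1 : (1 : rat) < q%:R. Proof. by rewrite ltr1n q_gt1. Qed.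
Lemma qr1_gt0 : (0 : rat) < q%:R - 1. Proof. by rewrite subr_gt0 qr_gt1. Qed.
Lemma qr_gt0 : (0 : rat) < q%:R. Proof. by rewrite (lt_trans _ qr_gt1). Qed.

Lemma qint0 : q_int 0 = 0. Proof. by rewrite /q_int expr0 subrr mul0r. Qed.
Lemma qint1 : q_int 1 = 1.
Proof. by rewrite /q_int expr1 divff // lt0r_neq0 // qr1_gt0. Qed.
Lemma qintD a b : q_int (a + b) = q%:R ^+ a * q_int b + q_int a.
Proof. by rewrite /q_int exprD; field; rewrite lt0r_neq0 // qr1_gt0. Qed.
Lemma ltr_qint a b : (q_int a < q_int b) = (a < b)%N.
Proof.
by rewrite /q_int ltr_pM2r ?invr_gt0 ?qr1_gt0 // ltrD2r ltr_eXn2l ?qr_gt1.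
Qed.
Lemma ler_qint a b : (q_int a <= q_int b) = (a <= b)%N.
Proof. by rewrite leNgt ltr_qint -leqNgt. Qed.
Lemma qint_gt0 a : (0 < q_int a) = (0 < a)%N.
Proof. by rewrite -[X in X < _]qint0 ltr_qint. Qed.

Lemma card_vspace_set U : #|[set v : fT | v \in U]| = (q ^ \dim U)%N.
Proof.
pose f (r : 'rV[F]_(\dim U)) : fT := \sum_i r 0 i *: (vbasis U)`_i.
have f_inj : injective f.
  move=> r r' /(congr1 (fun x : vT => coord (vbasis U) ^~ x)) E.
  by apply/rowP => i; have := congr1 (@^~ i) E; rewrite !coord_sum_free ?(basis_free (vbasisP U)).
rewrite -[X in (q ^ X)%N]mul1n -card_mx -cardsT -(card_imset _ f_inj).
apply: eq_card => v; rewrite inE; apply/idP/imsetP => [vU | [r _ ->]].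
  exists (\row_i coord (vbasis U) i v) => //; rewrite [LHS](coord_vbasis vU).
  by apply: eq_bigr => i _; rewrite mxE.
by apply: rpred_sum => i _; rewrite rpredZ ?vbasis_mem ?memt_nth.
Qed.

Lemma card_ext_vec S S' : \dim S' = (\dim S).+1 -> (S <= S')%VS ->
  #|[set v : fT | (v \in S') && (v \notin S)]| = (q ^ \dim S * (q - 1))%N.
Proof.
move=> d SS'; have := cardsID [set v : fT | v \in S] [set v : fT | v \in S'].
have -> : [set v : fT | v \in S'] :&: [set v : fT | v \in S] = [set v : fT | v \in S].
  by apply/setIidPr/subsetP => v; rewrite !inE => /(subvP SS').
have -> : [set v : fT | v \in S'] :\: [set v : fT | v \in S] = [set v : fT | (v \in S') && (v \notin S)].
  by apply/setP => v; rewrite !inE andbC.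
rewrite !card_vspace_set d expnS => E.
by rewrite mulnBr muln1 [X in (X - _)%N]mulnC -E addKn.
Qed.

Lemma capv_ext_line S U v : v \notin S ->
  ((S + <[v]>) :&: U == S :&: U)%VS = (v \notin S + U)%VS.
Proof.
move=> vS; apply/eqP/idP => [E | vSU].
  apply/negP => /memv_addP[s sS [u uU vE]].
  have uE : u = v - s by rewrite vE addrC addKr.
  have : (u \in (S + <[v]>) :&: U)%VS.
    rewrite memv_cap uU andbT uE addrC memv_add ?memv_line ?rpredN //.
  rewrite E memv_cap => /andP[uS _]; move/negP: vS; apply.
  by rewrite vE rpredD.
apply/vspaceP => x; rewrite !memv_cap; apply/andP/andP => -[xS xU]; split => //.
  have /memv_addP[s sS [y /vlineP[a ->] xE]] := xS.
  case: (eqVneq a 0) => [a0|a0]; first by rewrite xE a0 scale0r addr0.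
  case/negP: vSU.
  have -> : v = a^-1 *: (- s + x).
    by rewrite xE addKr scalerA mulVf // scale1r.
  by rewrite memvZ // memv_add // rpredN.
by move: xS; apply: subvP; apply: addvSl.
Qed.

(* The S' are the S + <[v]> with v in Y outside S + U, and each of them comes
   from q^(dim S) (q - 1) vectors v. *)
Lemma count_ext1 S U Y : (S <= Y)%VS -> (U <= Y)%VS ->
  #|[set S' : L | [&& \dim S' == (\dim S).+1, S <= S', S' <= Y
                   & S' :&: U == S :&: U]%VS]|%:R
  = q_int (\dim Y - \dim S) - q_int (\dim U - \dim (S :&: U)).
Proof.
move=> SY UY.
set A := [set S' : L | _].
have cA : (#|A| * (q ^ \dim S * (q - 1)) =
           #|[set v : fT | (v \in Y) && (v \notin (S + U)%VS)]|)%N.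
  rewrite -[RHS]sum1_card.
  rewrite (partition_big (fun v : fT => S + <[v : vT]>)%VS (fun S' => S' \in A)) /=.
    rewrite -sum_nat_const; apply: eq_bigr => S' S'A.
    move: (S'A); rewrite inE => /and4P[/eqP dS' SS' S'Y /eqP cS'].
    rewrite -(card_ext_vec dS' SS') -sum1_card; apply: eq_bigl => v.
    rewrite !inE; apply/andP/andP => [[vS' vS]|[/andP[vY vSU] /eqP<-]].
      have S'E : (S + <[v : vT]>)%VS = S'.
        apply/eqP; rewrite eqEdim dimv_add_line // dS' leqnn andbT.
        by rewrite subv_add SS'; apply/subvP => x /vlineP[a ->]; rewrite memvZ.
      split; last by apply/eqP.
      by rewrite (subvP S'Y) // -capv_ext_line // S'E cS' eqxx.
    split; first exact: (subvP (addvSr S <[v : vT]>) v (memv_line _)).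
    by apply: contraNN vSU; apply: subvP; apply: addvSl.
  move=> v; rewrite !inE => /andP[vY vSU].
  have vS : v \notin S by apply: contraNN vSU; apply: subvP; apply: addvSl.
  rewrite dimv_add_line // eqxx addvSl capv_ext_line // vSU subv_add SY andbT /=.
  by apply/subvP => x /vlineP[a ->]; rewrite memvZ.
have cB : (#|[set v : fT | (v \in Y) && (v \notin (S + U)%VS)]| + q ^ \dim (S + U) = q ^ \dim Y)%N.
  rewrite addnC -!card_vspace_set -(cardsID [set v : fT | v \in (S + U)%VS] [set v : fT | v \in Y]).
  congr (_ + _)%N; last by apply: eq_card => v; rewrite !inE andbC.
  apply: eq_card => v; rewrite !inE andbC; case: (boolP (v \in (S+U)%VS)) => //= h.
  by symmetry; apply: (subvP _ _ h); rewrite subv_add SY.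
have dSU : (\dim (S + U) + \dim (S :&: U) = \dim S + \dim U)%N by rewrite dimv_sum_cap.
have dI : (\dim (S :&: U) <= \dim U)%N by rewrite dimvS // capvSr.
have dS : (\dim S <= \dim Y)%N by rewrite dimvS.
have dSU' : (\dim (S + U) = \dim S + (\dim U - \dim (S :&: U)))%N by lia.
have dSUY : (\dim (S + U) <= \dim Y)%N by rewrite dimvS // subv_add SY.
have q1 := ltnW q_gt1.
rewrite /q_int -mulrBl; apply: (canRL (mulfK _)); first by rewrite lt0r_neq0 ?qr1_gt0.
apply: (mulIf (expf_neq0 (\dim S) (lt0r_neq0 qr_gt0))).
move: cB; rewrite -cA => /(congr1 (fun x => x%:R : rat)).
rewrite natrD !natrM !natrX natrB // => cB.
rewrite -mulrA [(_ - 1) * _]mulrC (canRL (addrK _) cB).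
rewrite [X in _ - _ ^+ X]dSU' exprD -{1}(subnK dS) exprD; ring.
Qed.

Lemma double_count (I J : finType) (P : pred I) (Q : pred J) (r : I -> J -> bool) :
  \sum_(i | P i) #|[set j | Q j && r i j]|%:R =
  \sum_(j | Q j) #|[set i | P i && r i j]|%:R :> rat.
Proof.
transitivity (\sum_(i | P i) \sum_(j | Q j) (r i j)%:R : rat).
  apply: eq_bigr => i _; rewrite -sum1_card natr_sum big_mkcond [RHS]big_mkcond.
  by apply: eq_bigr => j _; rewrite inE; case: (Q j); case: (r i j).
rewrite exchange_big; apply: eq_bigr => j _.
rewrite -sum1_card natr_sum big_mkcond [RHS]big_mkcond.
by apply: eq_bigr => i _; rewrite inE; case: (P i); case: (r i j).
Qed.

Definition q_fact (d : nat) : rat := \prod_(i < d) q_int i.+1.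
(** Divided by [q_fact d], this is the number of d-spaces of an a-space that meet a fixed c-space
    trivially. *)
Definition q_comp (a c d : nat) : rat := \prod_(i < d) (q_int (a - i) - q_int c).
Definition q_binomial (a d : nat) : rat := q_comp a 0 d / q_fact d.

Lemma qfact_gt0 d : 0 < q_fact d.
Proof. by apply: prodr_gt0 => i _; rewrite qint_gt0. Qed.
Lemma qfactS d : q_fact d.+1 = q_fact d * q_int d.+1.
Proof. by rewrite /q_fact big_ord_recr. Qed.
Lemma qcomp0 a c : q_comp a c 0 = 1. Proof. by rewrite /q_comp big_ord0. Qed.
Lemma qcompS a c d : q_comp a c d.+1 = (q_int a - q_int c) * q_comp a.-1 c d.
Proof.
rewrite /q_comp big_ord_recl /= subn0; congr (_ * _); apply: eq_bigr => i _.
by congr (q_int _ - _); rewrite /bump /=; lia.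
Qed.

(** Induction on d by counting pairs S' <= X, where S' is one dimension above S: each X contains
    [q_int d.+1] such S', all of them with the same trace on U. *)
Lemma count_ext S U Y d : (S <= Y)%VS -> (U <= Y)%VS ->
  #|[set X : L | [&& \dim X == (\dim S + d)%N, S <= X, X <= Y
                   & X :&: U == S :&: U]%VS]|%:R
  = q_comp (\dim Y - \dim S) (\dim U - \dim (S :&: U)) d / q_fact d.
Proof.
elim: d S => [|d IH] S SY UY.
  rewrite qcomp0 /q_fact big_ord0 divr1 addn0 (_ : [set X | _] = [set S]) ?cards1 //.
  apply/setP => X; rewrite !inE; apply/and4P/eqP => [[/eqP d SX _ _] | ->] //.
  by apply/esym/eqP; rewrite eqEdim SX d leqnn.
set A := [set X | _].
pose P S' := [&& \dim S' == (\dim S).+1, S <= S', S' <= Y & S' :&: U == S :&: U]%VS.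
have := @double_count L L (fun X => X \in A) P (fun X S' => S' <= X)%VS.
have -> : \sum_(X in A) #|[set S' | P S' && (S' <= X)%VS]|%:R = #|A|%:R * q_int d.+1.
  rewrite mulr_natl -sumr_const; apply: eq_bigr => X.
  rewrite inE => /and4P[/eqP dX SX XY /eqP XU].
  have := count_ext1 SX (sub0v X); rewrite capv0 dimv0 subn0 qint0 subr0 dX.
  rewrite addKn => <-; congr (_%:R); apply: eq_card => S'; rewrite !inE capv0 eqxx andbT.
  apply/andP/and3P => [[/and4P[h1 h2 _ _] h3] | [h1 SS' S'X]]; split=> //.
  by rewrite /P h1 SS' (subv_trans S'X) //= (capv_between SS' S'X XU).
have -> : \sum_(S' | P S') #|[set X | (X \in A) && (S' <= X)%VS]|%:R =
   (q_int (\dim Y - \dim S) - q_int (\dim U - \dim (S :&: U))) *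
   (q_comp (\dim Y - \dim S).-1 (\dim U - \dim (S :&: U)) d / q_fact d).
  rewrite -count_ext1 // mulr_natl -sumr_const.
  rewrite [RHS](eq_bigl P) => [|S']; last by rewrite inE.
  apply: eq_bigr => S' /and4P[/eqP dS' SS' S'Y /eqP S'U].
  have := IH S' S'Y UY; rewrite S'U dS' -subn1 -subnDA addn1 => <-.
  congr (_%:R); apply: eq_card => X; rewrite !inE addSnnS.
  case: (boolP (S' <= X)%VS) => S'X; last by rewrite !andbF.
  by rewrite (subv_trans SS' S'X) /= andbT.
have q0 : q_int d.+1 != 0 by rewrite gt_eqF // qint_gt0.
move=> E; apply: (mulIf q0); rewrite E qcompS qfactS; field.
by rewrite q0 gt_eqF // qfact_gt0.
Qed.

Lemma count_btw S Y d : (S <= Y)%VS ->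
  #|[set X : L | [&& \dim X == (\dim S + d)%N, S <= X & X <= Y]%VS]|%:R
  = q_binomial (\dim Y - \dim S) d.
Proof.
move=> SY; have := @count_ext S 0%VS Y d SY (sub0v Y).
rewrite capv0 dimv0 subnn /q_binomial => <-; congr (_%:R); apply: eq_card => X.
by rewrite !inE capv0 eqxx andbT.
Qed.

Lemma count_sub Y d : #|[set X : L | (\dim X == d) && (X <= Y)%VS]|%:R = q_binomial (\dim Y) d.
Proof.
have := count_btw d (sub0v Y); rewrite dimv0 subn0 => <-; congr (_%:R).
by apply: eq_card => X; rewrite !inE sub0v.
Qed.

Lemma count_sup S d : (d <= n)%N -> (\dim S <= d)%N ->
  #|[set X : L | (\dim X == d) && (S <= X)%VS]|%:R = q_binomial (n - \dim S) (d - \dim S).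
Proof.
move=> dn dS; have := count_btw (d - \dim S) (subvf S).
move=> <-; congr (_%:R).
by apply: eq_card => X; rewrite !inE subvf andbT subnKC.
Qed.

Lemma gbin0 a : q_binomial a 0 = 1. Proof. by rewrite /q_binomial qcomp0 /q_fact big_ord0 divr1. Qed.

End Counting.

(** * Gaussian coefficients *)

Section GaussianBinomials.
Variable F : finFieldType.
Local Notation q := #|F|.
Local Notation qint := (q_int F).
Local Notation gbin := (q_binomial F).
Local Notation qcomp := (q_comp F).
Local Notation qfact := (q_fact F).

Lemma qint_neq0 a : (0 < a)%N -> qint a != 0.
Proof. by move=> a0; rewrite gt_eqF // qint_gt0. Qed.
Lemma qfact_neq0 a : qfact a != 0. Proof. by rewrite gt_eqF // qfact_gt0. Qed.

Lemma qcomp_recr a c d : qcomp a c d.+1 = qcomp a c d * (qint (a - d) - qint c).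
Proof. by rewrite /q_comp big_ord_recr. Qed.

Lemma gbin_rec a d : gbin a d.+1 * qint d.+1 = gbin a d * qint (a - d).
Proof.
rewrite /q_binomial qcomp_recr qint0 subr0 qfactS; field.
by rewrite qfact_neq0 qint_neq0.
Qed.

Lemma gbin_recl a d : gbin a.+1 d.+1 * qint d.+1 = gbin a d * qint a.+1.
Proof.
rewrite /q_binomial qcompS qint0 subr0 qfactS /=; field.
by rewrite qfact_neq0 qint_neq0.
Qed.

Lemma gbin1 a : gbin a 1 = qint a.
Proof. by have := gbin_rec a 0; rewrite qint1 mulr1 gbin0 mul1r subn0. Qed.

Lemma gbin_fact a d : (d <= a)%N -> gbin a d * qfact d * qfact (a - d) = qfact a.
Proof.
elim: d => [|d IH] da; first by rewrite gbin0 subn0 /q_fact big_ord0 !mul1r.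
have e : (a - d = (a - d.+1).+1)%N by lia.
rewrite -(IH (ltnW da)) e !qfactS -e.
transitivity (gbin a d.+1 * qint d.+1 * qfact d * qfact (a - d.+1)); first by ring.
by rewrite gbin_rec; ring.
Qed.

Lemma gbin_sym a d : (d <= a)%N -> gbin a (a - d) = gbin a d.
Proof.
move=> da; have := gbin_fact da; have := gbin_fact (leq_subr d a).
rewrite (subKn da) => <- E; apply: (mulIf (qfact_neq0 (a - d))).
by apply: (mulIf (qfact_neq0 d)); rewrite -E mulrAC.
Qed.

Lemma qcomp_gt0 b c d : (c + d <= b)%N -> 0 < qcomp b c d.
Proof.
move=> h; apply: prodr_gt0 => i _; rewrite subr_gt0 ltr_qint.
by have := ltn_ord i; lia.
Qed.

Lemma gbin_gt0 a d : (d <= a)%N -> 0 < gbin a d.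
Proof.
move=> da; rewrite /q_binomial divr_gt0 ?qfact_gt0 //; apply: prodr_gt0 => i _.
by rewrite qint0 subr0 qint_gt0 subn_gt0 (leq_trans _ da).
Qed.

Lemma gbin_small a d : (a < d)%N -> gbin a d = 0.
Proof.
move=> ad; rewrite /q_binomial /q_comp (bigD1 (Ordinal ad)) //= subnn subrr.
by rewrite !mul0r.
Qed.

Lemma gbin_pascal a d : (d <= a)%N ->
  gbin a.+1 d.+1 = gbin a d.+1 + q%:R ^+ (a - d) * gbin a d.
Proof.
move=> da; apply: (mulIf (qint_neq0 (ltn0Sn d))).
have e : qint a.+1 = q%:R ^+ (a - d) * qint d.+1 + qint (a - d).
  by rewrite -qintD; congr qint; lia.
by rewrite mulrDl gbin_recl gbin_rec e; ring.
Qed.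

(** The Moebius function of the lattice of subspaces on an interval of rank r. *)
Definition moebq (r : nat) : rat := (-1) ^+ r * q%:R ^+ 'C(r, 2).

Lemma moebqS r : moebq r.+1 = - q%:R ^+ r * moebq r.
Proof. by rewrite /moebq binS bin1 exprD exprS; ring. Qed.

(** By the q-Pascal rule the sum for b + 1 is 1 - q^b times the sum for b, and this factor vanishes
    at b = 0. *)
Lemma sum_moebq a : \sum_(r < a.+1) gbin a r * moebq r = (a == 0)%:R.
Proof.
have rec b : \sum_(r < b.+2) gbin b.+1 r * moebq r =
    (1 - q%:R ^+ b) * \sum_(r < b.+1) gbin b r * moebq r.
  rewrite big_ord_recl gbin0 mul1r.
  transitivity (moebq 0 + \sum_(i < b.+1) (gbin b i.+1 * moebq i.+1 -
      q%:R ^+ b * (gbin b i * moebq i))).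
    congr (_ + _); apply: eq_bigr => i _; rewrite lift0 gbin_pascal -1?ltnS //.
    have ib : (i <= b)%N by rewrite -ltnS.
    have e : q%:R ^+ b = q%:R ^+ (b - i) * q%:R ^+ i :> rat by rewrite -exprD subnK.
    by rewrite mulrDl !moebqS e; ring.
  rewrite sumrB -mulr_sumr mulrBl mul1r addrA; congr (_ - _).
  rewrite [in LHS]big_ord_recr /= gbin_small // mul0r addr0.
  by rewrite [in RHS]big_ord_recl gbin0 mul1r; congr (_ + _).
case: a => [|a]; first by rewrite big_ord1 gbin0 mul1r /moebq expr0 mul1r.
elim: a => [|a IH]; first by rewrite rec expr0 subrr mul0r.
by rewrite rec IH mulr0.
Qed.

(* Eigenvalues of the shadow and disjointness operators on k-spaces of an
   n-space, at harmonic functions of degree e. *)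
Definition eig_up (n k e : nat) : rat :=
  qint (k - e) * (qint (n - k).+1 - qint e).
Definition eig_dis (n k e : nat) : rat :=
  moebq e * (qcomp (n - e) k (k - e) / qfact (k - e)).

End GaussianBinomials.

(** * Least squares over the rationals *)

Section NormalEquations.
Variables (I J : finType).

(* Orthogonal projection onto the row space of A. *)
Lemma normal_equations (A : I -> J -> rat) (x : J -> rat) :
  exists y : I -> rat, forall i,
    \sum_j A i j * (x j - \sum_i' A i' j * y i') = 0.
Proof.
pose B : 'M[rat]_(#|I|, #|J|) := \matrix_(i, j) A (enum_val i) (enum_val j).
pose X : 'rV[rat]_#|J| := \row_j x (enum_val j).
(* The normal equations are solvable: if B B^T C = 0 then D = B^T C satisfies D^T D = 0, and a
   vanishing sum of rational squares forces D = 0. *)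
have sub : (X *m B^T <= B *m B^T)%MS.
  have : B *m B^T *m cokermx (B *m B^T) = 0 by rewrite mulmx_coker.
  set C := cokermx _ => BC.
  have BC0 : B^T *m C = 0.
    apply/matrixP => i j; rewrite [RHS]mxE; set D := B^T *m C.
    have : (D^T *m D) j j = 0.
      by rewrite /D trmx_mul trmxK -mulmxA [B *m _]mulmxA BC mulmx0 mxE.
    rewrite mxE => E; have E' : \sum_i (D i j) ^+ 2 = 0.
      by rewrite -[RHS]E; apply: eq_bigr => l _; rewrite [D^T _ _]mxE expr2.
    apply/eqP; rewrite -sqrf_eq0; apply/eqP.
    have h : forall i', predT i' -> 0 <= (D i' j : rat) ^+ 2 by move=> *; apply: sqr_ge0.
    exact: (psumr_eq0P h E' (i := i) isT).
  by rewrite submxE -mulmxA BC0 mulmx0.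
have /submxP[Y EY] := sub.
exists (fun i => Y 0 (enum_rank i)) => i.
have E : ((X - Y *m B) *m B^T) 0 (enum_rank i) = 0.
  by rewrite mulmxBl EY mulmxA subrr mxE.
rewrite -[RHS]E mxE (reindex (@enum_val J predT)) /=; last first.
  by apply: onW_bij; apply: enum_val_bij.
apply: eq_bigr => j _; rewrite !mxE enum_rankK mulrC; congr ((_ - _) * _).
rewrite (reindex (@enum_val I predT)) /=; last first.
  by apply: onW_bij; apply: enum_val_bij.
by apply: eq_bigr => i' _; rewrite !mxE enum_valK mulrC.
Qed.

End NormalEquations.

(** * Harmonic functions on subspaces *)

Section Harmonic.
Variables (F : finFieldType) (vT : vectType (F : fieldType)).
Local Notation L := {vspace vT}.
Local Notation n := (\dim {: vT}).
Local Notation qint := (q_int F).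
Local Notation gbin := (q_binomial F).
Local Notation qcomp := (q_comp F).
Local Notation qfact := (q_fact F).
Local Notation moebq := (moebq F).
Implicit Types (S T U X Y R H : L) (f g h : L -> rat) (e k : nat).

Definition harmonic e h := forall R, (\dim R < e)%N ->
  \sum_(S : L | (\dim S == e) && (R <= S)%VS) h S = 0.

Definition hlift e h U : rat := \sum_(S : L | (\dim S == e) && (S <= U)%VS) h S.

Lemma exchange_incl (P Q : pred L) (r : L -> L -> bool) (h : L -> rat) :
  \sum_(X | P X) \sum_(S | Q S && r S X) h S =
  \sum_(S | Q S) h S * #|[set X | P X && r S X]|%:R.
Proof.
rewrite (exchange_big_dep Q) /=; last by move=> X S _ /andP[].
apply: eq_bigr => S QS; rewrite mulr_natr -sumr_const.
by apply: eq_bigl => X; rewrite inE QS.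
Qed.

Lemma lift_dim k f U : \dim U = k -> hlift k f U = f U.
Proof.
move=> dU; rewrite /hlift (big_pred1 U) // => S /=.
by apply/andP/eqP => [[/eqP dS SU] | ->]; [apply/eqP; rewrite eqEdim SU dU dS leqnn | rewrite dU eqxx].
Qed.

(** Each e-space of U lies in the same number of j-spaces of U, so lifting through an intermediate
    dimension only rescales. *)
Lemma sum_lift e h j U : (e <= j)%N ->
  \sum_(R : L | (\dim R == j) && (R <= U)%VS) hlift e h R =
  gbin (\dim U - e) (j - e) * hlift e h U.
Proof.
move=> ej; rewrite /hlift.
transitivity (\sum_(R | (\dim R == j) && (R <= U)%VS)
   \sum_(S | ((\dim S == e) && (S <= U)%VS) && (S <= R)%VS) h S).
  apply: eq_bigr => R /andP[_ RU]; apply: eq_bigl => S.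
  by case: eqP => //= _; case: (boolP (S <= R)%VS) => [SR|]; rewrite ?andbF // (subv_trans SR).
rewrite exchange_incl mulr_sumr; apply: eq_bigr => S /andP[/eqP dS SU].
rewrite mulrC -dS -(count_btw _ SU) dS subnKC //; congr (_%:R * _).
by apply: eq_card => R; rewrite !inE -andbA; congr andb; rewrite andbC.
Qed.

(** It suffices to test the dimension just below: summing the hypothesis over the k-spaces above R
    counts every S the same nonzero number of times. *)
Lemma harmonic_top k f :
  (forall R, \dim R = k -> \sum_(S : L | (\dim S == k.+1) && (R <= S)%VS) f S = 0) ->
  harmonic k.+1 f.
Proof.
move=> hf R dR.
have c0 : gbin (k.+1 - \dim R) (k - \dim R) != 0 by rewrite gt_eqF // gbin_gt0 //; lia.
apply: (mulIf c0); rewrite mul0r.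
transitivity (\sum_(R' | (\dim R' == k) && (R <= R')%VS)
   \sum_(S | ((\dim S == k.+1) && (R <= S)%VS) && (R' <= S)%VS) f S).
  rewrite exchange_incl mulr_suml; apply: eq_bigr => S /andP[/eqP dS RS].
  rewrite -dS -(count_btw _ RS); congr (_ * _%:R); apply: eq_card => R'.
  by rewrite !inE subnKC // andbA.
apply: big1 => R' /andP[/eqP dR' RR'].
apply: etrans (hf R' dR'); apply: eq_bigl => S.
case: eqP => //= _; case: (boolP (R' <= S)%VS) => R'S; last by rewrite andbF.
by rewrite (subv_trans RR').
Qed.

(** Project f onto the functions lifted from the k-spaces. The residue is orthogonal to all of them,
    hence harmonic of degree k + 1; the projection is the lift of a function y on k-spaces, which is
    decomposed by induction. The Gaussian factors come from [sum_lift]. *)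
Lemma harmonic_decomposition k f : exists h : nat -> L -> rat,
  (forall e, (e <= k)%N -> harmonic e (h e)) /\
  (forall U, \dim U = k -> f U = \sum_(e < k.+1) hlift e (h e) U).
Proof.
elim: k f => [|k IH] f.
  exists (fun _ => f); split=> [e|U dU]; first by rewrite leqn0 => /eqP-> R.
  by rewrite big_ord1 lift_dim.
pose A R S : rat := [&& \dim R == k, \dim S == k.+1 & (R <= S)%VS]%:R.
have [y hy] := normal_equations A f.
have [g [hg yE]] := IH y.
pose f' S := f S - \sum_(R | (\dim R == k) && (R <= S)%VS) y R.
exists (fun e => if e == k.+1 then f' else
  (fun S => gbin (k.+1 - e) (k - e) * g e S)); split.
  move=> e; rewrite leq_eqVlt; case: eqP => [-> _ | _ /=].
    apply: harmonic_top => R dR; apply: etrans (hy R); rewrite big_mkcond /=.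
    apply: eq_bigr => S _; rewrite /A dR eqxx /=; case: ifP => [|_]; last by rewrite mul0r.
    move=> /andP[/eqP dS RS]; rewrite dS eqxx /= mul1r /f'; congr (_ - _).
    rewrite big_mkcond; apply: eq_bigr => R' _.
    by case: (\dim R' == k); case: (R' <= S)%VS; rewrite ?mul1r ?mul0r.
  rewrite ltnS => ek R dR; rewrite -mulr_sumr hg // mulr0 //.
move=> U dU; rewrite big_ord_recr /= eqxx lift_dim // /f' addrC -[LHS](subrK (\sum_(R | (\dim R == k) && (R <= U)%VS) y R)).
congr (_ + _); transitivity (\sum_(R | (\dim R == k) && (R <= U)%VS)
    \sum_(e < k.+1) hlift e (g e) R).
  by apply: eq_bigr => R /andP[/eqP dR _]; apply: yE.
rewrite exchange_big; apply: eq_bigr => e _.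
have ek : (e <= k)%N by rewrite -ltnS.
rewrite sum_lift // dU ltn_eqF ?ltnS // /hlift mulr_sumr //.
Qed.

(** The adjacency operator of the Grassmann graph plus [q_int F k] times the identity, written
    through the (k-1)-spaces H to make it visibly symmetric. *)
Definition shadow_op k f U : rat :=
  \sum_(H : L | ((\dim H).+1 == k) && (H <= U)%VS) \sum_(X : L | (\dim X == k) && (H <= X)%VS) f X.
Definition disjoint_op k f U : rat :=
  \sum_(X : L | (\dim X == k) && (X :&: U == 0)%VS) f X.
Definition point_op k f U : rat :=
  \sum_(P : L | (\dim P == 1)%N && (P <= U)%VS) \sum_(X : L | (\dim X == k) && (P <= X)%VS) f X.

Local Notation mu := (eig_up F n).
Local Notation lam := (eig_dis F n).

(** For S not inside H there is one such X if S meets H in a hyperplane of S, and none otherwise,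
    which is the number of hyperplanes of S lying in H. The first term corrects the case S <= H. In
    this form the second term involves only spaces smaller than S and is killed by harmonicity. *)
Lemma count_common k H S : (k <= n)%N -> (\dim H).+1 = k ->
  #|[set X : L | (\dim X == k) && ((H <= X) && (S <= X))%VS]|%:R =
  (qint (n - k).+1 - qint (\dim S)) * (S <= H)%VS%:R +
  #|[set R : L | [&& (\dim R).+1 == \dim S, R <= H & R <= S]%VS]|%:R :> rat.
Proof.
move=> kn dH.
have hset : [set X : L | (\dim X == k) && ((H <= X) && (S <= X))%VS] =
    [set X : L | (\dim X == k) && (H + S <= X)%VS].
  by apply/setP => X; rewrite !inE subv_add.
have dHS : (\dim (H + S) + \dim (H :&: S) = \dim H + \dim S)%N by rewrite dimv_sum_cap.
have lE : (\dim (H :&: S) <= \dim S)%N by rewrite dimvS // capvSr.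
have lH : (\dim H <= \dim (H + S))%N by rewrite dimvS // addvSl.
case: (boolP (S <= H)%VS) => SH.
  rewrite mulr1; have HS : (H + S)%VS = H by apply/addv_idPl.
  rewrite hset HS count_sup //; last by lia.
  rewrite (_ : (k - _ = 1)%N) ?gbin1; last by lia.
  rewrite (_ : (n - \dim H = (n - k).+1)%N); last by lia.
  have -> : [set R | [&& (\dim R).+1 == \dim S, R <= H & R <= S]%VS] =
      [set R | (\dim R == (\dim S).-1) && (R <= S)%VS & (0 < \dim S)%N].
    apply/setP => R; rewrite !inE; case: (boolP (R <= S)%VS) => RS; last by rewrite !andbF.
    by rewrite (subv_trans RS SH) !andbT; case: (\dim S) => [|s]; rewrite /= ?andbT ?andbF ?eqSS.
  case: (posnP (\dim S)) => [-> | d0].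
    by rewrite qint0 subr0 (_ : [set R | _] = set0) ?cards0 ?addr0 //;
       apply/setP => R; rewrite !inE andbF.
  have -> : [set R | (\dim R == (\dim S).-1) && (R <= S)%VS & true] =
      [set R : L | (\dim R == (\dim S).-1) && (R <= S)%VS].
    by apply/setP => R; rewrite !inE andbT.
  by rewrite count_sub -subn1 gbin_sym // gbin1 subrK.
rewrite mulr0 add0r.
have lt1 : (\dim (H :&: S) < \dim S)%N.
  rewrite ltn_neqAle lE andbT; apply: contra SH => /eqP E.
  have /eqP -> : S == (H :&: S)%VS by rewrite eq_sym eqEdim capvSr E leqnn.
  by apply: capvSl.
case: (eqVneq (\dim (H + S)) k) => dk.
  have -> : [set R | [&& (\dim R).+1 == \dim S, R <= H & R <= S]%VS] = [set (H :&: S)%VS].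
    apply/setP => R; rewrite !inE; apply/and3P/eqP => [[/eqP dR RH RS] | ->].
      by apply/eqP; rewrite eqEdim subv_cap RH RS /=; lia.
    by rewrite capvSl capvSr; split => //; apply/eqP; lia.
  rewrite hset cards1 (_ : [set X | _] = [set (H + S)%VS]) ?cards1 //.
  apply/setP => X; rewrite !inE; apply/andP/eqP => [[/eqP dX HX] | ->]; last by rewrite dk eqxx.
  by apply/esym/eqP; rewrite eqEdim HX dX dk leqnn.
have hn : (\dim (H + S) != \dim H)%N.
  apply: contra SH => /eqP E; have /eqP -> : H == (H + S)%VS by rewrite eqEdim addvSl E leqnn.
  by rewrite addvSr.
have -> : [set X : L | (\dim X == k) && ((H <= X) && (S <= X))%VS] = set0.
  apply/setP => X; rewrite !inE -subv_add; apply/negP => /andP[/eqP dX /dimvS].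
  by rewrite dX; lia.
have -> : [set R : L | [&& (\dim R).+1 == \dim S, R <= H & R <= S]%VS] = set0.
  apply/setP => R; rewrite !inE; apply/negP => /and3P[/eqP dR RH RS].
  have : (\dim R <= \dim (H :&: S))%N by rewrite dimvS // (@subv_cap F) RH.
  by lia.
by rewrite !cards0.
Qed.

(** Exchanging the sums turns every inner sum into one that vanishes by harmonicity. This removes
    the lower-order part of each count below. *)
Lemma sum_harmonic_incl e h (P : pred L) (c : L -> rat) :
  harmonic e h -> (forall R, P R -> (\dim R < e)%N) ->
  \sum_(S : L | \dim S == e) h S * \sum_(R | P R && (R <= S)%VS) c R = 0.
Proof.
move=> hh hP.
transitivity (\sum_(R | P R) c R * \sum_(S | (\dim S == e) && (R <= S)%VS) h S).
  under eq_bigr do rewrite mulr_sumr.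
  rewrite (exchange_big_dep P) /=; last by move=> S R _ /andP[].
  apply: eq_bigr => R PR; rewrite mulr_sumr; apply: eq_big => [S|S _]; last by rewrite mulrC.
  by rewrite PR.
by apply: big1 => R PR; rewrite hh ?mulr0 // hP.
Qed.

Lemma sum_lift_sup k e h (Q : pred L) :
  \sum_(X | (\dim X == k) && Q X) hlift e h X =
  \sum_(S | \dim S == e) h S * #|[set X : L | (\dim X == k) && (Q X && (S <= X)%VS)]|%:R.
Proof.
rewrite /hlift exchange_incl; apply: eq_bigr => S _; congr (_ * _%:R).
by apply: eq_card => X; rewrite !inE andbA.
Qed.

(** Summing upwards over the X through H multiplies the lift at H by the second factor of [eig_up],
    by [count_common]; summing down from U gives the first factor, by [sum_lift]. *)
Lemma upop_lift k e h U : harmonic e h -> (k <= n)%N -> (e <= k)%N -> \dim U = k ->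
  shadow_op k (hlift e h) U = mu k e * hlift e h U.
Proof.
move=> hh kn ek dU; rewrite /shadow_op.
transitivity (\sum_(H | ((\dim H).+1 == k) && (H <= U)%VS)
    (qint (n - k).+1 - qint e) * hlift e h H).
  apply: eq_bigr => H /andP[/eqP dH HU]; rewrite sum_lift_sup.
  transitivity (\sum_(S : L | \dim S == e) h S * ((qint (n - k).+1 - qint e) * (S <= H)%VS%:R) +
     \sum_(S : L | \dim S == e) h S * \sum_(R : L | ((\dim R).+1 == e) && (R <= H)%VS && (R <= S)%VS) 1).
    rewrite -big_split; apply: eq_bigr => S /eqP dS.
    rewrite /= -mulrDr count_common // dS; congr (_ * (_ + _)).
    rewrite sumr_const; congr (_%:R); apply: eq_card => R.
    by rewrite !inE [in RHS]unfold_in andbA.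
  rewrite sum_harmonic_incl ?addr0 // => [|R /andP[/eqP<-] //].
  rewrite /hlift mulr_sumr [RHS]big_mkcond [LHS]big_mkcond; apply: eq_bigr => S _.
  by case: eqP => //= _; case: (S <= H)%VS; rewrite ?mulr1 ?mulr0 // mulrC.
rewrite -mulr_sumr /eig_up mulrC -[RHS]mulrA [_ * hlift e h U]mulrC mulrA; congr (_ * _).
case: k => [|k] in kn ek dU *.
  rewrite sub0n qint0 mul0r big_pred0 // => H.
rewrite (eq_bigl (fun H : L => (\dim H == k) && (H <= U)%VS)) //.
move: ek; rewrite leq_eqVlt => /orP[/eqP-> | ek].
  rewrite subnn qint0 mul0r; apply: big1 => H /andP[/eqP dH _]; rewrite /hlift.
  rewrite big_pred0 // => S; apply/negP => /andP[/eqP dS /dimvS]; rewrite dS dH; lia.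
rewrite sum_lift // dU (_ : (k - e = k.+1 - e - 1)%N); last by lia.
by rewrite gbin_sym ?gbin1 //; lia.
Qed.

(** The number of X through S that are disjoint from U depends only on whether S meets U trivially.
    Moebius inversion writes this condition as a sum over the R inside both S and U; the R of
    dimension less than e are killed, and R = S remains, which requires S <= U. *)
Lemma disop_lift k e h U : harmonic e h -> (k <= n)%N -> (e <= k)%N -> \dim U = k ->
  disjoint_op k (hlift e h) U = lam k e * hlift e h U.
Proof.
move=> hh kn ek dU; rewrite /disjoint_op sum_lift_sup.
pose N := qcomp (n - e) k (k - e) / qfact (k - e).
transitivity (\sum_(S : L | \dim S == e) h S * (N * (S :&: U == 0)%VS%:R)).
  apply: eq_bigr => S /eqP dS; congr (_ * _).
  case: (eqVneq (S :&: U)%VS 0%VS) => SU.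
    have := count_ext (k - e) (subvf S) (subvf U).
    rewrite SU dimv0 subn0 dU dS -/N mulr1 => <-; congr (_%:R); apply: eq_card => X.
    by rewrite !inE subnKC // subvf /=; congr andb; rewrite andbC.
  rewrite mulr0 (_ : [set X | _] = set0) ?cards0 //; apply/setP => X; rewrite !inE.
  apply/negP => /and3P[_ /eqP XU SX]; case/eqP: SU; apply/eqP; rewrite -subv0 -XU.
  exact: capvS.
transitivity (N * \sum_(S : L | \dim S == e) h S *
   \sum_(R : L | (R <= U)%VS && (R <= S)%VS) moebq (\dim R)).
  rewrite mulr_sumr; apply: eq_bigr => S /eqP dS; rewrite mulrCA; congr (_ * (_ * _)).
  rewrite -dimv_eq0 -(sum_moebq F).
  rewrite (partition_big (fun R : L => inord (\dim R) : 'I_(\dim (S :&: U)).+1) predT) //=.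
  apply: eq_bigr => i _; rewrite -count_sub -sum1_card natr_sum mulr_suml.
  rewrite big_mkcond [RHS]big_mkcond; apply: eq_bigr => R _; rewrite inE andbC.
  rewrite (@subv_cap F) [(R <= S)%VS && _]andbC.
  case: (boolP ((R <= U)%VS && (R <= S)%VS)) => /= [|_]; last by rewrite ?andbF.
  move=> /andP[RU RS]; rewrite ?andbT -val_eqE /= inordK ?mul1r.
    by case: eqP => [->|].
  by rewrite ltnS dimvS // (@subv_cap F) RU RS.
transitivity (N * \sum_(S : L | \dim S == e) h S *
   \sum_(R : L | ((\dim R == e) && (R <= U)%VS) && (R <= S)%VS) moebq (\dim R)).
  rewrite -[RHS]addr0 -[in X in _ + X](mulr0 N) -mulrDr; congr (_ * _).
  rewrite -[in X in _ + X](sum_harmonic_incl (P := fun R => (\dim R < e)%N && (R <= U)%VS) (fun R => moebq (\dim R)) hh); last by move=> R /andP[].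
  rewrite -big_split; apply: eq_bigr => S /eqP dS; rewrite /= -mulrDr; congr (_ * _).
  rewrite (bigID (fun R : L => \dim R == e)) /=; congr (_ + _); apply: eq_bigl => R.
    by rewrite [RHS]andbC andbC andbA [in RHS]andbA andbC andbA.
  case: (boolP (R <= S)%VS) => [/dimvS|]; last by rewrite !andbF.
  by rewrite dS !andbT andbC ltn_neqAle => ->; rewrite andbT.
rewrite /eig_dis -/N [moebq e * N]mulrC -[RHS]mulrA; apply: (congr1 ( *%R N)).
rewrite /hlift mulr_sumr.
transitivity (\sum_(S : L | \dim S == e) h S * (moebq e * (S <= U)%VS%:R)).
  apply: eq_bigr => S /eqP dS; congr (_ * _).
  case: (boolP (S <= U)%VS) => SU.
    rewrite mulr1 (big_pred1 S) ?dS // => R /=; apply/andP/eqP => [[/andP[/eqP dR _] RS] | ->].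
      by apply/eqP; rewrite eqEdim RS dS dR leqnn.
    by rewrite dS eqxx SU.
  rewrite mulr0 big_pred0 // => R; apply/negP => /andP[/andP[/eqP dR RU] RS].
  by case/negP: SU; have /eqP <- : R == S; rewrite // eqEdim RS dS dR /=.
rewrite big_mkcond [RHS]big_mkcond; apply: eq_bigr => S _.
by case: eqP => //= _; case: (S <= U)%VS; rewrite ?mulr0 ?mulr1 // mulrC.
Qed.

End Harmonic.

(** * Positivity of the quadratic form *)

Section Interpolation.
Variables (m : nat -> rat) (t : nat).
Hypothesis m_inj : {in [pred e : nat | (0 < e <= t)%N] &, injective m}.

(** The nodes are m 1, ..., m t, so the ordinal r stands for the node r + 1; m 0 is left out, as
    degree 0 has to keep its positive contribution. *)
Definition lagrange (s : nat) : {poly rat} :=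
  \prod_(r < t | r.+1 != s) ((m s - m r.+1)^-1 *: ('X - (m r.+1)%:P)).
Definition interp (v : nat -> rat) : {poly rat} :=
  \sum_(s < t) v s.+1 *: lagrange s.+1.

Lemma horner_lagrange s x :
  (lagrange s).[x] = \prod_(r < t | r.+1 != s) ((x - m r.+1) / (m s - m r.+1)).
Proof.
rewrite horner_prod; apply: eq_bigr => r _.
by rewrite hornerZ hornerXsubC mulrC.
Qed.

Lemma horner_interp v x : (interp v).[x] = \sum_(s < t) v s.+1 * (lagrange s.+1).[x].
Proof. by rewrite horner_sum; apply: eq_bigr => s _; rewrite hornerZ. Qed.

Lemma interpE v s : (0 < s <= t)%N -> (interp v).[m s] = v s.
Proof.
case: s => // s; rewrite ltnS /= => st; rewrite horner_interp.
rewrite (bigD1 (Ordinal st)) //= big1 ?addr0 => [|i /eqP ni].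
  rewrite horner_lagrange big1 ?mulr1 // => r rs; rewrite divff // subr_eq0.
  apply: contra rs => /eqP/m_inj E; apply/eqP; rewrite E ?inE //=.
rewrite horner_lagrange (bigD1 (Ordinal st)) /=; last first.
  by apply: contra_notN ni => /eqP[E]; apply/val_inj.
by rewrite subrr !mul0r mulr0.
Qed.

Lemma size_lagrange s : (0 < s <= t)%N -> (size (lagrange s) <= t)%N.
Proof.
case: s => // s; rewrite ltnS /= => st.
have h : (\sum_(r < t | r.+1 != s.+1) 1 = t.-1)%N.
  have := cardC1 (Ordinal st); rewrite card_ord => <-; rewrite -sum1_card.
  by apply: eq_bigl => r; rewrite !inE -val_eqE.
apply: leq_trans (size_poly_prod_leq _ _) _; rewrite -sum1_card h.
have : (\sum_(r < t | r.+1 != s.+1)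
   size ((m s.+1 - m r.+1)^-1 *: ('X - (m r.+1)%:P)) <= \sum_(r < t | r.+1 != s.+1) 2)%N.
  by apply: leq_sum => r _; rewrite (leq_trans (size_scale_leq _ _)) // size_XsubC.
rewrite [X in (_ <= X)%N](_ : _ = 2 * t.-1)%N.
  by move=> hA; apply: (@leq_trans ((2 * t.-1).+1 - t.-1)); [apply: leq_sub2r | lia].
by rewrite -h big_distrr.
Qed.

Lemma size_interp v : (size (interp v) <= t)%N.
Proof.
apply: leq_trans (size_sum _ _ _) _; apply/bigmax_leqP => s _.
by rewrite (leq_trans (size_scale_leq _ _)) // size_lagrange //=.
Qed.

End Interpolation.

Section Theta.
Variables (F : finFieldType) (n k : nat).
Hypothesis kn : (2 * k <= n)%N.
Local Notation q := #|F|.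
Local Notation Q := (q%:R : rat).
Local Notation qint := (q_int F).
Local Notation qcomp := (q_comp F).
Local Notation qfact := (q_fact F).

Local Notation mu := (eig_up F n k).
Local Notation lam := (eig_dis F n k).

(* Up to an affine change of variable, w e is the shadow eigenvalue. *)
Let w e : rat := Q ^+ (n.+1 - e) + Q ^+ e.

Let Q_ge2 : 2 <= Q. Proof. by rewrite ler_nat q_gt1. Qed.
Let Q_gt0 : 0 < Q. Proof. exact: qr_gt0. Qed.
Let Q_neq0 : Q != 0. Proof. by rewrite gt_eqF. Qed.

Lemma mu_diff r s : (r <= k)%N -> (s <= k)%N -> mu r - mu s = (w r - w s) / (Q - 1) ^+ 2.
Proof.
have Q1 : Q - 1 != 0 by rewrite gt_eqF // qr1_gt0.
have muE e : (e <= k)%N ->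
    mu e = (w e - Q ^+ k - Q ^+ (n - k).+1) / (Q - 1) ^+ 2.
  move=> ek; rewrite /eig_up /q_int /w.
  have -> : (n.+1 - e = (k - e) + (n - k).+1)%N by lia.
  have e1 : Q ^+ k = Q ^+ (k - e) * Q ^+ e by rewrite -exprD subnK.
  by rewrite exprD e1; field.
by move=> rk sk; rewrite !muE //; field.
Qed.

Let powS e : 2 * Q ^+ e <= Q ^+ e.+1.
Proof. by rewrite exprS ler_pM2r ?exprn_gt0. Qed.
Let pow_le a b : (a <= b)%N -> Q ^+ a <= Q ^+ b.
Proof. by move=> ab; rewrite ler_eXn2l ?qr_gt1. Qed.
Let pow_lt a b : (a < b)%N -> 2 * Q ^+ a <= Q ^+ b.
Proof. by move=> ab; apply: le_trans (powS a) (pow_le ab). Qed.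

Lemma w_lt r s : (r < s)%N -> (s <= k)%N -> w s < w r.
Proof.
move=> rs sk; rewrite /w.
have h1 : 2 * Q ^+ (n.+1 - s) <= Q ^+ (n.+1 - r) by apply: pow_lt; lia.
have h2 : Q ^+ s <= Q ^+ (n.+1 - s) by apply: pow_le; lia.
have h3 : 0 < Q ^+ r by rewrite exprn_gt0.
by lra.
Qed.

Lemma mu_lt r s : (r < s)%N -> (s <= k)%N -> mu s < mu r.
Proof.
move=> rs sk; rewrite -subr_gt0 mu_diff ?divr_gt0 ?subr_gt0 ?w_lt ?exprn_gt0 ?qr1_gt0 //.
by lia.
Qed.

Lemma mu_inj : {in [pred e : nat | (e <= k)%N] &, injective mu}.
Proof.
move=> r s; rewrite !inE => rk sk E; case: (ltngtP r s) => // h.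
  by have := mu_lt h sk; rewrite E ltxx.
by have := mu_lt h rk; rewrite E ltxx.
Qed.

(** Absolute value of the disjointness eigenvalue, whose sign alternates with e. *)
Let a e : rat := Q ^+ 'C(e, 2) * (qcomp (n - e) k (k - e) / qfact (k - e)).

Let lamE e : lam e = (-1) ^+ e * a e.
Proof. by rewrite /eig_dis /a /moebq -mulrA. Qed.

Let a_gt0 e : (e <= k)%N -> 0 < a e.
Proof.
move=> ek; rewrite mulr_gt0 ?exprn_gt0 // divr_gt0 ?qfact_gt0 // qcomp_gt0 //; lia.
Qed.

Lemma lam_neq0 e : (e <= k)%N -> lam e != 0.
Proof. by move=> ek; rewrite lamE mulf_neq0 ?signr_eq0 // gt_eqF ?a_gt0. Qed.

(** The quotient of consecutive terms is Q^(k-e) times [q_int (n - e - k)] over [q_int (k - e)]; the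
    condition 2k <= n makes the last quotient at least 1. *)
Let aS e : (e < k)%N -> Q ^+ (k - e) * a e.+1 <= a e.
Proof.
move=> ek; rewrite /a binS bin1 exprD.
have -> : (k - e = (k - e.+1).+1)%N by lia.
rewrite qcompS qfactS -subn1 -subnDA addn1.
set A := qcomp _ _ _; set B := qfact _; set C := Q ^+ 'C(e, 2).
have A0 : 0 < A by apply: qcomp_gt0; lia.
have B0 : 0 < B by exact: qfact_gt0.
have C0 : 0 < C by rewrite exprn_gt0.
have D0 : 0 < qint (k - e.+1).+1 by rewrite qint_gt0.
have -> : C * ((qint (n - e) - qint k) * A / (B * qint (k - e.+1).+1)) =
   (qint (n - e) - qint k) / qint (k - e.+1).+1 * (C * (A / B)).
  by field; rewrite !gt_eqF.
have -> : Q ^+ (k - e.+1).+1 * (C * Q ^+ e * (A / B)) = Q ^+ k * (C * (A / B)).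
  have -> : Q ^+ k = Q ^+ (k - e.+1).+1 * Q ^+ e by rewrite -exprD; congr (_ ^+ _); lia.
  by ring.
rewrite ler_pM2r ?mulr_gt0 ?invr_gt0 // ler_pdivlMr //.
have -> : qint (n - e) - qint k = Q ^+ k * qint (n - e - k).
  by rewrite -{1}(subnKC (_ : k <= n - e)%N) ?qintD ?addrK //; lia.
by rewrite ler_pM2l ?exprn_gt0 // ler_qint; lia.
Qed.

Let a_le d s : (s + d <= k)%N -> Q ^+ 'C(d.+1, 2) * a (s + d) <= a s.
Proof.
elim: d s => [|d IH] s sk; first by rewrite addn0 bin_small // mul1r.
have h1 : Q ^+ 'C(d.+1, 2) * a (s + d.+1) <= a s.+1 by rewrite -addSnnS IH //; lia.
have h2 : Q ^+ d.+1 * a s.+1 <= a s.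
  apply: le_trans (aS _); last by lia.
  by rewrite ler_pM2r ?a_gt0 ?pow_le //; lia.
apply: le_trans h2; rewrite binS bin1 exprD -mulrA mulrCA.
by rewrite ler_pM2l ?exprn_gt0.
Qed.

(** The worst case is q = 2, where the infinite product of the 1 - 2^(-i) is about 0.289. The
    induction needs the stronger bound 1/4 + 2^(-d-2) for d + 1 factors. *)
Let halfprod s : 1 / 4 <= \prod_(r < s) (1 - Q ^- (s - r)).
Proof.
have -> : \prod_(r < s) (1 - Q ^- (s - r)) = \prod_(i < s) (1 - Q ^- i.+1).
  rewrite (reindex_inj rev_ord_inj) /=; apply: eq_bigr => i _.
  by rewrite /= subKn.
suff h d : 1 / 4 + 1 / 2 ^+ d.+2 <= \prod_(i < d.+1) (1 - Q ^- i.+1).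
  case: s => [|s]; first by rewrite big_ord0; lra.
  apply: le_trans (h s); have : 0 < 1 / 2 ^+ s.+2 :> rat by rewrite divr_gt0 ?exprn_gt0.
  by lra.
have le2 i : 1 - 1 / 2 ^+ i.+1 <= 1 - Q ^- i.+1.
  rewrite lerD2l lerN2 div1r lef_pV2 ?posrE ?exprn_gt0 //.
  by rewrite lerXn2r ?nnegrE ?ler0n.
elim: d => [|d IH].
  rewrite big_ord1; apply: le_trans (le2 0%N); rewrite expr1 !expr2; lra.
rewrite big_ord_recr /=; have h2 := le2 d.+1.
have e0 : 0 < 1 / 2 ^+ d.+2 :> rat by rewrite divr_gt0 ?exprn_gt0.
have e1 : 1 / 2 ^+ d.+2 <= 1 / 4 :> rat.
  rewrite ler_pM2l // (_ : 4 = 2 ^+ 2) // lef_pV2 ?posrE ?exprn_gt0 //.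
  by rewrite ler_eXn2l.
have e2 : 1 / 2 ^+ d.+3 = 1 / 2 ^+ d.+2 / 2 :> rat by rewrite !exprS; field; rewrite expf_neq0.
rewrite e2; move: e0 e1 h2 IH; set x := 1 / 2 ^+ d.+2; set A := \prod_(_ < _) _.
move=> e0 e1 h2 IH; apply: (@le_trans _ _ ((1 / 4 + x) * (1 - x))); first by nra.
apply: (@le_trans _ _ (A * (1 - x))); last by apply: ler_wpM2l => //; lra.
by apply: ler_wpM2r => //; lra.
Qed.

Variable t : nat.
Hypothesis tk : (t < k)%N.

Let L (s e : nat) : rat := \prod_(r < t | r.+1 != s) ((mu e - mu r.+1) / (mu s - mu r.+1)).

Let mu_ratio r s e : (r <= k)%N -> (s <= k)%N -> (e <= k)%N ->
  (mu e - mu r) / (mu s - mu r) = (w e - w r) / (w s - w r).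
Proof.
move=> rk sk ek; rewrite !mu_diff //.
have : (Q - 1) ^+ 2 != 0 by rewrite expf_neq0 // gt_eqF ?qr1_gt0.
by move: (_ ^+ 2) => c c0; rewrite invfM mulrACA mulfV ?mulr1 // invr_eq0.
Qed.

(** The factor of a node r below s. The denominator w r - w s equals (Q^(n+1-r) - Q^s) (1 -
    Q^(r-s)), and its first factor bounds the numerator w r - w e. *)
Let frac1 r s e : (r < s)%N -> (s < e)%N -> (e <= k)%N ->
  0 <= (mu e - mu r) / (mu s - mu r) <= (1 - Q ^- (s - r))^-1.
Proof.
move=> rs se ek.
have -> : (mu e - mu r) / (mu s - mu r) = (w r - w e) / (w r - w s).
  by rewrite mu_ratio; try lia; rewrite -opprB -[w s - w r]opprB invrN mulrNN.
have w1 : w s < w r by apply: w_lt => //; lia.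
have w2 : w e < w s by apply: w_lt.
have c0 : 0 < 1 - Q ^- (s - r).
  by rewrite subr_gt0 invf_lt1 ?exprn_gt0 // exprn_egt1 ?qr_gt1 //; lia.
apply/andP; split.
  by rewrite divr_ge0 // subr_ge0 ltW // (lt_trans w2).
rewrite ler_pdivrMr ?subr_gt0 // mulrC ler_pdivlMr //.
have -> : w r - w s = (Q ^+ (n.+1 - r) - Q ^+ s) * (1 - Q ^- (s - r)).
  have e1 : Q ^+ (n.+1 - r) = Q ^+ (n.+1 - s) * Q ^+ (s - r) by rewrite -exprD; congr (_ ^+ _); lia.
  have e2 : Q ^+ s = Q ^+ (s - r) * Q ^+ r by rewrite -exprD; congr (_ ^+ _); lia.
  by rewrite /w e1 e2; field; rewrite expf_neq0.
rewrite ler_pM2r // /w.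
have h1 : Q ^+ r <= Q ^+ (n.+1 - e) by apply: pow_le; lia.
have h2 : Q ^+ s <= Q ^+ e by apply: pow_le; lia.
by lra.
Qed.

Let frac2 r s e : (s < r)%N -> (r < e)%N -> (e <= k)%N ->
  -1 <= (mu e - mu r) / (mu s - mu r) <= 0.
Proof.
move=> sr re ek.
have -> : (mu e - mu r) / (mu s - mu r) = - ((w r - w e) / (w s - w r)).
  by rewrite mu_ratio; try lia; rewrite -opprB mulNr.
have w1 : w r < w s by apply: w_lt => //; lia.
have w2 : w e < w r by apply: w_lt.
rewrite lerN2 oppr_le0; apply/andP; split; last first.
  by rewrite divr_ge0 // subr_ge0 ltW.
rewrite ler_pdivrMr ?subr_gt0 // mul1r /w.
have h1 : 2 * Q ^+ (n.+1 - r) <= Q ^+ (n.+1 - s) by apply: pow_lt; lia.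
have h2 : 2 * Q ^+ r <= Q ^+ e by apply: pow_lt.
have h3 : 0 < Q ^+ s by rewrite exprn_gt0.
have h4 : 0 < Q ^+ (n.+1 - e) by rewrite exprn_gt0.
by lra.
Qed.

(** The nodes below s + 1 give nonnegative factors with product at most 4, by [halfprod]; each of
    the t - s - 1 nodes above gives a factor in [-1, 0], and the sign in front compensates for
    these. *)
Let signed_L s e : (s < t)%N -> (t < e)%N -> (e <= k)%N ->
  0 <= (-1) ^+ (t - s.+1) * L s.+1 e <= 4.
Proof.
move=> st te ek; pose f r := (mu e - mu r.+1) / (mu s.+1 - mu r.+1).
have LE : L s.+1 e = (\prod_(r < s) f r) * \prod_(s.+1 <= r < t) f r.
  rewrite /L -(big_mkord (fun r => r.+1 != s.+1) f) (big_cat_nat (n := s)) //=; last exact: ltnW.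
  congr (_ * _); last first.
    rewrite big_ltn_cond //= eqxx /=; rewrite big_nat_cond [RHS]big_nat_cond.
    by apply: eq_bigl => r; rewrite andbT eqSS; case: eqP => [->|]; rewrite ?ltnn ?andbT.
  rewrite -[RHS](big_mkord xpredT f) big_nat_cond [RHS]big_nat_cond.
  by apply: eq_bigl => r; rewrite andbT eqSS leq0n /=; case: eqP => [->|]; rewrite ?ltnn ?andbT.
have -> : (-1) ^+ (t - s.+1) * L s.+1 e =
    (\prod_(r < s) f r) * \prod_(s.+1 <= r < t) - f r.
  rewrite LE mulrCA; congr (_ * _).
  have -> : (-1) ^+ (t - s.+1) = \prod_(s.+1 <= r < t) (-1 : rat).
    by rewrite prodr_const_nat.
  by rewrite -big_split /=; apply: eq_bigr => r _; rewrite mulN1r.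
have h1 : 0 <= \prod_(r < s) f r <= 4.
  have hr (r : 'I_s) : 0 <= f r <= (1 - Q ^- (s - r))^-1.
    have := @frac1 r.+1 s.+1 e; rewrite subSS /f; apply=> //; last by lia.
    by rewrite ltnS.
  rewrite prodr_ge0 => [|r _]; last by case/andP: (hr r).
  apply: (@le_trans _ _ (\prod_(r < s) (1 - Q ^- (s - r))^-1)); first exact: ler_prod.
  rewrite prodfV; have h := halfprod s.
  have h0 : 0 < \prod_(r < s) (1 - Q ^- (s - r)) by apply: lt_le_trans h; lra.
  rewrite -[leLHS]div1r ler_pdivrMr //; lra.
have h2 : 0 <= \prod_(s.+1 <= r < t) - f r <= 1.
  have hr r : (s.+1 <= r < t)%N -> 0 <= - f r <= 1.
    move=> /andP[sr rt]; have := @frac2 r.+1 s.+1 e; rewrite -/(f r) => h.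
    have /andP[] : -1 <= f r <= 0 by apply: h => //; lia.
    by move=> *; apply/andP; split; lra.
  rewrite big_nat prodr_ge0 => [|r /hr/andP[] //].
  apply: (@le_trans _ _ (\prod_(s.+1 <= r < t | (s < r < t)%N) 1)).
    by apply: ler_prod => r /hr.
  by rewrite big1_eq.
case/andP: h1 => h1 h1'; case/andP: h2 => h2 h2'; rewrite mulr_ge0 //=.
by rewrite -[leRHS]mulr1 ler_pM.
Qed.

(** All terms of the interpolation sum have the same sign, which is favourable when e + t is odd.
    Otherwise e >= t + 2, and the decay of the eigenvalues gives a quotient of at most 2^(-(t-s)-2).
    This absorbs the factor 4 and leaves a geometric sum equal to 1 - 2^(-t). *)
Lemma theta_gt0 e : (t < e)%N -> (e <= k)%N ->
  0 < 1 + lam e * (interp mu t (fun s => - (lam s)^-1)).[mu e].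
Proof.
move=> te ek; rewrite horner_interp.
pose P s := (a e / a s.+1) * ((-1) ^+ (t - s.+1) * L s.+1 e).
have P0 s : (s < t)%N -> 0 <= P s.
  move=> st; have /andP[h _] := signed_L st te ek.
  by rewrite mulr_ge0 // divr_ge0 ?ltW ?a_gt0 //; lia.
have -> : lam e * (\sum_(s < t) - (lam s.+1)^-1 * (lagrange mu t s.+1).[mu e]) =
    - (-1) ^+ (e + t) * \sum_(s < t) P s.
  rewrite !mulr_sumr; apply: eq_bigr => s _; rewrite horner_lagrange -/(L s.+1 e) /P !lamE.
  have st := ltn_ord s; have as0 : a s.+1 != 0 by rewrite gt_eqF // a_gt0 //; lia.
  have -> : (-1) ^+ (e + t) = (-1) ^+ e * (-1) ^+ s.+1 * (-1) ^+ (t - s.+1) :> rat.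
    by rewrite -!exprD; congr (_ ^+ _); lia.
  have e1 : (-1) ^+ (t - s.+1) * (-1) ^+ (t - s.+1) = 1 :> rat by rewrite -expr2 sqrr_sign.
  have -> : - ((-1) ^+ e * (-1) ^+ s.+1 * (-1) ^+ (t - s.+1)) *
      (a e / a s.+1 * ((-1) ^+ (t - s.+1) * L s.+1 e)) =
      - ((-1) ^+ e * (-1) ^+ s.+1) * (a e / a s.+1) * L s.+1 e.
    by transitivity (- ((-1) ^+ e * (-1) ^+ s.+1) * (a e / a s.+1) * L s.+1 e *
         ((-1) ^+ (t - s.+1) * (-1) ^+ (t - s.+1))); [ring | rewrite e1 mulr1].
  by rewrite invfM -exprVn invrN1; ring.
have S0 : 0 <= \sum_(s < t) P s by apply: sumr_ge0 => s _; apply: P0.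
rewrite -signr_odd; case: (boolP (odd (e + t))) => odd_et.
  by rewrite expr1 opprK mul1r; lra.
rewrite expr0 mulN1r subr_gt0.
have e2 : (t.+2 <= e)%N.
  by move: te; rewrite leq_eqVlt => /orP[/eqP ee|//]; move: odd_et; rewrite -ee; lia.
apply: (@le_lt_trans _ _ (\sum_(s < t) 2 ^- (t - s))).
  apply: ler_sum => s _; have st := ltn_ord s.
  have /andP[h0 h4] := signed_L st te ek.
  have ha : a e / a s.+1 <= 2 ^- (t - s).+2.
    have hd : (s.+1 + (e - s.+1) = e)%N by lia.
    have := @a_le (e - s.+1) s.+1; rewrite hd => /(_ ek) h.
    rewrite ler_pdivrMr ?a_gt0; try lia.
    rewrite mulrC ler_pdivlMr ?exprn_gt0 // mulrC; apply: le_trans h.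
    rewrite ler_pM2r ?a_gt0 //.
    apply: (@le_trans _ _ (2 ^+ 'C((e - s.+1).+1, 2))).
      rewrite ler_eXn2l //; apply: (@leq_trans (e - s.+1).+1); first by lia.
      by rewrite bin2 -divn2 leq_divRL //= leq_mul2l; apply/orP; right; lia.
    by rewrite lerXn2r ?nnegrE ?ler0n.
  apply: (@le_trans _ _ (2 ^- (t - s).+2 * 4)); first by rewrite ler_pM // divr_ge0 ?ltW ?a_gt0 //; lia.
  by rewrite !exprS; have -> : (2 * (2 * 2 ^+ (t - s)))^-1 * 4 = 2 ^- (t - s) :> rat by field; rewrite expf_neq0.
have -> : \sum_(s < t) 2 ^- (t - s) = \sum_(i < t) 2 ^- i.+1 :> rat.
  by rewrite (reindex_inj rev_ord_inj) /=; apply: eq_bigr => i _; rewrite /= subKn.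
have -> : \sum_(i < t) 2 ^- i.+1 = 1 - 2 ^- t :> rat.
  elim: (t) => [|d IH]; first by rewrite big_ord0 expr0 invr1 subrr.
  by rewrite big_ord_recr /= IH exprS; field; rewrite expf_neq0.
by rewrite ltrBlDr ltrDl invr_gt0 exprn_gt0.
Qed.

End Theta.

(** * Functions of bounded degree *)

Section Spectral.
Variables (F : finFieldType) (vT : vectType (F : fieldType)) (k : nat).
Local Notation L := {vspace vT}.
Local Notation n := (\dim {: vT}).
Local Notation gbin := (q_binomial F).
Local Notation mu := (eig_up F n k).
Local Notation lam := (eig_dis F n k).
Local Notation upop := (@shadow_op F vT k).
Local Notation disop := (@disjoint_op F vT k).
Local Notation ptop := (@point_op F vT k).
Implicit Types (S T U X Y R H P : L) (f g : L -> rat) (h : nat -> L -> rat) (e i t : nat).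
Hypothesis kn : (2 * k <= n)%N.

Let kn1 : (k <= n)%N. Proof. lia. Qed.

Definition hexpand t f h :=
  (forall e, (e <= t)%N -> harmonic e (h e)) /\
  (forall U, \dim U = k -> f U = \sum_(e < t.+1) hlift e (h e) U).
Definition deg_le t f := exists h, hexpand t f h.

Lemma hdec_full f : deg_le k f.
Proof. exact: harmonic_decomposition. Qed.

Lemma eq_upop f g U : (forall X, \dim X = k -> f X = g X) -> upop f U = upop g U.
Proof.
move=> fg; apply: eq_bigr => H _; apply: eq_bigr => X /andP[/eqP dX _]; exact: fg.
Qed.
Lemma eq_disop f g U : (forall X, \dim X = k -> f X = g X) -> disop f U = disop g U.
Proof. by move=> fg; apply: eq_bigr => X /andP[/eqP dX _]; exact: fg. Qed.
Lemma eq_ptop f g U : (forall X, \dim X = k -> f X = g X) -> ptop f U = ptop g U.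
Proof.
move=> fg; apply: eq_bigr => H _; apply: eq_bigr => X /andP[/eqP dX _]; exact: fg.
Qed.

Lemma upop_sum (I : finType) (c : I -> rat) (f : I -> L -> rat) U :
  upop (fun X => \sum_i c i * f i X) U = \sum_i c i * upop (f i) U.
Proof.
rewrite /upop; transitivity (\sum_(H : L | ((\dim H).+1 == k) && (H <= U)%VS)
   \sum_i c i * \sum_(X : L | (\dim X == k) && (H <= X)%VS) f i X).
  by apply: eq_bigr => H _; rewrite exchange_big; apply: eq_bigr => i _; rewrite mulr_sumr.
by rewrite exchange_big; apply: eq_bigr => i _; rewrite mulr_sumr.
Qed.
Lemma ptop_sum (I : finType) (c : I -> rat) (f : I -> L -> rat) U :
  ptop (fun X => \sum_i c i * f i X) U = \sum_i c i * ptop (f i) U.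
Proof.
rewrite /ptop; transitivity (\sum_(H : L | (\dim H == 1)%N && (H <= U)%VS)
   \sum_i c i * \sum_(X : L | (\dim X == k) && (H <= X)%VS) f i X).
  by apply: eq_bigr => H _; rewrite exchange_big; apply: eq_bigr => i _; rewrite mulr_sumr.
by rewrite exchange_big; apply: eq_bigr => i _; rewrite mulr_sumr.
Qed.
Lemma disop_sum (I : finType) (c : I -> rat) (f : I -> L -> rat) U :
  disop (fun X => \sum_i c i * f i X) U = \sum_i c i * disop (f i) U.
Proof. by rewrite /disop exchange_big; apply: eq_bigr => i _; rewrite mulr_sumr. Qed.

Section Decomposed.
Variables (t : nat) (f : L -> rat) (h : nat -> L -> rat).
Hypotheses (tk : (t <= k)%N) (fh : hexpand t f h).

Let et (e : 'I_t.+1) : (e <= k)%N. Proof. by have := ltn_ord e; lia. Qed.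
Let hh (e : 'I_t.+1) : harmonic e (h e).
Proof. by case: fh => + _; apply; have := ltn_ord e; lia. Qed.

Lemma iter_upop_dec i U : \dim U = k ->
  iter i upop f U = \sum_(e < t.+1) mu e ^+ i * hlift e (h e) U.
Proof.
elim: i U => [|i IH] U dU.
  by rewrite /=; case: fh => _ -> //; apply: eq_bigr => e _; rewrite expr0 mul1r.
rewrite iterS (eq_upop _ IH) upop_sum; apply: eq_bigr => e _.
by rewrite upop_lift // mulrA -exprSr.
Qed.

Definition shadow_poly (p : {poly rat}) g U : rat := \sum_(i < size p) p`_i * iter i upop g U.

Lemma pop_dec p U : \dim U = k -> shadow_poly p f U = \sum_(e < t.+1) p.[mu e] * hlift e (h e) U.
Proof.
move=> dU; rewrite /shadow_poly.
under eq_bigr do rewrite iter_upop_dec // mulr_sumr.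
rewrite exchange_big; apply: eq_bigr => e _; rewrite horner_coef mulr_suml.
by apply: eq_bigr => i _; rewrite mulrA.
Qed.

Lemma disop_pop_dec p U : \dim U = k ->
  disop (shadow_poly p f) U = \sum_(e < t.+1) lam e * p.[mu e] * hlift e (h e) U.
Proof.
move=> dU; rewrite (eq_disop _ (pop_dec p)) disop_sum; apply: eq_bigr => e _.
by rewrite disop_lift // mulrCA mulrA.
Qed.

Lemma upop_dec U : \dim U = k -> upop f U = \sum_(e < t.+1) mu e * hlift e (h e) U.
Proof. by move=> dU; have := iter_upop_dec 1 dU => /=. Qed.

End Decomposed.

(** One shadow step replaces a space by one sharing a hyperplane with it, so it lowers the dimension
    of an intersection by at most one. *)
Lemma iter_upop_local i f X :
  (forall X', \dim X' = k -> (k <= \dim (X' :&: X) + i)%N -> f X' = 0) ->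
  \dim X = k -> iter i upop f X = 0.
Proof.
elim: i X => [|i IH] X fX dX; first by apply: fX => //; rewrite capvv dX addn0.
rewrite iterS; apply: big1 => H /andP[/eqP dH HX]; apply: big1 => X1 /andP[/eqP dX1 HX1].
apply: IH => // X' dX' d'; apply: fX => //.
have e1 : (\dim ((X' :&: X1) + H) + \dim ((X' :&: X1) :&: H) = \dim (X' :&: X1) + \dim H)%N.
  by rewrite dimv_sum_cap.
have e2 : (\dim ((X' :&: X1) + H) <= \dim X1)%N.
  by rewrite dimvS // subv_add capvSr.
have e3 : (\dim ((X' :&: X1) :&: H) <= \dim (X' :&: X))%N.
  by apply/dimvS/capvS => //; apply: capvSl.
lia.
Qed.

(** Suppose X' carries f and is reached from X in i < t steps. Inside X' the traces of X and U have
    dimensions at least k - i and t, with sum greater than k, so they meet; hence X is not disjoint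
    from U. *)
Lemma disop_pop_local t (p : {poly rat}) f U : (size p <= t)%N ->
  (forall X, \dim X = k -> f X != 0 -> (t <= \dim (X :&: U))%N) ->
  disop (shadow_poly p f) U = 0.
Proof.
move=> pt fU; apply: big1 => X /andP[/eqP dX /eqP XU]; apply: big1 => i _.
rewrite iter_upop_local ?mulr0 // => X' dX' d'; apply/eqP; apply: contraTT isT => /(fU _ dX') d.
have e1 : (\dim ((X' :&: X) + (X' :&: U)) + \dim ((X' :&: X) :&: (X' :&: U)) =
   \dim (X' :&: X) + \dim (X' :&: U))%N by rewrite dimv_sum_cap.
have e2 : (\dim ((X' :&: X) + (X' :&: U)) <= \dim X')%N by rewrite dimvS // subv_add !capvSl.
have e3 : \dim ((X' :&: X) :&: (X' :&: U)) = 0%N.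
  have : ((X' :&: X) :&: (X' :&: U) <= X :&: U)%VS by apply: capvS; apply: capvSr.
  by rewrite XU => /dimvS; rewrite dimv0 leqn0 => /eqP.
have := ltn_ord i; lia.
Qed.

Lemma lift0E (h : L -> rat) U : hlift 0 h U = h 0%VS.
Proof.
rewrite /hlift (big_pred1 0%VS) // => S /=.
by rewrite dimv_eq0; case: eqP => // ->; rewrite sub0v.
Qed.

Lemma sum_lift_all e (h : L -> rat) : harmonic e h -> (0 < e <= k)%N ->
  \sum_(U : L | \dim U == k) hlift e h U = 0.
Proof.
move=> hh /andP[e0 ek].
have := sum_lift h (fullv : L) ek.
under eq_bigl do rewrite subvf andbT.
move=> ->; suff -> : hlift e h fullv = 0 by rewrite mulr0.
rewrite -[RHS](hh 0%VS); last by rewrite dimv0.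
by apply: eq_bigl => S; rewrite subvf sub0v.
Qed.

Lemma card_kspaces : \sum_(U : L | \dim U == k) 1 = gbin n k.
Proof.
rewrite -(count_sub (fullv : L)) sumr_const; congr (_%:R); apply: eq_card => U.
by rewrite !inE subvf andbT.
Qed.

Lemma hdec_sum t f h : (t <= k)%N -> hexpand t f h ->
  \sum_(U : L | \dim U == k) f U = gbin n k * h 0 0%VS.
Proof.
move=> tk [hh fE]; rewrite (eq_bigr _ (fun U dU => fE U (eqP dU))) exchange_big /=.
rewrite big_ord_recl [X in _ + X]big1 ?addr0 => [|e _].
  rewrite -card_kspaces mulr_suml; by apply: eq_bigr => U _; rewrite lift0E mul1r.
have et := ltn_ord e; rewrite lift0; apply: sum_lift_all; [apply: hh | ]; lia.
Qed.

Lemma upop_sym f g :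
  \sum_(U : L | \dim U == k) f U * upop g U = \sum_(U : L | \dim U == k) upop f U * g U.
Proof.
have E (f1 g1 : L -> rat) : \sum_(U : L | \dim U == k) f1 U * upop g1 U =
   \sum_(H : L | (\dim H).+1 == k) (\sum_(U : L | (\dim U == k) && (H <= U)%VS) f1 U) *
     (\sum_(U : L | (\dim U == k) && (H <= U)%VS) g1 U).
  transitivity (\sum_(U : L | \dim U == k) \sum_(H : L | ((\dim H).+1 == k) && (H <= U)%VS)
      f1 U * \sum_(X : L | (\dim X == k) && (H <= X)%VS) g1 X).
    by apply: eq_bigr => U _; rewrite mulr_sumr.
  rewrite (exchange_big_dep (fun H : L => (\dim H).+1 == k)) /=; last by move=> U H _ /andP[].
  apply: eq_bigr => H ->; rewrite mulr_suml; apply: eq_bigl => U.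
  by rewrite andbC.
rewrite E; under [RHS]eq_bigr do rewrite mulrC.
by rewrite E; apply: eq_bigr => H _; rewrite mulrC.
Qed.

(** The two lifts are eigenvectors of the symmetric shadow operator with distinct eigenvalues. *)
Lemma lift_orth e e' (h h' : L -> rat) : (e <= k)%N -> (e' <= k)%N -> e != e' ->
  harmonic e h -> harmonic e' h' ->
  \sum_(U : L | \dim U == k) hlift e h U * hlift e' h' U = 0.
Proof.
move=> ek ek' ee' hh hh'; set s := \sum_(_ | _) _.
have := upop_sym (hlift e h) (hlift e' h').
have -> : \sum_(U : L | \dim U == k) hlift e h U * upop (hlift e' h') U = mu e' * s.
  rewrite mulr_sumr; apply: eq_bigr => U /eqP dU; rewrite upop_lift //; ring.
have -> : \sum_(U : L | \dim U == k) upop (hlift e h) U * hlift e' h' U = mu e * s.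
  rewrite mulr_sumr; apply: eq_bigr => U /eqP dU; rewrite upop_lift //; ring.
move=> E; apply/eqP; have : (mu e' - mu e) * s = 0 by rewrite mulrBl E subrr.
move/eqP; rewrite mulf_eq0 subr_eq0 => /orP[/eqP/(mu_inj kn) E'|//].
by case/negP: ee'; apply/eqP; rewrite E' ?inE.
Qed.

Lemma degle_ext t f g : (forall U, \dim U = k -> f U = g U) -> deg_le t f -> deg_le t g.
Proof. by move=> fg [h [hh fE]]; exists h; split=> // U dU; rewrite -fg ?fE. Qed.

Lemma degle_lin t (a : rat) f g : deg_le t f -> deg_le t g ->
  deg_le t (fun U => a * f U + g U).
Proof.
move=> [h [hh fE]] [h' [hh' gE]]; exists (fun e S => a * h e S + h' e S); split.
  by move=> e et R dR; rewrite big_split /= -mulr_sumr hh // hh' // mulr0 addr0.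
move=> U dU; rewrite fE // gE // mulr_sumr -big_split; apply: eq_bigr => e _.
by rewrite /hlift /= big_split /= mulr_sumr.
Qed.

Lemma degle0 t : deg_le t (fun=> 0).
Proof.
exists (fun _ _ => 0); split=> [e _ R _|U _]; first by rewrite big1.
by rewrite big1 // => e _; rewrite /hlift big1.
Qed.

Lemma degle_sum t (I : Type) (r : seq I) (c : I -> rat) (f : I -> L -> rat) :
  (forall x, deg_le t (f x)) -> deg_le t (fun U => \sum_(x <- r) c x * f x U).
Proof.
move=> hf; elim: r => [|x r IH].
  by apply: degle_ext (degle0 t) => U _; rewrite big_nil.
by apply: degle_ext (degle_lin (c x) (hf x) IH) => U _; rewrite big_cons.
Qed.

(** The function is the lift of the point mass at T, whose harmonic decomposition stops at degree
    dim T. *)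
Lemma degle_pencil t T : (\dim T <= t)%N -> (t <= k)%N ->
  deg_le t (fun U => (T <= U)%VS%:R).
Proof.
move=> Tt tk; set j := \dim T.
have [h [hh hE]] := harmonic_decomposition j (fun S => (S == T)%:R).
exists (fun e S => if (e <= j)%N then gbin (k - e) (j - e) * h e S else 0); split.
  move=> e et R dR; case: leqP => ej; last by rewrite big1.
  by rewrite -mulr_sumr hh // mulr0.
move=> U dU; transitivity (hlift j (fun S => (S == T)%:R) U).
  rewrite /hlift; case: (boolP (T <= U)%VS) => TU.
    rewrite (bigD1 T) ?eqxx //= big1 ?addr0 // => S /andP[_ /negPf->] //.
  rewrite big1 // => S /andP[_ SU]; case: eqP => // ST; by rewrite -ST SU in TU.
rewrite {1}/hlift (eq_bigr (fun S => \sum_(e < j.+1) hlift e (h e) S)); last first.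
  by move=> S /andP[/eqP dS _]; rewrite -hE.
rewrite exchange_big /= -(subnKC (_ : j.+1 <= t.+1)%N) // big_split_ord /=.
rewrite [X in _ = _ + X]big1 ?addr0 => [|e _]; last first.
  by rewrite /hlift big1 // => S _; rewrite leqNgt ltnS leq_addr.
apply: eq_bigr => e _; have ej : (e <= j)%N by rewrite -ltnS.
by rewrite sum_lift // dU ej /hlift mulr_sumr.
Qed.

Lemma interp_lam t (v : nat -> rat) e : (0 < e <= t)%N -> (t <= k)%N ->
  (interp mu t v).[mu e] = v e.
Proof.
move=> et tk; apply: interpE => // r s; rewrite !inE => /andP[r0 rt] /andP[s0 st].
by apply: (mu_inj kn); rewrite inE; lia.
Qed.

(* If f is supported on the X meeting U in dimension at least t, then the
   disjointness operator applied to a polynomial of degree < t in the shadow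
   operator kills f at U; this determines any spectral functional of f at U. *)
Lemma local_functional t (om : nat -> rat) : (t <= k)%N -> exists beta : rat,
  forall f h U, hexpand t f h -> \dim U = k ->
  (forall X, \dim X = k -> f X != 0 -> (t <= \dim (X :&: U))%N) ->
  \sum_(e < t.+1) om e * hlift e (h e) U = beta * \sum_(X : L | \dim X == k) f X.
Proof.
move=> tk; pose p := interp mu t (fun e => om e / lam e).
exists ((om 0%N - lam 0%N * p.[mu 0%N]) / gbin n k) => f h U fh dU fU.
have := disop_pop_local (size_interp _ _ _ : size p <= t)%N fU.
rewrite (disop_pop_dec tk fh) // (hdec_sum tk fh) => E.
rewrite -[LHS]subr0 -[X in _ - X = _]E -sumrB big_ord_recl big1 ?addr0 => [|e _].
  rewrite lift0E mulrA divfK ?gt_eqF ?gbin_gt0 //; ring.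
rewrite !lift0 /p interp_lam //; last by have := ltn_ord e; lia.
by rewrite mulrCA divff ?mulr1 ?subrr // lam_neq0 //; have := ltn_ord e; lia.
Qed.

(** The t nodes cannot match degree t + 1 as well. Adding a multiple [al] of the interpolant [p2]
    repairs it, because the value [th1] of the quadratic form in degree t + 1 is nonzero; the shift
    this causes in all degrees is the term alpha * f U. *)
Lemma local_functional_succ t (om : nat -> rat) : (t < k)%N -> exists alpha beta : rat,
  forall f h U, hexpand t.+1 f h -> \dim U = k ->
  (forall X, \dim X = k -> f X != 0 -> (t <= \dim (X :&: U))%N) ->
  \sum_(e < t.+2) om e * hlift e (h e) U =
    alpha * f U + beta * \sum_(X : L | \dim X == k) f X.
Proof.
move=> tk; pose p1 := interp mu t (fun e => om e / lam e).
pose p2 := interp mu t (fun s => - (lam s)^-1).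
have th := @theta_gt0 F n k kn t tk t.+1 (ltnSn t) tk.
pose th1 := 1 + lam t.+1 * p2.[mu t.+1]; have {}th : th1 != 0 by rewrite gt_eqF.
pose al := (om t.+1 - lam t.+1 * p1.[mu t.+1]) / th1.
pose p := p1 + al *: p2.
exists al, ((om 0%N - al - lam 0%N * p.[mu 0%N]) / gbin n k) => f h U fh dU fU.
have sp : (size p <= t)%N.
  apply: leq_trans (size_polyD _ _) _; rewrite geq_max size_interp.
  exact: leq_trans (size_scale_leq _ _) (size_interp _ _ _).
have := disop_pop_local sp fU.
rewrite (disop_pop_dec tk fh) // (hdec_sum tk fh) => E.
have -> : f U = \sum_(e < t.+2) hlift e (h e) U by case: fh => _ ->.
rewrite -[LHS]subr0 -[X in _ - X = _]E mulr_sumr -[LHS](subrK (\sum_(e < t.+2) al * hlift e (h e) U)).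
rewrite addrC; congr (_ + _); rewrite -!sumrB big_ord_recl big1 ?addr0 => [|e _].
  rewrite lift0E mulrA divfK ?gt_eqF ?gbin_gt0 //; ring.
rewrite !lift0 /p hornerD hornerZ; have et := ltn_ord e.
case: (ltnP e t) => et'.
  rewrite /p1 /p2 !interp_lam //; try lia.
  have l0 : lam e.+1 != 0 by apply: lam_neq0 => //; lia.
  by field.
have -> : e.+1 = t.+1 by lia.
rewrite -(mulrBl (hlift t.+1 (h t.+1) U)) -mulrBl.
have -> : om t.+1 - lam t.+1 * (p1.[mu t.+1] + al * p2.[mu t.+1]) - al =
   om t.+1 - lam t.+1 * p1.[mu t.+1] - al * th1 by rewrite /th1; ring.
by rewrite /al divfK // subrr mul0r.
Qed.

End Spectral.

(** * Hyperplanes and common complements *)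

Section VspaceFacts2.
Variables (K : fieldType) (vT : vectType K).
Implicit Types (S T U V W X Y A B H : {vspace vT}).

Lemma dimv_cap_hyper X A H : (H <= X)%VS -> (\dim H).+1 = \dim X -> (A <= X)%VS ->
  (\dim A <= (\dim (A :&: H)).+1)%N.
Proof.
move=> HX dH AX; have := dimv_sum_cap A H.
have : (\dim (A + H) <= \dim X)%N by rewrite dimvS // subv_add AX.
lia.
Qed.

Lemma exists_hyper T U x : (T <= U)%VS -> x \in U -> x \notin T ->
  exists H, [/\ (T <= H)%VS, (H <= U)%VS, (\dim H).+1 = \dim U & x \notin H].
Proof.
move=> TU xU xT; set W := (T + <[x]>)%VS.
have WU : (W <= U)%VS.
  by rewrite subv_add TU; apply/subvP => y /vlineP[a ->]; rewrite memvZ.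
have dW : \dim W = (\dim T).+1 by rewrite dimv_add_line.
pose H := (T + (U :\: W))%VS; exists H.
have HU : (H <= U)%VS by rewrite subv_add TU diffvSl.
have HxU : (H + <[x]> = U)%VS.
  by rewrite /H -addvA [(_ :\: _ + _)%VS]addvC addvA -/W addvC addv_diff; apply/addv_idPl.
have dD : \dim (U :\: W) = (\dim U - \dim W)%N.
  by have := dimv_cap_compl U W; rewrite (capv_idPr WU); lia.
have dWU := dimvS WU.
have d1 : (\dim H <= \dim T + (\dim U - \dim W))%N.
  by rewrite -dD; have := dimv_sum_cap T (U :\: W); rewrite -/H; lia.
have xH : x \notin H.
  apply/negP => xH; have := HxU; rewrite (_ : H + <[x]> = H)%VS.
    by move=> HE; move: d1; rewrite HE; lia.
  by apply/addv_idPl/subvP => y /vlineP[a ->]; rewrite memvZ.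
split => //; first exact: addvSl.
by rewrite -(dimv_add_line xH) HxU.
Qed.

Lemma exists_avoid1 A Y : (A <= Y)%VS -> (\dim A < \dim Y)%N -> exists2 v, v \in Y & v \notin A.
Proof.
move=> AY dA; apply/subvPn; apply: contraL dA => YA.
by rewrite -leqNgt dimvS.
Qed.

Lemma exists_avoid2 A B Y : (A <= Y)%VS -> (B <= Y)%VS ->
  (\dim A < \dim Y)%N -> (\dim B < \dim Y)%N ->
  exists v, [/\ v \in Y, v \notin A & v \notin B].
Proof.
move=> AY BY dA dB.
have [a aY aA] := exists_avoid1 AY dA; have [b bY bB] := exists_avoid1 BY dB.
case: (boolP (a \in B)) => aB; last by exists a.
case: (boolP (b \in A)) => bA; last by exists b.
exists (a + b); split; first by rewrite rpredD.
  by apply: contra aA => h; rewrite -(addrK b a) rpredB.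
by apply: contra bB => h; rewrite -(addKr a b) rpredD ?rpredN.
Qed.

(** Induction on d: a space is not the union of two proper subspaces, so a vector of Y outside both
    A and B can be added to S, A and B at once. This is the source of all spaces in general position
    used later. *)
Lemma common_complement d S A B Y : (S <= A)%VS -> (S <= B)%VS -> (A <= Y)%VS -> (B <= Y)%VS ->
  (\dim A + d <= \dim Y)%N -> (\dim B + d <= \dim Y)%N ->
  exists V, [/\ \dim V = (\dim S + d)%N, (S <= V)%VS, (V <= Y)%VS,
               (V :&: A = S)%VS & (V :&: B = S)%VS].
Proof.
elim: d S A B => [|d IH] S A B SA SB AY BY dA dB.
  by exists S; rewrite addn0; split=> //; [apply: subv_trans AY | apply/capv_idPl | apply/capv_idPl].
have [v [vY vA vB]] : exists v, [/\ v \in Y, v \notin A & v \notin B].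
  by apply: exists_avoid2 => //; lia.
have vS : v \notin S by apply: contra vA; apply: subvP.
have vlY : (<[v]> <= Y)%VS by apply/subvP => y /vlineP[a ->]; rewrite memvZ.
have [] := IH (S + <[v]>)%VS (A + <[v]>)%VS (B + <[v]>)%VS; rewrite ?addvS ?subv_add ?AY ?BY //.
- by rewrite dimv_add_line //; lia.
- by rewrite dimv_add_line //; lia.
move=> V [dV SV VY VA VB]; exists V.
have key C : (S <= C)%VS -> v \notin C -> (V :&: (C + <[v]>) = S + <[v]>)%VS -> (V :&: C = S)%VS.
  move=> SC vC VC; apply/eqP; rewrite eqEsubv; apply/andP; split; last first.
    by rewrite subv_cap SC (subv_trans _ SV) ?addvSl.
  apply/subvP => x; rewrite memv_cap => /andP[xV xC].
  have : x \in (V :&: (C + <[v]>))%VS by rewrite memv_cap xV (subvP (addvSl _ _) _ xC).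
  rewrite VC => /memv_addP[s sS [y /vlineP[a ->] xE]].
  case: (eqVneq a 0) => [a0|a0]; first by rewrite xE a0 scale0r addr0.
  case/negP: vC; have -> : v = a^-1 *: (x - s).
    by rewrite xE addrAC subrr add0r scalerA mulVf // scale1r.
  by rewrite memvZ // rpredB // (subvP SC).
split => //; [by rewrite dV dimv_add_line // addSnnS | | exact: key | exact: key].
by rewrite (subv_trans _ SV) ?addvSl.
Qed.

Lemma exists_subspace U d : (d <= \dim U)%N -> exists2 W, (W <= U)%VS & \dim W = d.
Proof.
move=> dU; have [] := @common_complement d 0%VS 0%VS 0%VS U; rewrite ?sub0v ?dimv0 ?add0n //.
by move=> W [dW _ WU _ _]; exists W.
Qed.

End VspaceFacts2.

(** * The point operator *)

Section PointOperator.
Variables (F : finFieldType) (vT : vectType (F : fieldType)).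
Local Notation L := {vspace vT}.
Local Notation n := (\dim {: vT}).
Local Notation qint := (q_int F).
Local Notation gbin := (q_binomial F).
Implicit Types (S T U X Y R H P : L).

(** Points only see degrees 0 and 1. The test on k is there because the truncated [k.-2] would give
    the coefficient 1 instead of 0 when k = 1. *)
Definition eig_pt k e : rat :=
  if e == 0%N then qint k * gbin n.-1 k.-1 else
  if e == 1%N then gbin n.-1 k.-1 - (if (1 < k)%N then gbin n.-2 k.-2 else 0) else 0.

(** The number of X through P and S is b, or a when P <= S. For e > 0 the constant part meets the
    total sum of h, which is 0; the rest is the sum of h over the S through P, which is 0 as soon as
    e > 1. *)
Lemma ptop_lift k e (h : L -> rat) U : harmonic e h -> (0 < k)%N -> (k <= n)%N -> (e <= k)%N ->
  \dim U = k -> point_op k (hlift e h) U = eig_pt k e * hlift e h U.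
Proof.
move=> hh k0 kn ek dU.
pose a := gbin (n - e) (k - e).
pose b := if (e < k)%N then gbin (n - e.+1) (k - e.+1) else 0.
have cnt P S : \dim P = 1%N -> \dim S = e ->
  #|[set X : L | (\dim X == k) && ((P <= X) && (S <= X))%VS]|%:R = b + (a - b) * (P <= S)%VS%:R.
  move=> dP dS.
  have -> : [set X : L | (\dim X == k) && ((P <= X) && (S <= X))%VS] =
      [set X : L | (\dim X == k) && (P + S <= X)%VS].
    by apply/setP => X; rewrite !inE subv_add.
  case: (boolP (P <= S)%VS) => PS.
    by rewrite (addv_idPr PS) mulr1 addrCA subrr addr0 count_sup // dS.
  have d0 : \dim (P :&: S) = 0%N.
    have : (\dim (P :&: S) <= \dim P)%N by rewrite dimvS // capvSl.
    rewrite dP leq_eqVlt ltnS leqn0 => /orP[/eqP E|/eqP//].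
    case/negP: PS; have /eqP <- : (P :&: S)%VS == P by rewrite eqEdim capvSl E dP.
    exact: capvSr.
  have dPS : \dim (P + S) = e.+1 by have := dimv_sum_cap P S; lia.
  rewrite mulr0 addr0 /b; case: ltnP => ek'; first by rewrite count_sup // dPS.
  rewrite (_ : [set X | _] = set0) ?cards0 //; apply/setP => X; rewrite !inE.
  apply/negP => /andP[/eqP dX /dimvS]; rewrite dX dPS; lia.
have step : point_op k (hlift e h) U = \sum_(P : L | (\dim P == 1)%N && (P <= U)%VS)
    (b * \sum_(S : L | \dim S == e) h S +
     (a - b) * \sum_(S : L | (\dim S == e) && (P <= S)%VS) h S).
  apply: eq_bigr => P /andP[/eqP dP PU]; rewrite sum_lift_sup.
  transitivity (\sum_(S : L | \dim S == e) (b * h S + (a - b) * (h S * (P <= S)%VS%:R))).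
    by apply: eq_bigr => S /eqP dS; rewrite cnt //; ring.
  rewrite big_split /= -mulr_sumr -mulr_sumr; congr (_ + _ * _).
  rewrite big_mkcond [RHS]big_mkcond; apply: eq_bigr => S _.
  by case: (_ == e); case: (P <= S)%VS; rewrite /= ?mulr1 ?mulr0.
case: e => [|e] in hh ek a b cnt step *.
  rewrite /eig_pt eqxx lift0E /point_op.
  transitivity (\sum_(P : L | (\dim P == 1)%N && (P <= U)%VS) gbin n.-1 k.-1 * h 0%VS).
    apply: eq_bigr => P /andP[/eqP dP PU].
    rewrite (eq_bigr (fun=> h 0%VS)) => [|X _]; last exact: lift0E.
    rewrite sumr_const -[in RHS]subn1 -[in RHS](subn1 k) -dP -count_sup ?dP //.
    by rewrite mulr_natl; congr (_ *+ _); apply: eq_card => X; rewrite !inE.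
  rewrite sumr_const -[RHS]mulrA -[LHS]mulr_natl; congr (_ * _).
  rewrite -gbin1 -dU -count_sub; congr (_%:R); apply: eq_card => P; by rewrite !inE.
have s0 : \sum_(S : L | \dim S == e.+1) h S = 0.
  rewrite -[RHS](hh 0%VS) ?dimv0 //; apply: eq_bigl => S; by rewrite sub0v andbT.
rewrite step s0 mulr0; under eq_bigr do rewrite add0r.
rewrite -mulr_sumr /eig_pt /=; case: e => [|e] in hh ek a b cnt step s0 *; last first.
  rewrite mul0r big1 ?mulr0 // => P /andP[/eqP dP _]; apply: hh; by rewrite dP.
rewrite /= -subn1 -[k.-1]subn1 -/a.
have -> : b = if (1 < k)%N then gbin n.-2 k.-2 else 0.
  by rewrite /b -(subn2 n) -(subn2 k).
rewrite !subn1; congr (_ * _); apply: eq_bigr => P /andP[/eqP dP _].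
rewrite (big_pred1 P) // => S /=; apply/andP/eqP => [[/eqP dS PS]|->]; last by rewrite dP.
by apply/esym/eqP; rewrite eqEdim PS dP dS.
Qed.

End PointOperator.

(** * Intersecting families over a field: the bound *)

Section FieldEKR.
Variables (F : finFieldType) (vT : vectType (F : fieldType)) (k t : nat).
Local Notation L := {vspace vT}.
Local Notation n := (\dim {: vT}).
Local Notation gbin := (q_binomial F).
Local Notation mu := (eig_up F n k).
Local Notation lam := (eig_dis F n k).
Implicit Types (S T U V X Y Z R H P : L) (f g : L -> rat) (h : nat -> L -> rat) (e i : nat).
Implicit Types (A : {set L}).
Hypotheses (kn : (2 * k <= n)%N) (tk : (t < k)%N).

Let kn1 : (k <= n)%N. Proof. lia. Qed.
Let tk1 : (t <= k)%N. Proof. lia. Qed.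

Definition tint A := (forall U, U \in A -> \dim U = k) /\
  (forall U V, U \in A -> V \in A -> (t <= \dim (U :&: V))%N).
Definition indic A U : rat := (U \in A)%:R.
Definition pencil T : {set L} := [set U | (\dim U == k) && (T <= U)%VS].

(* The interpolation makes theta vanish in degrees 1, ..., t, and theta 0 is
   computed from the pencil, for which the bound below is an equality. *)
Definition theta e : rat := 1 + lam e * (interp mu t (fun s => - (lam s)^-1)).[mu e].

Lemma theta0 e : (0 < e <= t)%N -> theta e = 0.
Proof.
move=> et; rewrite /theta interp_lam //.
by rewrite mulrN divff ?subrr // lam_neq0 //; lia.
Qed.

Lemma sum_ind A f : (forall U, U \in A -> \dim U = k) ->
  \sum_(U : L | \dim U == k) indic A U * f U = \sum_(U in A) f U.
Proof.
move=> dA; rewrite big_mkcond [RHS]big_mkcond; apply: eq_bigr => U _; rewrite /indic.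
case: (boolP (U \in A)) => [/dA->|]; first by rewrite eqxx mul1r.
by rewrite mul0r; case: ifP.
Qed.

Lemma card_ind A : (forall U, U \in A -> \dim U = k) ->
  \sum_(U : L | \dim U == k) indic A U = #|A|%:R.
Proof.
by move=> dA; rewrite -sumr_const -(sum_ind _ dA); apply: eq_bigr => U _; rewrite mulr1.
Qed.

Lemma ind_local A U : tint A -> U \in A ->
  forall X, \dim X = k -> indic A X != 0 -> (t <= \dim (X :&: U))%N.
Proof.
move=> [_ iA] UA X _; rewrite /indic; case: (boolP (X \in A)) => [XA _|]; first exact: iA.
by rewrite eqxx.
Qed.

(** Pair the indicator with its image under the whole operator: at a member the added part vanishes
    by [disop_pop_local], and orthogonality of the components leaves their squared norms. The case j
    = t is used for the pencil, j = k for arbitrary families. *)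
Lemma energy j h A : (t <= j)%N -> (j <= k)%N -> tint A -> hexpand k j (indic A) h ->
  #|A|%:R = \sum_(e < j.+1) theta e * \sum_(U : L | \dim U == k) hlift e (h e) U ^+ 2.
Proof.
move=> tj jk tA dec; have [dA iA] := tA.
pose G := interp mu t (fun s => - (lam s)^-1).
transitivity (\sum_(U : L | \dim U == k) indic A U * \sum_(e < j.+1) theta e * hlift e (h e) U).
  rewrite sum_ind // -sumr_const; apply: eq_bigr => U UA.
  have := disop_pop_local kn (size_interp _ _ _ : size G <= t)%N (ind_local tA UA).
  rewrite (disop_pop_dec kn jk dec _ (dA U UA)) => E.
  have : indic A U = 1 by rewrite /indic UA.
  case: (dec) => _ -> //; last exact: dA.
  move=> E1; rewrite -E1 -[LHS]addr0 -[X in _ + X]E -big_split.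
  by apply: eq_bigr => e _; rewrite /theta /= mulrDl mul1r.
transitivity (\sum_(U : L | \dim U == k) \sum_(e < j.+1) \sum_(e' < j.+1)
     theta e * (hlift e (h e) U * hlift e' (h e') U)).
  apply: eq_bigr => U /eqP dU; case: (dec) => _ -> //.
  rewrite mulr_sumr; apply: eq_bigr => e _.
  rewrite mulr_suml; apply: eq_bigr => e' _; ring.
rewrite exchange_big; apply: eq_bigr => e _.
rewrite exchange_big (bigD1 e) //= [X in _ + X]big1 ?addr0 => [|e' ee'].
  by rewrite mulr_sumr; apply: eq_bigr => U _; rewrite expr2.
rewrite -mulr_sumr lift_orth ?mulr0 //; try by have := ltn_ord e; have := ltn_ord e'; lia.
- by rewrite eq_sym.
- by case: dec => hh _; apply: hh; rewrite -ltnS.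
- by case: dec => hh _; apply: hh; rewrite -ltnS.
Qed.

Lemma energy0 j h A : (j <= k)%N -> (forall U, U \in A -> \dim U = k) -> hexpand k j (indic A) h ->
  gbin n k * (\sum_(U : L | \dim U == k) hlift 0 (h 0) U ^+ 2) = #|A|%:R ^+ 2.
Proof.
move=> jk dA dec; have := hdec_sum kn jk dec; rewrite card_ind // => ->.
rewrite -(card_kspaces vT k).
rewrite [X in _ * X](eq_bigr (fun=> h 0%N 0%VS ^+ 2 * 1)) => [|U _]; last by rewrite lift0E mulr1.
by rewrite -mulr_sumr; ring.
Qed.

Lemma tint_pencil T : \dim T = t -> tint (pencil T).
Proof.
move=> dT; split=> [U|U V]; rewrite !inE => /andP[/eqP dU TU] //.
by move=> /andP[/eqP dV TV]; rewrite -dT dimvS // (@subv_cap F) TU.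
Qed.

Lemma card_pencil T : \dim T = t -> #|pencil T|%:R = gbin (n - t) (k - t).
Proof. by move=> dT; rewrite -dT count_sup // dT. Qed.

Lemma degle_ind_pencil T : \dim T = t -> deg_le k t (indic (pencil T)).
Proof.
move=> dT; have := @degle_pencil F vT k t T; rewrite dT => /(_ (leqnn t) tk1).
by apply: degle_ext => // U dU; rewrite /indic inE dU eqxx.
Qed.

Let exT : exists T, \dim T = t.
Proof.
have tn : (t <= n)%N by lia.
by have [T _ dT] := exists_subspace tn; exists T.
Qed.

Lemma pencil_gt0 : 0 < gbin (n - t) (k - t).
Proof. by rewrite gbin_gt0 //; lia. Qed.

Lemma theta00 : theta 0 * gbin (n - t) (k - t) = gbin n k.
Proof.
have [T dT] := exT; have [h dec] := degle_ind_pencil dT.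
have := energy (leqnn t) tk1 (tint_pencil dT) dec.
have := energy0 tk1 (proj1 (tint_pencil dT)) dec.
rewrite card_pencil // big_ord_recl [X in _ + X]big1 ?addr0 => [|e _]; last first.
  by rewrite theta0 ?mul0r // lift0 /=; have := ltn_ord e; lia.
set s := \sum_(_ | _) _ => E1 E2.
have p0 := pencil_gt0; have p1 : gbin (n - t) (k - t) != 0 by rewrite gt_eqF.
apply: (mulIf p1); rewrite -mulrA -expr2 -E1 mulrCA -E2; ring.
Qed.

(** A ratio bound of Hoffman type: discarding the nonnegative terms of positive degree leaves theta
    0 times |A|^2 / [gbin n k], at most |A|, and [theta00] evaluates theta 0. *)
Theorem field_ekr_bound A : tint A -> #|A|%:R <= gbin (n - t) (k - t).
Proof.
move=> tA; have [h dec] := hdec_full k (indic A).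
have E := energy tk1 (leqnn k) tA dec.
have E0 := energy0 (leqnn k) (proj1 tA) dec.
have h1 : theta 0 * (\sum_(U : L | \dim U == k) hlift 0 (h 0) U ^+ 2) <= #|A|%:R.
  rewrite E big_ord_recl lerDl; apply: sumr_ge0 => e _; rewrite lift0 /=.
  case: (leqP e.+1 t) => et; first by rewrite theta0 ?mul0r.
  apply: mulr_ge0; last by apply: sumr_ge0 => U _; apply: sqr_ge0.
  by apply/ltW/theta_gt0 => //; have := ltn_ord e; lia.
have p0 := pencil_gt0; have g0 : 0 < gbin n k by rewrite gbin_gt0.
have h2 : #|A|%:R ^+ 2 <= #|A|%:R * gbin (n - t) (k - t).
  rewrite -E0 -theta00 [_ * gbin (n - t) (k - t)]mulrC -mulrA [X in _ <= X]mulrC.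
  by rewrite ler_pM2l.
case: (posnP #|A|) => [->|A0]; first exact: ltW.
by move: h2; rewrite expr2 ler_pM2l // ltr0n.
Qed.

(** In the equality case the discarded terms are all zero, and theta is positive beyond degree t, so
    these components of the indicator vanish. *)
Lemma extremal_degle A : tint A -> #|A|%:R = gbin (n - t) (k - t) -> deg_le k t (indic A).
Proof.
move=> tA cA; have [h dec] := hdec_full k (indic A).
have E := energy tk1 (leqnn k) tA dec.
have E0 := energy0 (leqnn k) (proj1 tA) dec.
have p0 := pencil_gt0; have g0 : 0 < gbin n k by rewrite gbin_gt0.
have h1 : theta 0 * (\sum_(U : L | \dim U == k) hlift 0 (h 0) U ^+ 2) = #|A|%:R.
  have p1 : gbin (n - t) (k - t) != 0 by rewrite gt_eqF.
  by apply: (mulIf p1); rewrite mulrAC theta00 E0 cA expr2.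
have tS e : 0 <= theta e.+1 * (\sum_(U : L | \dim U == k) hlift e.+1 (h e.+1) U ^+ 2) \/ (k <= e)%N.
  case: (leqP k e) => ke; [by right | left].
  case: (leqP e.+1 t) => et; first by rewrite theta0 ?mul0r.
  apply: mulr_ge0; last by apply: sumr_ge0 => U _; apply: sqr_ge0.
  by apply/ltW/theta_gt0 => //; lia.
have S0 e U : (t < e)%N -> (e <= k)%N -> \dim U = k -> hlift e (h e) U = 0.
  case: e => // e te ek dU.
  move: E; rewrite big_ord_recl h1 -[LHS]addr0 => /addrI/esym E.
  have pos (i : 'I_k) : true -> 0 <= theta (fintype.lift ord0 i) *
      (\sum_(U : L | \dim U == k) hlift (fintype.lift ord0 i) (h (fintype.lift ord0 i)) U ^+ 2).
    by move=> _; rewrite lift0; case: (tS i) => //; have := ltn_ord i; lia.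
  have /eqP := psumr_eq0P pos E (i := Ordinal ek) isT.
  rewrite lift0 /=.
  rewrite mulf_eq0 gt_eqF /=; last exact: theta_gt0.
  move=> /eqP H2; apply/eqP; rewrite -sqrf_eq0; apply/eqP.
  by apply: (psumr_eq0P _ H2 (i := U)) => [V _|]; [apply: sqr_ge0 | apply/eqP].
exists h; case: dec => hh fE; split=> [e et|U dU]; first by apply: hh; lia.
rewrite fE // -(subnKC (_ : t.+1 <= k.+1)%N) ?big_split_ord //=.
rewrite [X in _ + X]big1 ?addr0 // => e _; apply: S0 => //; have := ltn_ord e; lia.
Qed.

End FieldEKR.

(** * Intersecting families over a field: equality *)

Section FieldExtremal.
Variables (F : finFieldType) (vT : vectType (F : fieldType)) (k t : nat).
Local Notation L := {vspace vT}.
Local Notation n := (\dim {: vT}).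
Local Notation qint := (q_int F).
Local Notation gbin := (q_binomial F).
Local Notation mu := (eig_up F n k).
Local Notation lam := (eig_dis F n k).
Local Notation upop := (@shadow_op F vT k).
Local Notation disop := (@disjoint_op F vT k).
Local Notation ptop := (@point_op F vT k).
Local Notation tint := (@tint F vT k t).
Local Notation pencil := (@pencil F vT k).
Implicit Types (S T U V X Y Z R H P : L) (f g : L -> rat) (h : nat -> L -> rat) (e i : nat).
Implicit Types (A B : {set L}).
Hypotheses (kn : (2 * k <= n)%N) (tk : (t < k)%N).

Let kn1 : (k <= n)%N. Proof. lia. Qed.
Let tk1 : (t <= k)%N. Proof. lia. Qed.

(** By [local_functional] the value at a member depends on the family only through its cardinality.
    The same argument with other eigenvalues gives the versions for points and for disjointness
    below. *)
Lemma eq_upop_extremal A B U U' : tint A -> tint B -> deg_le k t (indic A) -> deg_le k t (indic B) ->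
  #|A| = #|B| -> U \in A -> U' \in B -> upop (indic A) U = upop (indic B) U'.
Proof.
move=> tA tB [hA dA] [hB dB] AB UA UB.
have [beta H] := local_functional kn mu tk1.
rewrite (upop_dec kn tk1 dA (proj1 tA U UA)) (upop_dec kn tk1 dB (proj1 tB U' UB)).
rewrite (H _ _ _ dA (proj1 tA U UA) (ind_local tA UA)).
rewrite (H _ _ _ dB (proj1 tB U' UB) (ind_local tB UB)).
by rewrite !card_ind ?AB //; [apply: (proj1 tB) | apply: (proj1 tA)].
Qed.

Lemma ptop_dec j f h U : (0 < k)%N -> (j <= k)%N -> hexpand k j f h -> \dim U = k ->
  ptop f U = \sum_(e < j.+1) eig_pt vT k e * hlift e (h e) U.
Proof.
move=> k0 jk [hh fE] dU; rewrite (eq_ptop (g := fun X => \sum_(e < j.+1) 1 * hlift e (h e) X)).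
  rewrite ptop_sum; apply: eq_bigr => e _; have ej := ltn_ord e.
  by rewrite mul1r ptop_lift //; [apply: hh; lia | lia].
by move=> X dX; rewrite fE //; apply: eq_bigr => e _; rewrite mul1r.
Qed.

Lemma eq_ptop_extremal A B U U' : tint A -> tint B -> deg_le k t (indic A) -> deg_le k t (indic B) ->
  #|A| = #|B| -> U \in A -> U' \in B -> ptop (indic A) U = ptop (indic B) U'.
Proof.
move=> tA tB [hA dA] [hB dB] AB UA UB.
have k0 : (0 < k)%N by lia.
have [beta H] := local_functional kn (eig_pt vT k) tk1.
rewrite (ptop_dec k0 tk1 dA (proj1 tA U UA)) (ptop_dec k0 tk1 dB (proj1 tB U' UB)).
rewrite (H _ _ _ dA (proj1 tA U UA) (ind_local tA UA)).
rewrite (H _ _ _ dB (proj1 tB U' UB) (ind_local tB UB)).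
by rewrite !card_ind ?AB //; [apply: (proj1 tB) | apply: (proj1 tA)].
Qed.

Lemma disop_iter_dec j f h i U : (j <= k)%N -> hexpand k j f h -> \dim U = k ->
  disop (iter i upop f) U = \sum_(e < j.+1) lam e * mu e ^+ i * hlift e (h e) U.
Proof.
move=> jk dec dU; have [hh fE] := dec.
rewrite (eq_disop (g := fun X => \sum_(e < j.+1) mu e ^+ i * hlift e (h e) X)).
  rewrite disop_sum; apply: eq_bigr => e _; have ej := ltn_ord e.
  by rewrite disop_lift //; [ring | apply: hh; lia | lia].
by move=> X dX; rewrite (iter_upop_dec kn jk dec).
Qed.

Lemma eq_disop_extremal A B U U' i : tint A -> tint B -> deg_le k t (indic A) -> deg_le k t (indic B) ->
  #|A| = #|B| -> U \in A -> U' \in B ->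
  disop (iter i upop (indic A)) U = disop (iter i upop (indic B)) U'.
Proof.
move=> tA tB [hA dA] [hB dB] AB UA UB.
have [beta H] := local_functional kn (fun e => lam e * mu e ^+ i) tk1.
rewrite (disop_iter_dec i tk1 dA (proj1 tA U UA)) (disop_iter_dec i tk1 dB (proj1 tB U' UB)).
rewrite (H _ _ _ dA (proj1 tA U UA) (ind_local tA UA)).
rewrite (H _ _ _ dB (proj1 tB U' UB) (ind_local tB UB)).
by rewrite !card_ind ?AB //; [apply: (proj1 tB) | apply: (proj1 tA)].
Qed.

(* Multiplication by common_pts V raises the degree by one, which makes
   local_functional_succ available for weighted families. *)
Definition common_pts V X : rat := #|[set P : L | [&& \dim P == 1%N, P <= V & P <= X]%VS]|%:R.

Lemma nptsE V X : common_pts V X = qint (\dim (X :&: V)).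
Proof.
rewrite -gbin1 -count_sub; congr (_%:R); apply: eq_card => P; rewrite !inE.
by rewrite (@subv_cap F) [(P <= X)%VS && _]andbC.
Qed.

Lemma sum_npts f V : \sum_(X : L | \dim X == k) f X * common_pts V X = ptop f V.
Proof.
rewrite /point_op.
transitivity (\sum_(P : L | (\dim P == 1%N) && (P <= V)%VS)
   \sum_(X : L | (\dim X == k) && (P <= X)%VS) f X); last by [].
rewrite (exchange_incl (fun P : L => (\dim P == 1%N) && (P <= V)%VS) (fun X : L => \dim X == k)
  (fun X P => (P <= X)%VS)).
by apply: eq_bigr => X _; congr (_ * _%:R); apply: eq_card => P; rewrite !inE andbA.
Qed.

(** Containing S and containing a point P together mean containing S + P, whose dimension is at most
    t + 1; so the product is a combination of pencil indicators. *)
Lemma degle_npts f V : deg_le k t f -> deg_le k t.+1 (fun X => f X * common_pts V X).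
Proof.
move=> [h [hh fE]].
pose I : finType := ('I_t.+1 * (L * L))%type.
pose c (i : I) : rat := [&& \dim i.2.1 == i.1, \dim i.2.2 == 1%N & (i.2.2 <= V)%VS]%:R * h i.1 i.2.1.
pose g (i : I) X : rat := if (\dim (i.2.1 + i.2.2) <= t.+1)%N then (i.2.1 + i.2.2 <= X)%VS%:R else 0.
have dg (x : I) : deg_le k t.+1 (g x).
  rewrite /g; case: leqP => d; last exact: degle0.
  by apply: degle_pencil => //; lia.
apply: degle_ext (degle_sum (index_enum I) c dg) => X dX.
rewrite fE // -(pair_big xpredT xpredT (fun (e : 'I_t.+1) (p : L * L) => c (e, p) * g (e, p) X)) /=.
rewrite mulr_suml; apply: eq_bigr => e _.
rewrite -(pair_big xpredT xpredT (fun S P : L => c (e, (S, P)) * g (e, (S, P)) X)) /=.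
rewrite /hlift mulr_suml big_mkcond [RHS]big_mkcond; apply: eq_bigr => S _.
case: ifP => [/andP[/eqP dS SX]|nS].
  rewrite /common_pts -sum1_card natr_sum mulr_sumr [RHS]big_mkcond [LHS]big_mkcond.
  apply: eq_bigr => P _; rewrite inE /c /g /= dS eqxx /= subv_add SX.
  case: eqP => dP //=; rewrite ?mul0r //; case: (boolP (P <= V)%VS); rewrite ?mul0r //= mul1r.
  have := dimv_sum_cap S P; rewrite dS dP => dSP; have et := ltn_ord e.
  by case: leqP => h1; [case: (P <= X)%VS; rewrite ?mulr1 ?mulr0 | lia].
rewrite big1 // => P _; rewrite /c /g /= subv_add.
case: eqP => dS /=; last by rewrite !mul0r.
rewrite dS eqxx /= in nS; rewrite nS /= ; case: ifP; rewrite ?mulr0 //.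
Qed.

(** The two quantities left by [local_functional_succ] agree: the value at U is determined by dim (U
    :&: V), and the total weight is the point operator at V, covered by [eq_ptop_extremal]. *)
Lemma eq_upop_npts_extremal A B U V U' V' : tint A -> tint B ->
  deg_le k t (indic A) -> deg_le k t (indic B) -> #|A| = #|B| ->
  U \in A -> V \in A -> U' \in B -> V' \in B -> \dim (U :&: V) = \dim (U' :&: V') ->
  upop (fun X => indic A X * common_pts V X) U = upop (fun X => indic B X * common_pts V' X) U'.
Proof.
move=> tA tB dA dB AB UA VA UB VB d.
have [alpha [beta H]] := local_functional_succ kn mu tk.
have [hA decA] := degle_npts V dA; have [hB decB] := degle_npts V' dB.
have loc C W W' : tint C -> W \in C -> forall X, \dim X = k -> indic C X * common_pts W' X != 0 ->
    (t <= \dim (X :&: W))%N.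
  move=> tC WC X dX h0; apply: (ind_local tC WC) => //.
  by apply: contraNneq h0 => ->; rewrite mul0r.
rewrite (upop_dec kn tk decA (proj1 tA U UA)) (upop_dec kn tk decB (proj1 tB U' UB)).
rewrite (H _ _ _ decA (proj1 tA U UA) (loc A U V tA UA)).
rewrite (H _ _ _ decB (proj1 tB U' UB) (loc B U' V' tB UB)).
by rewrite !sum_npts (eq_ptop_extremal tA tB dA dB AB VA VB) /indic UA UB !nptsE d.
Qed.

Variable A : {set L}.
Hypotheses (tA : tint A) (cA : #|A|%:R = gbin (n - t) (k - t)).

Let dA : deg_le k t (indic A). Proof. exact: extremal_degle. Qed.
Let dimA U : U \in A -> \dim U = k. Proof. exact: (proj1 tA). Qed.
Let intA U V : U \in A -> V \in A -> (t <= \dim (U :&: V))%N. Proof. exact: (proj2 tA). Qed.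

Let card_pencilA T : \dim T = t -> #|A| = #|pencil T|.
Proof.
move=> dT; apply/eqP; rewrite -(eqr_nat rat) cA; apply/eqP.
by rewrite (@card_pencil F vT k t).
Qed.

(** Compare A with the pencil through T = U :&: V, weighting each neighbour X of U by its excess of
    points on V over [qint t]. A neighbour with positive excess contains T, so term by term A
    contributes no more than the pencil. The totals agree, hence so do the terms, and every
    neighbour with positive excess belongs to A. *)
Lemma extremal_close U V X H : U \in A -> V \in A -> \dim (U :&: V) = t ->
  \dim X = k -> (\dim H).+1 = k -> (H <= U)%VS -> (H <= X)%VS -> (t < \dim (X :&: V))%N ->
  X \in A.
Proof.
move=> UA VA dT dX dH HU HX tXV; set T := (U :&: V)%VS in dT.
have tP := @tint_pencil F vT k t T dT.
have dP := degle_ind_pencil kn tk dT.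
have UP : U \in pencil T by rewrite inE dimA ?eqxx ?capvSl.
have VP : V \in pencil T by rewrite inE dimA ?eqxx ?capvSr.
have E1 := eq_upop_extremal tA tP dA dP (card_pencilA dT) UA UP.
have E2 := eq_upop_npts_extremal tA tP dA dP (card_pencilA dT) UA VA UP VP erefl.
have gsum C : upop (fun X => indic C X * (common_pts V X - qint t)) U =
    upop (fun X => indic C X * common_pts V X) U - qint t * upop (indic C) U.
  rewrite /shadow_op mulr_sumr -sumrB; apply: eq_bigr => H' _.
  rewrite mulr_sumr -sumrB; apply: eq_bigr => X' _; ring.
have inT H' X' : (\dim H').+1 = k -> (H' <= U)%VS -> (H' <= X')%VS -> \dim X' = k ->
    (t < \dim (X' :&: V))%N -> (T <= X')%VS.
  move=> dH' HU' HX' dX' lt1.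
  have l1 := dimv_cap_hyper HX' (etrans dH' (esym dX')) (capvSl X' V).
  have l2 : (X' :&: V :&: H' <= T)%VS.
    rewrite /T (@subv_cap F) (subv_trans (capvSr _ _) HU') /=.
    exact: subv_trans (capvSl _ _) (capvSr _ _).
  have /eqP <- : (X' :&: V :&: H')%VS == T by rewrite eqEdim l2 dT -ltnS (leq_trans lt1).
  exact: subv_trans (capvSl _ _) (capvSl _ _).
have : upop (fun X => indic (pencil T) X * (common_pts V X - qint t) -
                      indic A X * (common_pts V X - qint t)) U = 0.
  have -> : upop (fun X => indic (pencil T) X * (common_pts V X - qint t) -
      indic A X * (common_pts V X - qint t)) U =
      upop (fun X => indic (pencil T) X * (common_pts V X - qint t)) U -
      upop (fun X => indic A X * (common_pts V X - qint t)) U.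
    rewrite /shadow_op -sumrB; apply: eq_bigr => H' _; by rewrite sumrB.
  by rewrite !gsum E1 E2 subrr.
have ge0 H' X' : ((\dim H').+1 == k) && (H' <= U)%VS -> (\dim X' == k) && (H' <= X')%VS ->
    0 <= indic (pencil T) X' * (common_pts V X' - qint t) - indic A X' * (common_pts V X' - qint t).
  move=> /andP[/eqP dH' HU'] /andP[/eqP dX' HX'].
  rewrite -mulrBl nptsE.
  have PX : X' \in pencil T -> (t <= \dim (X' :&: V))%N by move=> XP; apply: (proj2 tP).
  case: (boolP (X' \in A)) => XA; last first.
    rewrite /indic (negPf XA) subr0; case: (boolP (X' \in _)) => XP; last by rewrite mul0r.
    by rewrite mul1r subr_ge0 ler_qint PX.
  have := intA XA VA; rewrite leq_eqVlt => /orP[/eqP<-|lt1]; first by rewrite subrr mulr0.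
  by rewrite /indic XA inE dX' eqxx (inT H') // subrr mul0r.
move=> E; have E3 : \sum_(X' : L | (\dim X' == k) && (H <= X')%VS)
   (indic (pencil T) X' * (common_pts V X' - qint t) - indic A X' * (common_pts V X' - qint t)) = 0.
  apply: (psumr_eq0P _ E (i := H)) => [H' hH'|]; last by rewrite dH eqxx.
  by apply: sumr_ge0 => X' hX'; apply: ge0 hX'.
have hH : ((\dim H).+1 == k) && (H <= U)%VS by rewrite dH eqxx.
have E4 : indic (pencil T) X * (common_pts V X - qint t) - indic A X * (common_pts V X - qint t) = 0.
  apply: (psumr_eq0P _ E3 (i := X)) => [X' hX'|]; last by rewrite dX eqxx.
  exact: ge0 hX'.
apply: contraPT E4 => XA; apply/eqP; rewrite /indic (negPf XA) inE dX eqxx.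
by rewrite (inT H X) //= mul0r subr0 mul1r subr_eq0 nptsE gt_eqF // ltr_qint.
Qed.

(** If the traces on U differ, take a hyperplane H of U that contains the first but not the second.
    For v in V1 outside U, the space H + <v> is in A by [extremal_close]. It meets V2 in dimension
    at least t while H does not, so some w + c v with w in H and c nonzero lies in V2, and v is in U
    + V2. *)
Lemma extremal_dichotomy U V1 V2 : U \in A -> V1 \in A -> V2 \in A ->
  \dim (U :&: V1) = t -> \dim (U :&: V2) = t ->
  (U :&: V1 = U :&: V2)%VS \/ (U + V1 = U + V2)%VS.
Proof.
move=> UA VA1 VA2 d1 d2.
have dY V : V \in A -> \dim (U :&: V) = t -> \dim (U + V) = (2 * k - t)%N.
  move=> VA d; have := dimv_sum_cap U V; rewrite d (dimA UA) (dimA VA); lia.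
case: (eqVneq (U :&: V1)%VS (U :&: V2)%VS) => T12; [by left | right].
have [x xT2 xT1] : exists2 x, x \in (U :&: V2)%VS & x \notin (U :&: V1)%VS.
  apply/subvPn; apply: contra T12 => T21.
  by rewrite eq_sym eqEdim T21 d1 d2 leqnn.
have xU : x \in U by move: xT2; rewrite memv_cap => /andP[].
have [H [TH HU dH xH]] := exists_hyper (capvSl U V1) xU xT1.
rewrite (dimA UA) in dH.
suff V1Y : (V1 <= U + V2)%VS.
  by apply/eqP; rewrite eqEdim subv_add addvSl V1Y (dY V1) // (dY V2) /=.
apply/subvP => v vV1; case: (boolP (v \in U)) => vU.
  by rewrite (subvP (addvSl _ _)).
have vH : v \notin H by apply: contra vU; apply: subvP.
pose X := (H + <[v]>)%VS.
have dX : \dim X = k by rewrite dimv_add_line.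
have XA : X \in A.
  apply: (extremal_close UA VA1 d1 dX dH HU); first exact: addvSl.
  have vT1 : v \notin (U :&: V1)%VS by rewrite memv_cap (negPf vU).
  rewrite -d1 -(dimv_add_line vT1) dimvS // (@subv_cap F) !subv_add.
  rewrite (subv_trans TH (addvSl _ _)) addvSr capvSr /=.
  by apply/subvP => y /vlineP[a ->]; rewrite memvZ.
have := intA XA VA2 => lt1.
have lt2 : (\dim (H :&: V2) < t)%N.
  rewrite -d2 ltnNge; apply: contra xH => le1.
  have HT : (H :&: V2 <= U :&: V2)%VS by apply: capvS.
  have /eqP E : (H :&: V2)%VS == (U :&: V2)%VS by rewrite eqEdim HT.
  by move: xT2; rewrite -E memv_cap => /andP[].
have [y yX yH] : exists2 y, y \in (X :&: V2)%VS & y \notin (H :&: V2)%VS.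
  by apply/subvPn; apply: contraL lt2 => /dimvS le1; rewrite -leqNgt (leq_trans lt1).
move: yX; rewrite memv_cap => /andP[/memv_addP[w wH [z /vlineP[c ->] yE]] yV2].
have c0 : c != 0.
  by apply: contraNneq yH => c0; rewrite memv_cap yV2 andbT yE c0 scale0r addr0.
have -> : v = c^-1 *: (- w + y) by rewrite yE addKr scalerA mulVf // scale1r.
by rewrite memvZ // memv_add // rpredN (subvP HU).
Qed.

End FieldExtremal.

(** * From the members at minimal intersection to the whole family *)

Section FieldClassification.
Variables (F : finFieldType) (vT : vectType (F : fieldType)) (k t : nat).
Local Notation L := {vspace vT}.
Local Notation n := (\dim {: vT}).
Local Notation q := #|F|.
Local Notation qint := (q_int F).
Local Notation qcomp := (q_comp F).
Local Notation qfact := (q_fact F).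
Local Notation gbin := (q_binomial F).
Local Notation upop := (@shadow_op F vT k).
Local Notation disop := (@disjoint_op F vT k).
Local Notation tint := (@tint F vT k t).
Local Notation pencil := (@pencil F vT k).
Implicit Types (S T U V X Y Z R H P : L) (f g : L -> rat) (e i j : nat).
Implicit Types (A B : {set L}).
Hypotheses (kn : (2 * k <= n)%N) (tk : (t < k)%N).

Lemma count_hyper S V : (S <= V)%VS ->
  #|[set H : L | [&& (\dim H).+1 == \dim V, S <= H & H <= V]%VS]|%:R = qint (\dim V - \dim S).
Proof.
move=> SV; case: (ltnP (\dim S) (\dim V)) => d; last first.
  have -> : (\dim V - \dim S = 0)%N by lia.
  rewrite qint0 (_ : [set H | _] = set0) ?cards0 //; apply/setP => H; rewrite !inE.
  by apply/negP => /and3P[/eqP dH /dimvS SH _]; lia.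
rewrite -gbin1 -gbin_sym; last by lia.
rewrite -count_btw //; congr (_%:R); apply: eq_card => H; rewrite !inE; congr andb.
by apply/eqP/eqP; lia.
Qed.

(** The first factor counts the X through a (k-1)-space H with X :&: U = H :&: U of dimension j; the
    second counts the hyperplanes H of V that do not contain V :&: U, of dimension j + 1. *)
Definition kappa j : rat := (qint (n - k).+1 - qint (k - j)) * (qint k - qint (k - j.+1)).

Lemma kappa_neq0 j : (j < k)%N -> kappa j != 0.
Proof. by move=> jk; rewrite mulf_neq0 // gt_eqF // subr_gt0 ltr_qint; lia. Qed.

(** As f lives on intersections larger than j, a step V, H, X that ends at dimension j must start at
    dimension j + 1, with H and X having the same trace on U. *)
Lemma level_step j f U : \dim U = k -> (j < k)%N ->
  (forall V, \dim V = k -> f V != 0 -> (j < \dim (V :&: U))%N) ->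
  \sum_(X : L | (\dim X == k) && (\dim (X :&: U) == j)) upop f X =
  kappa j * \sum_(V : L | (\dim V == k) && (\dim (V :&: U) == j.+1)) f V.
Proof.
move=> dU jk fU; rewrite /shadow_op.
transitivity (\sum_(X : L | (\dim X == k) && (\dim (X :&: U) == j))
   \sum_(H : L | ((\dim H).+1 == k) && (H <= X)%VS)
      \sum_(V : L | (\dim V == k) && (H <= V)%VS) f V); first by [].
rewrite (exchange_incl (fun X : L => (\dim X == k) && (\dim (X :&: U) == j))
  (fun H : L => (\dim H).+1 == k) (fun H X => (H <= X)%VS)).
transitivity (\sum_(H : L | ((\dim H).+1 == k) && (\dim (H :&: U) == j))
   (qint (n - k).+1 - qint (k - j)) * \sum_(V : L | (\dim V == k) && (H <= V)%VS) f V).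
  rewrite big_mkcond [RHS]big_mkcond; apply: eq_bigr => H _; case: eqP => //= dH.
  case: (ltngtP (\dim (H :&: U)) j) => d.
  - rewrite big1 ?mul0r // => V /andP[/eqP dV HV]; apply/eqP; apply: contraTT isT => /(fU V dV).
    have := dimv_cap_hyper HV (etrans dH (esym dV)) (capvSl V U).
    have : (\dim (V :&: U :&: H) <= \dim (H :&: U))%N.
      by rewrite dimvS // (@subv_cap F) capvSr (subv_trans (capvSl _ _) (capvSr _ _)).
    lia.
  - rewrite (_ : [set X | _] = set0) ?cards0 ?mulr0 //; apply/setP => X; rewrite !inE.
    apply/negP => /andP[/andP[/eqP dX /eqP dXU] HX].
    have : (\dim (H :&: U) <= \dim (X :&: U))%N by rewrite dimvS // capvS.
    lia.
  rewrite mulrC; congr (_ * _).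
  have := count_ext1 (subvf H) (subvf U); rewrite dU d; have -> : (n - \dim H = (n - k).+1)%N by lia.
  move=> <-; congr (_%:R); apply: eq_card => X; rewrite !inE dH subvf /= -andbA.
  case: (\dim X == k) => //=; rewrite andbC; case: (boolP (H <= X)%VS) => //= HX.
  apply/eqP/eqP => [dX|-> //].
  by apply/esym/eqP; rewrite eqEdim capvS //= d dX.
rewrite -mulr_sumr /kappa -mulrA; congr (_ * _).
transitivity (\sum_(H : L | ((\dim H).+1 == k) && (\dim (H :&: U) == j))
      \sum_(V : L | (\dim V == k) && (H <= V)%VS) f V); first by [].
rewrite (exchange_incl (fun H : L => ((\dim H).+1 == k) && (\dim (H :&: U) == j))
  (fun V : L => \dim V == k) (fun V H => (H <= V)%VS)).
rewrite mulr_sumr big_mkcond [RHS]big_mkcond; apply: eq_bigr => V _.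
case: eqP => //= dV.
case: (eqVneq (f V) 0) => [->|fV0]; first by rewrite mul0r mulr0 if_same.
have := fU V dV fV0; rewrite leq_eqVlt => /orP[/eqP d | d]; last first.
  rewrite gtn_eqF // (_ : [set X | _] = set0) ?cards0 ?mulr0 //; apply/setP => H; rewrite !inE.
  apply/negP => /andP[/andP[/eqP dH /eqP dHU] HV].
  have := dimv_cap_hyper HV (etrans dH (esym dV)) (capvSl V U).
  have : (\dim (V :&: U :&: H) <= \dim (H :&: U))%N.
    by rewrite dimvS // (@subv_cap F) capvSr (subv_trans (capvSl _ _) (capvSr _ _)).
  lia.
rewrite -d eqxx mulrC; congr (_ * _).
have h1 := count_hyper (sub0v V); have h2 := count_hyper (capvSl V U).
rewrite dV dimv0 subn0 in h1; rewrite dV -d in h2.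
rewrite -h1 -h2; apply: (canRL (addrK _)); rewrite -natrD; congr (_%:R).
rewrite -(cardsID [set H : L | (V :&: U <= H)%VS] [set H : L | [&& (\dim H).+1 == k, (0 <= H) & (H <= V)]%VS]).
rewrite addnC; congr (_ + _)%N; apply: eq_card => H; rewrite !inE sub0v /=.
  by rewrite -andbA; congr andb; rewrite andbC.
rewrite -andbA andbCA; case: (eqVneq (\dim H).+1 k) => dH; rewrite ?andbF //=.
case: (boolP (H <= V)%VS) => HV; last by rewrite !andbF.
rewrite !andbT; have hh := dimv_cap_hyper HV (etrans dH (esym dV)) (capvSl V U).
have e1 : (V :&: U :&: H = H :&: U)%VS.
  by rewrite -capvA [(U :&: H)%VS]capvC capvA (capv_idPr HV).
rewrite e1 in hh; apply/eqP/idP => [dHU | VUH].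
  apply/negP => VUH; have : (\dim (V :&: U) <= \dim (H :&: U))%N.
    by rewrite dimvS // (@subv_cap F) VUH capvSr.
  lia.
have le : (\dim (H :&: U) <= \dim (V :&: U))%N by rewrite dimvS // capvS.
have ne : \dim (H :&: U) != \dim (V :&: U).
  apply: contra VUH => /eqP E; have /eqP <- : (H :&: U)%VS == (V :&: U)%VS.
    by rewrite eqEdim capvS //= E.
  exact: capvSl.
lia.
Qed.

(** Each shadow step lowers the minimal intersection with U by one; after i steps the lowest level
    has become disjointness from U. *)
Lemma level_iter i f U : \dim U = k -> (i <= k)%N ->
  (forall V, \dim V = k -> f V != 0 -> (i <= \dim (V :&: U))%N) ->
  disop (iter i upop f) U = (\prod_(j < i) kappa j) *
    \sum_(V : L | (\dim V == k) && (\dim (V :&: U) == i)) f V.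
Proof.
move=> dU; elim: i f => [|i IH] f ik fU.
  by rewrite big_ord0 mul1r; apply: eq_bigl => X; rewrite dimv_eq0.
rewrite iterSr IH; [ | lia |].
  by rewrite level_step // mulrA big_ord_recr.
move=> V dV; apply: contraR; rewrite -ltnNge => d; apply/eqP.
apply: big1 => H /andP[/eqP dH HV]; apply: big1 => X /andP[/eqP dX HX].
apply/eqP; apply: contraTT isT => /(fU X dX).
have := dimv_cap_hyper HX (etrans dH (esym dX)) (capvSl X U).
have : (\dim (X :&: U :&: H) <= \dim (V :&: U))%N.
  rewrite dimvS // (@subv_cap F) (subv_trans (capvSr _ _) HV) /=.
  exact: subv_trans (capvSl _ _) (capvSr _ _).
lia.
Qed.

Lemma qcomp_shift c a w : (w <= a)%N -> qcomp (c + a) c w = (q%:R ^+ c) ^+ w * qcomp a 0 w.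
Proof.
move=> wa; rewrite /q_comp -[X in _ ^+ X](card_ord w) -prodr_const -big_split /=.
apply: eq_bigr => i _; have iw := ltn_ord i; rewrite qint0 subr0 -addnBA; last by lia.
by rewrite qintD addrK.
Qed.

Lemma ltr_gbin a b w : (w <= a)%N -> (0 < w)%N -> (gbin a w < gbin b w) = (a < b)%N.
Proof.
move=> wa w0.
have mono c d : (w <= c)%N -> (c <= d)%N -> gbin c w <= gbin d w.
  move=> wc cd; rewrite /q_binomial ler_pM2r ?invr_gt0 ?qfact_gt0 //.
  apply: ler_prod => i _; have iw := ltn_ord i; rewrite qint0 !subr0 ler_qint.
  by rewrite ltW ?qint_gt0 /=; lia.
case: (ltnP a b) => ab; last first.
  apply/negbTE; rewrite -leNgt; case: (leqP w b) => wb; first exact: mono.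
  by rewrite gbin_small // ltW // gbin_gt0.
rewrite /q_binomial ltr_pM2r ?invr_gt0 ?qfact_gt0 //; case: w w0 wa mono => // w _ wa mono.
rewrite !qcompS qint0 !subr0.
apply: (@lt_le_trans _ _ (qint b * qcomp a.-1 0 w)).
  rewrite ltr_pM2r ?ltr_qint //; apply: prodr_gt0 => i _; have iw := ltn_ord i.
  by rewrite qint0 subr0 qint_gt0; lia.
rewrite ler_pM2l ?qint_gt0; last by lia.
apply: ler_prod => i _; have iw := ltn_ord i; rewrite qint0 !subr0 ler_qint.
by rewrite ltW ?qint_gt0 /=; lia.
Qed.

Variable A : {set L}.
Hypotheses (tA : tint A) (cA : #|A|%:R = gbin (n - t) (k - t)).

Let dA : deg_le k t (indic A). Proof. exact: extremal_degle. Qed.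
Let dimA U : U \in A -> \dim U = k. Proof. exact: (proj1 tA). Qed.
Let intA U V : U \in A -> V \in A -> (t <= \dim (U :&: V))%N. Proof. exact: (proj2 tA). Qed.

Definition far U : {set L} := [set V in A | \dim (V :&: U) == t].

Lemma card_complements U T : \dim U = k -> \dim T = t -> (T <= U)%VS ->
  #|[set V : L | (\dim V == k) && (V :&: U == T)%VS]|%:R = qcomp (n - t) (k - t) (k - t) / qfact (k - t).
Proof.
move=> dU dT TU; have := count_ext (k - t) (subvf T) (subvf U).
rewrite (capv_idPl TU) dU dT => <-; congr (_%:R); apply: eq_card => V.
rewrite !inE subvf subnKC 1?ltnW //=; congr andb.
by case: eqP => [<-|]; rewrite ?andbF ?capvSl.
Qed.

(** [level_iter] with i = t turns this number into a disjointness count, which is the same for a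
    pencil through some T <= U; there the far members are the V with V :&: U = T. *)
Lemma card_far U : U \in A -> #|far U|%:R = qcomp (n - t) (k - t) (k - t) / qfact (k - t).
Proof.
move=> UA; have dU := dimA UA; have tU : (t <= \dim U)%N by rewrite dU ltnW.
have [T TU dT] := exists_subspace tU.
have tP := @tint_pencil F vT k t T dT.
have dP := degle_ind_pencil kn tk dT.
have UP : U \in pencil T by rewrite inE dU eqxx.
have AP : #|A| = #|pencil T|.
  by apply/eqP; rewrite -(eqr_nat rat) cA (@card_pencil F vT k t).
have := eq_disop_extremal kn tk t tA tP dA dP AP UA UP.
rewrite (level_iter dU (ltnW tk) (ind_local tA UA)).
rewrite (level_iter dU (ltnW tk) (ind_local tP UP)).
have K0 : \prod_(j < t) kappa j != 0.
  by apply/prodf_neq0 => j _; apply: kappa_neq0; have := ltn_ord j; lia.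
move/(mulfI K0); rewrite -(card_complements dU dT TU).
have E B : (forall V, V \in B -> \dim V = k) ->
    \sum_(V : L | (\dim V == k) && (\dim (V :&: U) == t)) indic B V =
    #|[set V in B | \dim (V :&: U) == t]|%:R.
  move=> dB; rewrite -sum1_card natr_sum big_mkcond [RHS]big_mkcond.
  apply: eq_bigr => V _; rewrite inE /indic; case: (boolP (V \in B)) => [/dB->|_].
    by rewrite eqxx.
  by rewrite if_same.
rewrite !E; [|exact: (proj1 tP) | exact: dimA].
move=> ->; congr (_%:R); apply: eq_card => V; rewrite !inE -andbA; congr andb.
apply/andP/eqP => [[TV /eqP dVU] | VU].
  by apply/eqP; rewrite eq_sym eqEdim (@subv_cap F) TV TU dT dVU /=.
by rewrite -[in X in (X <= V)%VS]VU capvSl VU dT.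
Qed.

Lemma far_neq0 U : U \in A -> exists V, V \in far U.
Proof.
move=> UA; have c0 : 0 < #|far U|%:R :> rat.
  rewrite card_far // divr_gt0 ?qfact_gt0 // qcomp_gt0 //; lia.
by apply/set0Pn; rewrite -card_gt0 -(ltr0n rat).
Qed.

(** If V1 and V0 have different traces on U, they have the same sum with U. Any other V differs in
    trace from V0 or from V1, so it has this sum too. *)
Lemma far_same U : U \in A -> exists V0, V0 \in far U /\
  ((forall V, V \in far U -> (V :&: U = V0 :&: U)%VS) \/
   (forall V, V \in far U -> (U + V = U + V0)%VS)).
Proof.
move=> UA; have [V0 V0f] := far_neq0 UA; exists V0; split=> //.
have inf V : V \in far U -> V \in A /\ \dim (U :&: V) = t.
  by rewrite inE => /andP[VA /eqP d]; rewrite capvC.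
have dich V V' : V \in far U -> V' \in far U ->
    (U :&: V = U :&: V')%VS \/ (U + V = U + V')%VS.
  by move=> /inf[VA d] /inf[VA' d']; apply: (extremal_dichotomy kn tk tA cA).
case: (boolP [forall V in far U, (V :&: U == V0 :&: U)%VS]) => [/forall_inP h|].
  by left=> V /h/eqP.
rewrite negb_forall_in => /exists_inP[V1 V1f nT].
have Y1 : (U + V1 = U + V0)%VS.
  case: (dich V1 V0 V1f V0f) => // E; case/eqP: nT; by rewrite capvC E capvC.
right=> V Vf; case: (dich V V0 Vf V0f) => // E; case: (dich V V1 Vf V1f) => [E1|->//].
by case/eqP: nT; rewrite capvC -E1 E capvC.
Qed.

(** By cardinality the far members are all the V with V :&: U = T. Choose one that also meets T + Z
    only in T: its intersection with Z has dimension at least t and lies in T :&: Z, so T <= Z. *)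
Lemma extremal_pencil U T : U \in A -> \dim T = t -> (T <= U)%VS ->
  (forall V, V \in far U -> (V :&: U = T)%VS) -> forall Z, Z \in A -> (T <= Z)%VS.
Proof.
move=> UA dT TU hT.
have dU := dimA UA.
have farE : far U = [set V : L | (\dim V == k) && (V :&: U == T)%VS].
  apply/eqP; rewrite eqEcard; apply/andP; split.
    apply/subsetP => V Vf; rewrite inE hT // eqxx andbT.
    by move: Vf; rewrite inE => /andP[/dimA-> _].
  by rewrite -(ler_nat rat) card_far // card_complements.
move=> Z ZA; have dZ := dimA ZA.
have TZ : (T :&: Z <= T)%VS := capvSl _ _.
have dTZ := dimv_sum_cap T Z; have dTZ2 := dimvS TZ.
have [] := @common_complement _ _ (k - t) T U (T + Z) fullv; rewrite ?subvf ?addvSl //; try lia.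
move=> V [dV TV _ VU VTZ].
have Vf : V \in far U by rewrite farE inE VU eqxx dV dT subnKC ?eqxx // ltnW.
have VA : V \in A by move: Vf; rewrite inE => /andP[].
have := intA VA ZA => le1.
have sub : (V :&: Z <= T :&: Z)%VS.
  by rewrite (@subv_cap F) capvSr andbT -VTZ capvS // addvSr.
have /eqP <- : (T :&: Z)%VS == T by rewrite eqEdim capvSl dT /= (leq_trans le1) // dimvS.
exact: capvSr.
Qed.

(** The far members lie in the set D of k-spaces of Y meeting U in dimension t. The two
    cardinalities are q^((k-t)^2) times [gbin (n - k) (k - t)] and [gbin k (k - t)]; the inclusion
    forces n = 2k, and then far U = D. *)
Lemma extremal_dual U Y : (0 < t)%N -> U \in A -> (forall V, V \in far U -> (U + V = Y)%VS) ->
  [/\ (2 * k = n)%N, \dim Y = (2 * k - t)%N & forall Z, Z \in A -> (Z <= Y)%VS].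
Proof.
move=> t0 UA hY; have dU := dimA UA.
have [V0 V0f] := far_neq0 UA.
have dY : \dim Y = (2 * k - t)%N.
  have := dimv_sum_cap U V0; rewrite (hY _ V0f) dU.
  by move: V0f; rewrite inE => /andP[/dimA-> /eqP]; rewrite capvC => ->; lia.
have UY : (U <= Y)%VS by rewrite -(hY _ V0f) addvSl.
pose D := [set V : L | [&& \dim V == k, (V <= Y)%VS & \dim (V :&: U) == t]].
have farD : far U \subset D.
  apply/subsetP => V Vf; rewrite inE -(hY _ Vf) addvSr /=.
  by move: Vf; rewrite inE => /andP[/dimA-> ->]; rewrite eqxx.
have cD : #|D|%:R = gbin k (k - t) * (qcomp (2 * k - t - t) (k - t) (k - t) / qfact (k - t)).
  rewrite gbin_sym 1?ltnW // -dU -count_sub mulr_natl -[RHS]sumr_const.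
  rewrite -[#|D|]sum1_card natr_sum (partition_big (fun V => (V :&: U)%VS)
    (fun T : L => T \in [set X : L | (\dim X == t) && (X <= U)%VS])) /=.
    apply: eq_bigr => T; rewrite inE => /andP[/eqP dT TU].
    have := count_ext (k - t) (subv_trans TU UY) UY.
    rewrite (capv_idPl TU) dY dU dT => <-; rewrite -sum1_card natr_sum.
    apply: eq_bigl => V; rewrite !inE subnKC 1?ltnW //.
    apply/andP/and4P => [[/and3P[dV VY _] /eqP<-] | [-> TV -> /eqP VU]].
      by split=> //; rewrite ?capvSl.
    by rewrite VU dT !eqxx.
  by move=> V; rewrite !inE => /and3P[_ _ ->]; rewrite capvSr.
have w0 : (0 < k - t)%N by lia.
have e1 : (2 * k - t - t = (k - t) + (k - t))%N by lia.
have e2 : (n - t = (k - t) + (n - k))%N by lia.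
have cf := card_far UA.
have q0 : 0 < (q%:R ^+ (k - t)) ^+ (k - t) :> rat by rewrite !exprn_gt0 // qr_gt0.
have f0 : qfact (k - t) != 0 by rewrite gt_eqF // qfact_gt0.
have cf' : #|far U|%:R = (q%:R ^+ (k - t)) ^+ (k - t) * gbin (n - k) (k - t).
  by rewrite cf e2 qcomp_shift ?[in RHS]/q_binomial ?mulrA //; lia.
have cD' : #|D|%:R = (q%:R ^+ (k - t)) ^+ (k - t) * gbin k (k - t).
  have c1 : gbin (k - t) (k - t) = 1 by rewrite -{2}[(k - t)%N]subn0 gbin_sym // gbin0.
  by rewrite cD e1 qcomp_shift // -mulrA -/(q_binomial F _ _) c1 mulr1 mulrC.
have le1 : (#|far U|%:R : rat) <= #|D|%:R by rewrite ler_nat subset_leq_card.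
have n2k : (2 * k = n)%N.
  rewrite cf' cD' ler_pM2l // leNgt ltr_gbin // in le1; last by lia.
  by move: le1; rewrite -leqNgt; lia.
split=> // Z ZA.
have nk : (n - k = k)%N by clear -n2k; lia.
have farE : far U = D.
  by apply/eqP; rewrite eqEcard farD -(ler_nat rat) cf' cD' nk lexx.
apply: contraT => ZY; have dZ := dimA ZA.
have dZ' : (\dim (Z :&: Y) < k)%N.
  rewrite ltnNge; apply: contra ZY => le2; have /eqP <- : (Z :&: Y)%VS == Z.
    by rewrite eqEdim capvSl dZ le2.
  exact: capvSr.
(* V avoids a (k-t)-space U' of U, which makes it far from U. It also avoids a (k-t)-space Z' of Z
   :&: Y, or all of Z :&: Y when that is smaller, so it meets Z in dimension less than t; in the
   second case this is t > 0. *)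
have ktU : (k - t <= \dim U)%N by rewrite dU leq_subr.
have [U' U'U dU'] := exists_subspace ktU.
have [Z' Z'Z dZ''] := @exists_subspace _ _ (Z :&: Y)%VS (minn (k - t) (\dim (Z :&: Y))) (geq_minr _ _).
have [] := @common_complement _ _ k 0%VS U' Z' Y; rewrite ?sub0v ?dY ?dU' ?dZ'' //.
- exact: subv_trans UY.
- exact: subv_trans Z'Z (capvSr _ _).
- by clear -tk; lia.
- by have := geq_minl (k - t) (\dim (Z :&: Y)); clear -tk; lia.
move=> V [dV _ VY VU' VZ']; rewrite dimv0 add0n in dV.
have VU : (V + U = Y)%VS.
  apply/eqP; rewrite eqEdim subv_add VY UY /= dY.
  have := dimv_sum_cap V U'; rewrite VU' dimv0 addn0 dV dU' => h1.
  have : (\dim (V + U') <= \dim (V + U))%N by rewrite dimvS // addvS.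
  by clear -h1 tk; lia.
have dVU : \dim (V :&: U) = t by have := dimv_sum_cap V U; rewrite VU dY dV dU; clear -tk; lia.
have VA : V \in A.
  have : V \in far U by rewrite farE inE dV VY dVU !eqxx.
  by rewrite inE => /andP[].
have le3 := intA VA ZA.
have e3 : (V :&: Z = V :&: (Z :&: Y))%VS by rewrite [(Z :&: Y)%VS]capvC capvA (capv_idPl VY).
have h2 : (\dim ((V :&: (Z :&: Y)) + Z') <= \dim (Z :&: Y))%N.
  by rewrite dimvS // subv_add capvSr.
have h3 := dimv_sum_cap (V :&: (Z :&: Y)) Z'.
have h4 : \dim (V :&: (Z :&: Y) :&: Z') = 0%N.
  apply/eqP; rewrite dimv_eq0 -subv0 -VZ'; apply: capvS => //; exact: capvSl.
rewrite e3 in le3; rewrite h4 dZ'' addn0 in h3.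
by clear -h2 h3 le3 dZ' tk t0; lia.
Qed.

(** One inclusion is known in each case and cardinality gives the other. The k-spaces of a
    (2k-t)-space pairwise meet in dimension at least t, so [field_ekr_bound] applies to them. *)
Theorem field_ekr_extremal : (0 < t)%N ->
  (exists2 T, \dim T = t & forall S, S \in A = (\dim S == k) && (T <= S)%VS) \/
  ((2 * k = n)%N /\ exists2 Y, \dim Y = (2 * k - t)%N &
     forall S, S \in A = (\dim S == k) && (S <= Y)%VS).
Proof.
move=> t0.
have [U UA] : exists U, U \in A.
  by apply/set0Pn; rewrite -card_gt0 -(ltr0n rat) cA pencil_gt0.
have [V0 [V0f [hT|hY]]] := far_same UA; [left | right].
  have dT : \dim (V0 :&: U) = t by move: V0f; rewrite inE => /andP[_ /eqP].
  have sub := extremal_pencil UA dT (capvSr _ _) hT.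
  exists (V0 :&: U)%VS => //.
  suff -> : A = pencil (V0 :&: U) by move=> S; rewrite inE.
  apply/eqP; rewrite eqEcard; apply/andP; split.
    by apply/subsetP => S SA; rewrite inE dimA // eqxx sub.
  by rewrite -(ler_nat rat) cA (@card_pencil F vT k t).
have [n2k dY sub] := extremal_dual t0 UA hY.
split=> //; exists (U + V0)%VS => //.
pose D := [set S : L | (\dim S == k) && (S <= U + V0)%VS].
suff -> : A = D by move=> S; rewrite inE.
apply/eqP; rewrite eqEcard; apply/andP; split.
  by apply/subsetP => S SA; rewrite inE dimA // eqxx sub.
rewrite -(ler_nat rat) cA; apply: field_ekr_bound => //; split=> [S|S S'].
  by rewrite inE => /andP[/eqP].
rewrite !inE => /andP[/eqP dS SY] /andP[/eqP dS' S'Y].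
have : (\dim (S + S') <= 2 * k - t)%N by rewrite -dY dimvS // subv_add SY.
have := dimv_sum_cap S S'; rewrite dS dS'; lia.
Qed.

End FieldClassification.

(** * Anticodes for the rank distance *)

Section FieldExtension.
Variable F : finFieldType.
Local Notation q := #|F|.

(** K is the splitting field of X^(q^l) - X. The derivative -1 makes its q^l roots distinct; they
    are the fixed field of the l-th power of the Frobenius map, hence a subfield, and they generate
    K. *)
Lemma finField_extension l : (0 < l)%N -> {K : splittingFieldType F | \dim {: K} = l}.
Proof.
move=> l0; pose m := (q ^ l)%N.
have q1 : (1 < q)%N := finNzRing_gt1 F.
have m1 : (1 < m)%N by rewrite -(exp1n l) ltn_exp2r.
have nz : 'X^m - 'X != 0 :> {poly F}.
  by rewrite -size_poly_gt0 size_polyDl ?size_polyXn // size_polyN size_polyX.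
have /FinSplittingFieldFor[/= K splitK] := nz; exists K.
rewrite rmorphB rmorphXn /= map_polyX in splitK.
have [zs Dzs defK] := splitK.
have m_char : m%:R = 0 :> K.
  have [p p_pr pF] := finPcharP F.
  have pK : p \in [pchar K] by rewrite pchar_lalg.
  have qE : q = (p ^ logn p q)%N := card_pprimeChar pF.
  have n0 : (0 < logn p q)%N by rewrite lt0n; apply: contraTneq q1 => n0; rewrite qE n0.
  by rewrite /m qE -expnM natrX pcharf0 // expr0n muln_eq0 !gtn_eqF.
have uniq_zs : uniq zs.
  rewrite -separable_prod_XsubC -(eqp_separable Dzs) unlock /separable_poly.body.
  have -> : ('X^m - 'X : {poly K})^`() = -1.
    by rewrite derivB derivXn derivX -mulr_natr -polyC_natr m_char mulr0 add0r.
  by rewrite -[X in coprimep _ X]scaleN1r coprimepZr ?oppr_eq0 ?oner_neq0 // coprimep1.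
have size_zs : size zs = m.
  apply: succn_inj; rewrite -(size_prod_XsubC _ id) -(eqp_size Dzs).
  by rewrite size_polyDl ?size_polyXn // size_polyN size_polyX.
have [a _ Da] := finField_galois_generator (sub1v {:K}).
pose E := fixedSpace (a ^+ l)%g.
have in_zs : zs =i E.
  move=> z; rewrite -root_prod_XsubC -(eqp_root Dzs) (sameP fixedSpaceP eqP).
  rewrite /root !hornerE subr_eq0 /= /m; congr (_ == z).
  elim: (l) => [|i IH]; first by rewrite gal_id expn0 expr1.
  by rewrite expgSr expnSr exprM IH galM ?Da ?memvf // dimv1 expn1.
have defE : E = {:K}%VS.
  apply/eqP; rewrite eqEsubv subvf -defK -[X in (_ <= X)%VS]subfield_closed agenvS //.
  by rewrite subv_add sub1v; apply/span_subvP => z; rewrite in_zs.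
have card_zs : #|[set v : finvect_type K | v \in (zs : seq (finvect_type K))]| = size zs.
  by rewrite cardsE; apply/card_uniqP.
apply/eqP; rewrite -(eqn_exp2l _ _ q1) -/m -size_zs -card_zs -(card_vspace_set {:K}%VS).
by apply/eqP/eq_card => z; rewrite !inE in_zs defE.
Qed.

Section Gabidulin.
Variables (K : splittingFieldType F) (k t : nat).
Local Notation l := (\dim {: K}).
Local Notation b := (vbasis {: K}).
Hypotheses (t0 : (0 < t)%N) (kl : (k <= l)%N).

Let bfree : free b. Proof. exact: basis_free (vbasisP _). Qed.

(** Identifies F^s with the span of the first s basis vectors of K: s = k for the arguments of the
    linearized polynomials, s = l for their coefficients. *)
Let comb s (c : 'rV[F]_s) (sl : (s <= l)%N) : K := \sum_j c 0 j *: b`_(widen_ord sl j).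

Let comb_inj s (sl : (s <= l)%N) : injective (@comb s ^~ sl).
Proof.
have coordE c j : coord b (widen_ord sl j) (@comb s c sl) = c 0 j.
  rewrite linear_sum (bigD1 j) //= big1 ?addr0 => [|i ij].
    have /= cf := coord_free (widen_ord sl j) (widen_ord sl j) bfree.
    by rewrite linearZ /= cf eqxx mulr1.
  have /= cf := coord_free (widen_ord sl i) (widen_ord sl j) bfree.
  by rewrite linearZ /= cf -val_eqE /= (inj_eq val_inj) (negPf ij) mulr0.
by move=> c d E; apply/rowP => j; rewrite -!coordE E.
Qed.

Let coef (A : 'M[F]_(t, l)) (i : 'I_t) : K := comb (row i A) (leqnn l).
Let lpol A (x : K) : K := \sum_i coef A i * x ^+ (q ^ i).

(* Rank-distance codewords: a nonzero linearized polynomial of q-degree < t has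
   at most q^(t-1) roots, so its matrix has rank greater than k - t. *)
Definition gabidulin (A : 'M[F]_(t, l)) : 'M[F]_(k, l) :=
  \matrix_(r, s) coord b s (lpol A b`_r).

Let expq_add i : {morph (fun x : K => x ^+ (q ^ i)) : x y / x + y}.
Proof.
move=> x y; have [p p_pr pF] := finPcharP F.
have pK : p \in [pchar K] by rewrite pchar_lalg.
apply: (exprDn_pchar _ _ (n := q ^ i)).
have -> : q = (p ^ logn p q)%N := card_pprimeChar pF.
rewrite -expnM (eq_pnat _ (pcharf_eq pK)) pnatX pnat_id //.
Qed.

Let expq_scale i (c : F) (x : K) : (c *: x) ^+ (q ^ i) = c *: x ^+ (q ^ i).
Proof.
rewrite exprZn; congr (_ *: _); elim: i => [|i IH]; first by rewrite expn0 expr1.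
by rewrite expnS exprM expf_card.
Qed.

Let lpol_comb A c : lpol A (comb c kl) = \sum_j c 0 j *: lpol A b`_j.
Proof.
have add : {morph lpol A : x y / x + y}.
  by move=> x y; rewrite -big_split; apply: eq_bigr => i _; rewrite expq_add mulrDr.
have zero : lpol A 0 = 0.
  by rewrite /lpol big1 // => i _; rewrite expr0n expn_eq0 gtn_eqF ?mulr0 ?(ltnW (finNzRing_gt1 F)).
rewrite /comb (big_morph _ add zero); apply: eq_bigr => j _.
by rewrite /lpol scaler_sumr; apply: eq_bigr => i _; rewrite expq_scale scalerAr.
Qed.

Let gabidulinE A c s : (c *m gabidulin A) 0 s = coord b s (lpol A (comb c kl)).
Proof.
rewrite lpol_comb linear_sum mxE; apply: eq_bigr => j _.
by rewrite linearZ mxE.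
Qed.

Lemma gabidulinB A B : gabidulin A - gabidulin B = gabidulin (A - B).
Proof.
apply/matrixP => r s; rewrite !mxE -raddfB /=; congr (coord b s _).
rewrite -sumrB; apply: eq_bigr => i _; rewrite -mulrBl; congr (_ * _).
by rewrite /coef /comb -sumrB; apply: eq_bigr => j _; rewrite !mxE scalerBl.
Qed.

Lemma rank_gabidulin A : A != 0 -> (k < \rank (gabidulin A) + t)%N.
Proof.
move=> A0; set G := gabidulin A.
pose p : {poly K} := \sum_i coef A i *: 'X^(q ^ i).
have q1 : (1 < q)%N := finNzRing_gt1 F.
have [i Ai] : exists i, coef A i != 0.
  apply/existsP; apply: contraNT A0; rewrite negb_exists => /forallP h.
  apply/eqP/row_matrixP => i; apply: (comb_inj (sl := leqnn l)); rewrite row0.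
  have := h i; rewrite negbK /coef => /eqP ->.
  by rewrite /comb big1 // => j _; rewrite mxE scale0r.
have p0 : p != 0.
  apply: contraNneq Ai => E; have := congr1 (fun u : {poly K} => u`_(q ^ i)) E.
  rewrite coef0 coef_sum (bigD1 i) //= big1 ?addr0 => [|j ji].
    by rewrite coefZ coefXn eqxx mulr1 => ->.
  by rewrite coefZ coefXn eqn_exp2l // (inj_eq val_inj) eq_sym (negPf ji) mulr0.
have size_p : (size p <= (q ^ t.-1).+1)%N.
  apply: leq_trans (size_sum _ _ _) _; apply/bigmax_leqP => j _.
  rewrite (leq_trans (size_scale_leq _ _)) // size_polyXn ltnS leq_exp2l //.
  by have := ltn_ord j; lia.
pose rs := [seq comb (d *m row_base (kermx G)) kl | d : 'rV[F]_(\rank (kermx G))].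
have rs_uniq : uniq rs.
  rewrite map_inj_uniq ?enum_uniq // => c d /(comb_inj (sl := kl)).
  exact: (row_free_injr (row_base_free _)).
have rs_root : all (root p) rs.
  apply/allP => x /mapP[d _ ->]; set c := d *m _.
  have cG : c *m G = 0.
    by apply/eqP; rewrite -sub_kermx (submx_trans (submxMl _ _)) // eq_row_base.
  have L0 : lpol A (comb c kl) = 0.
    rewrite (coord_vbasis (memvf (lpol A (comb c kl)))) big1 // => s _.
    by rewrite -gabidulinE cG mxE scale0r.
  rewrite rootE horner_sum -[X in _ == X]L0; apply/eqP; apply: eq_bigr => j _.
  by rewrite hornerZ hornerXn.
have := max_poly_roots p0 rs_root rs_uniq.
rewrite size_map -cardE card_mx mul1n mxrank_ker => lt.
have : (q ^ (k - \rank G) <= q ^ t.-1)%N by rewrite -ltnS (leq_trans lt).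
rewrite leq_exp2l //; have := rank_leq_row G; lia.
Qed.

End Gabidulin.

(* Translates of D by a maximum rank distance code are disjoint. *)
Lemma bilinear_ekr k l t (D : {set 'M[F]_(k, l)}) : (0 < t)%N -> (t <= k)%N -> (k <= l)%N ->
  (forall X Y, X \in D -> Y \in D -> (\rank (X - Y)%R + t <= k)%N) ->
  (#|D| <= q ^ ((k - t) * l))%N.
Proof.
move=> t0 tk kl DD; have [K dK] := @finField_extension l (leq_trans t0 (leq_trans tk kl)).
subst l; pose f (x : 'M[F]_(k, \dim {:K}) * 'M[F]_(t, \dim {:K})) := x.1 + gabidulin k x.2.
have f_inj : {in setX D setT &, injective f}.
  move=> [X A] [Y B]; rewrite !inE !andbT /f /= => XD YD E.
  have E1 : X - Y = gabidulin k (B - A).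
    rewrite -gabidulinB; apply/eqP; rewrite subr_eq addrAC -subr_eq opprK E addrC //.
  case: (eqVneq B A) => BA.
    move: E; rewrite BA => /addIr -> //.
  have BA0 : B - A != 0 by rewrite subr_eq0.
  have := rank_gabidulin t0 kl BA0; rewrite -E1 => h.
  by have := DD X Y XD YD; rewrite leqNgt h.
have q1 : (1 < q)%N := finNzRing_gt1 F.
have : (#|D| * q ^ (t * \dim {:K}) <= q ^ (k * \dim {:K}))%N.
  rewrite -[X in (_ <= X)%N]card_mx -[X in (_ * X <= _)%N]card_mx -[X in (_ * X <= _)%N]cardsT -cardsX.
  by rewrite -(card_in_imset f_inj) max_card.
have e : (k * \dim {:K} = (k - t) * \dim {:K} + t * \dim {:K})%N by rewrite -mulnDl subnK.
by rewrite e expnD leq_pmul2r // expn_gt0 ltnW.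
Qed.

End FieldExtension.

(** * Matrices over a finite chain ring *)

Section ChainRingStructure.
Variable R : finNzRingType.

Lemma left_idealP (I : {set R}) :
  reflect [/\ 0 \in I, forall x y, x \in I -> y \in I -> x + y \in I
             & forall a x, x \in I -> a * x \in I] (left_ideal I).
Proof.
apply: (iffP and3P) => [[I0 /forall_inP ID /forallP IM]|[I0 ID IM]]; split => //.
- by move=> x y xI yI; move/forall_inP: (ID x xI); apply.
- by move=> a x xI; move/forall_inP: (IM a); apply.
- by apply/forall_inP => x xI; apply/forall_inP => y yI; apply: ID.
- by apply/forallP => a; apply/forall_inP => x xI; apply: IM.
Qed.

Lemma mem_ideal_mul (I J : {set R}) x y : x \in I -> y \in J -> x * y \in ideal_mul I J.
Proof.
move=> xI yJ; apply/bigcapP => K /andP[_ /forall_inP h].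
by move/forall_inP: (h x xI); apply.
Qed.

Lemma ideal_mul_sub (I J K : {set R}) : left_ideal K ->
  (forall x y, x \in I -> y \in J -> x * y \in K) -> ideal_mul I J \subset K.
Proof.
move=> lK h; apply: bigcap_inf; rewrite lK /=.
by apply/forall_inP => x xI; apply/forall_inP => y yJ; apply: h.
Qed.

Variables (F : finFieldType) (pi : {rmorphism R -> F}) (N : {set R}) (m : nat).
Hypothesis pi_surj : forall y : F, exists x : R, pi x = y.
Hypothesis pi_ker : forall x : R, pi x = 0 <-> x \in N.
Hypothesis hR : chain_ring R.
Hypothesis hm : nilpotency_index N m.

Let NX x i : x \in N -> x ^+ i \in ideal_exp N i.
Proof.
move=> xN; elim: i => [|i IH]; first by rewrite inE.
by rewrite exprS; apply: mem_ideal_mul.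
Qed.

Let N_nil x : x \in N -> x ^+ m = 0.
Proof. by move=> xN; have := NX m xN; case: hm => -> _; rewrite inE => /eqP. Qed.

(** Lift an inverse of pi a to b; then 1 - b a lies in N, is nilpotent, and a geometric sum inverts
    b a. *)
Let unitl a : a \notin N -> exists b, b * a = 1.
Proof.
move=> aN; have pa : pi a != 0 by apply: contra aN => /eqP/pi_ker.
have [b pb] := pi_surj (pi a)^-1.
pose e := 1 - b * a.
have eN : e \in N by apply/pi_ker; rewrite rmorphB rmorph1 rmorphM pb mulVf ?subrr.
exists ((\sum_(i < m) e ^+ i) * b); rewrite -mulrA.
have -> : b * a = 1 - e by rewrite /e subKr.
have := subrX1 e m; rewrite N_nil // sub0r => E.
have E2 : (\sum_(i < m) e ^+ i) * (1 - e) = - ((e - 1) * \sum_(i < m) e ^+ i).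
  rewrite -opprB mulrN; congr (- _); rewrite mulrBr mulrBl mulr1 mul1r; congr (_ - _).
  by rewrite mulr_suml mulr_sumr; apply: eq_bigr => i _; rewrite -exprSr -exprS.
by rewrite E2 -E opprK.
Qed.

Let N_left : left_ideal N.
Proof.
apply/left_idealP; split.
- by apply/pi_ker; rewrite rmorph0.
- by move=> x y /pi_ker xN /pi_ker yN; apply/pi_ker; rewrite rmorphD xN yN addr0.
- by move=> a x /pi_ker xN; apply/pi_ker; rewrite rmorphM xN mulr0.
Qed.

Let principal x : left_ideal [set a * x | a : R].
Proof.
apply/left_idealP; split.
- by apply/imsetP; exists 0; rewrite ?mul0r.
- by move=> _ _ /imsetP[a _ ->] /imsetP[b _ ->]; apply/imsetP; exists (a + b); rewrite ?mulrDl.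
- by move=> c _ /imsetP[a _ ->]; apply/imsetP; exists (c * a); rewrite ?mulrA.
Qed.

Let exp1 : ideal_exp N 1 = N.
Proof.
apply/eqP; rewrite eqEsubset; apply/andP; split.
  apply: ideal_mul_sub => // x y /pi_ker xN _; apply/pi_ker.
  by rewrite rmorphM xN mul0r.
by apply/subsetP => x xN; rewrite -[x]mulr1; apply: mem_ideal_mul; rewrite ?inE.
Qed.

(* Any element of N outside N^2 generates N, by the chain condition. *)
Lemma chain_ring_uniformizer : exists theta : R,
  [/\ forall x, pi x = 0 <-> exists a, x = a * theta,
      theta ^+ m = 0 & forall i, (i < m)%N -> theta ^+ i != 0].
Proof.
have m0 : (0 < m)%N.
  rewrite lt0n; apply/eqP => m0; case: hm; rewrite m0 /= => E _.
  by have : (1 : R) \in [set: R] by []; rewrite E inE oner_eq0.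
have [theta thN gen] : exists2 theta, theta \in N & forall x, x \in N -> exists a, x = a * theta.
  (* For m = 1 the ideal N is zero and has no element outside N^2; the generator is then 0. *)
  have [m1|m1] := leqP m 1.
    have mE : m = 1%N by lia.
    exists 0; first by apply/pi_ker; rewrite rmorph0.
    move=> x; rewrite -exp1 -mE; case: hm => -> _; rewrite inE => /eqP ->.
    by exists 0; rewrite mulr0.
  have sub21 : ideal_exp N 2 \subset N.
    apply: ideal_mul_sub => // x y /pi_ker xN _; apply/pi_ker.
    by rewrite rmorphM xN mul0r.
  have : ~~ (N \subset ideal_exp N 2).
    apply/negP => sub12.
    have E : ideal_exp N 2 = ideal_exp N 1 by rewrite exp1; apply/eqP; rewrite eqEsubset sub21.
    have Ei i : ideal_exp N i.+1 = ideal_exp N 1.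
      elim: i => // i IH; rewrite /ideal_exp iterS -/(ideal_exp N i.+1) IH; exact: E.
    by case: hm => + /(_ 1%N m1); rewrite -(Ei m.-1) prednK.
  case/subsetPn => theta thN th2; exists theta => // x xN.
  have [sub|sub] := orP (hR (principal x) (principal theta)).
    have : x \in [set a * theta | a : R].
      by apply: (subsetP sub); apply/imsetP; exists 1; rewrite ?mul1r.
    by case/imsetP => a _ ->; exists a.
  have : theta \in [set a * x | a : R].
    by apply: (subsetP sub); apply/imsetP; exists 1; rewrite ?mul1r.
  case/imsetP => a _ thE; case: (boolP (a \in N)) => aN.
    case/negP: th2; rewrite thE; apply: mem_ideal_mul => //.
    by rewrite -[ideal_mul _ _]/(ideal_exp N 1) exp1.
  have [b ba] := unitl aN; exists b; by rewrite thE mulrA ba mul1r.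
(* N is the kernel of a ring morphism, hence two-sided, while theta generates it as a left ideal; so
   theta can be moved to the right of any element. *)
have comm b : exists b', theta * b = b' * theta.
  by apply: gen; apply/pi_ker; move/pi_ker: thN => thN; rewrite rmorphM thN mul0r.
exists theta; split.
- move=> x; split=> [/pi_ker/gen//|[a ->]]; move/pi_ker: thN => thN.
  by rewrite rmorphM thN mulr0.
- exact: N_nil.
move=> i im; apply/eqP => thi; have [hm1 hm2] := hm.
apply: (hm2 i im); apply/eqP; rewrite eqEsubset; apply/andP; split; last first.
  rewrite sub1set; have := NX i (proj1 (pi_ker 0) (rmorph0 pi)).
  case: i {im thi} => [|i]; by [rewrite inE | rewrite expr0n].
have : ideal_exp N i \subset [set a * theta ^+ i | a : R].
  elim: (i) => [|j IH].
    by apply/subsetP => x _; apply/imsetP; exists x; rewrite ?expr0 ?mulr1.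
  apply: ideal_mul_sub => // x y /gen[a ->] /(subsetP IH)/imsetP[b _ ->].
  have [b' bb'] := comm b; apply/imsetP; exists (a * b') => //.
  by rewrite exprS -!mulrA; congr (_ * _); rewrite !mulrA bb'.
move/subset_trans; apply; apply/subsetP => _ /imsetP[a _ ->].
by rewrite thi mulr0 inE.
Qed.

End ChainRingStructure.

(** All that the matrix arguments use of a chain ring. Ideals disappear from here on, and a field is
    covered as well. *)
Record uniformizer (R : finNzRingType) (F : finFieldType) (pi : {rmorphism R -> F})
    (theta : R) (m : nat) : Prop := Uniformizer {
  unif_surj : forall y : F, exists x : R, pi x = y;
  unif_ker : forall x, pi x = 0 <-> exists a, x = a * theta;
  unif_nil : theta ^+ m = 0;
  unif_neq0 : forall i, (i < m)%N -> theta ^+ i != 0 }.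

Section Filtration.
Variables (R : finNzRingType) (F : finFieldType) (pi : {rmorphism R -> F}).
Variables (theta : R) (m : nat).
Hypothesis cd : uniformizer pi theta m.

Let pi_surj := unif_surj cd.
Let pi_ker := unif_ker cd.
Let th_m := unif_nil cd.
Let th_lt := unif_neq0 cd.

(** The i-th power of the kernel of pi, as the left ideal generated by theta^i; [th_comm] makes it
    two-sided. *)
Definition thI (i : nat) (x : R) : bool := [exists a, x == a * theta ^+ i].

Lemma thIP i x : reflect (exists a, x = a * theta ^+ i) (thI i x).
Proof. by apply: (iffP existsP) => -[a /eqP]; exists a => //; apply/eqP. Qed.

Lemma th_comm i b : exists b', theta ^+ i * b = b' * theta ^+ i.
Proof.
elim: i b => [|i IH] b; first by exists b; rewrite expr0 mul1r mulr1.
have [b1 E1] := IH b.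
have [b2 E2] : exists b2, theta * b1 = b2 * theta.
  apply/pi_ker; rewrite rmorphM; have -> : pi theta = 0 by apply/pi_ker; exists 1; rewrite mul1r.
  by rewrite mul0r.
by exists b2; rewrite exprS -mulrA E1 mulrA E2 mulrA.
Qed.

Lemma thI0 x : thI 0 x. Proof. by apply/thIP; exists x; rewrite expr0 mulr1. Qed.
Lemma thI_0 i : thI i 0. Proof. by apply/thIP; exists 0; rewrite mul0r. Qed.
Lemma thID i x y : thI i x -> thI i y -> thI i (x + y).
Proof. by move=> /thIP[a ->] /thIP[b ->]; apply/thIP; exists (a + b); rewrite mulrDl. Qed.
Lemma thIN i x : thI i x -> thI i (- x).
Proof. by move=> /thIP[a ->]; apply/thIP; exists (- a); rewrite mulNr. Qed.
Lemma thIM i j x y : thI i x -> thI j y -> thI (i + j) (x * y).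
Proof.
move=> /thIP[a ->] /thIP[b ->]; have [b' E] := th_comm i b.
by apply/thIP; exists (a * b'); rewrite exprD -!mulrA; congr (_ * _); rewrite !mulrA E.
Qed.
Lemma thI_sum i (J : finType) (f : J -> R) : (forall j, thI i (f j)) -> thI i (\sum_j f j).
Proof.
by move=> h; apply: (big_ind (thI i)) => [|x y|j _]; [apply: thI_0 | apply: thID | apply: h].
Qed.
Lemma thI1 x : (pi x == 0) = thI 1 x.
Proof. by apply/eqP/thIP => [/pi_ker|h]; rewrite ?expr1 //; apply/pi_ker; move: h; rewrite expr1. Qed.
Lemma thIm x : thI m x = (x == 0).
Proof.
by apply/thIP/eqP => [[a ->]|->]; [rewrite th_m mulr0 | exists 0; rewrite mul0r].
Qed.

Lemma m_gt0 : (0 < m)%N.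
Proof. by rewrite lt0n; apply/eqP => m0; move: th_m; rewrite m0 expr0 => /eqP; rewrite oner_eq0. Qed.

Lemma thI_big x i : (m <= i)%N -> thI i x -> x = 0.
Proof. by move=> mi /thIP[a ->]; rewrite -(subnK mi) exprD th_m !mulr0. Qed.

(** If pi a were nonzero, inverting it modulo N would give theta^i = e theta^i with e in N;
    iterating, theta^i would lie in every power of N and be 0. *)
Lemma pi_th_coef i a : (i < m)%N -> thI i.+1 (a * theta ^+ i) -> pi a = 0.
Proof.
move=> im /thIP[b E]; apply/eqP; apply: contraTT isT => pa.
have [c pc] := pi_surj (pi a)^-1.
pose e := 1 - c * (a - b * theta).
have pe : thI 1 e.
  rewrite -thI1 /e rmorphB rmorph1 rmorphM rmorphB.
  have -> : pi (b * theta) = 0 by apply/pi_ker; exists b.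
  by rewrite subr0 pc mulVf ?subrr.
have E0 : theta ^+ i = e * theta ^+ i.
  by rewrite /e mulrBl mul1r -mulrA mulrBl -mulrA -exprS -E subrr mulr0 subr0.
have H j : thI j (theta ^+ i).
  by elim: j => [|j IH]; [apply: thI0 | rewrite E0 -add1n; apply: thIM].
by move: (H m); rewrite thIm => /eqP h; have := th_lt im; rewrite h eqxx.
Qed.

Lemma pi_th_eq0 i a : (i < m)%N -> a * theta ^+ i = 0 -> pi a = 0.
Proof. by move=> im E; apply: (pi_th_coef im); rewrite E thI_0. Qed.

Definition residue_mx p s (A : 'M[R]_(p, s)) : 'M[F]_(p, s) := map_mx pi A.

Lemma piM_mul p s r (A : 'M_(p, s)) (B : 'M_(s, r)) : residue_mx (A *m B) = residue_mx A *m residue_mx B.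
Proof. exact: map_mxM. Qed.

Lemma piM_lift p s (A : 'M[F]_(p, s)) : exists B, residue_mx B = A.
Proof.
have pex y : exists x, pi x == y by have [x <-] := pi_surj y; exists x.
exists (\matrix_(i, j) xchoose (pex (A i j))); apply/matrixP => i j.
by rewrite !mxE; apply/eqP/(xchooseP (pex (A i j))).
Qed.

Definition thM i p s (A : 'M[R]_(p, s)) : bool := [forall a, forall b, thI i (A a b)].

Lemma thMP i p s (A : 'M[R]_(p, s)) : reflect (forall a b, thI i (A a b)) (thM i A).
Proof. by apply: (iffP forallP) => h a; apply/forallP. Qed.

Lemma thMD i p s (A B : 'M[R]_(p, s)) : thM i A -> thM i B -> thM i (A + B).
Proof. by move=> /thMP hA /thMP hB; apply/thMP => a b; rewrite mxE thID. Qed.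
Lemma thMN i p s (A : 'M[R]_(p, s)) : thM i A -> thM i (- A).
Proof. by move=> /thMP hA; apply/thMP => a b; rewrite mxE thIN. Qed.
Lemma thMM i j p s r (A : 'M[R]_(p, s)) (B : 'M[R]_(s, r)) :
  thM i A -> thM j B -> thM (i + j) (A *m B).
Proof.
by move=> /thMP hA /thMP hB; apply/thMP => a b; rewrite mxE; apply: thI_sum => c; apply: thIM.
Qed.
Lemma thM0 p s (A : 'M[R]_(p, s)) : thM 0 A. Proof. by apply/thMP => a b; apply: thI0. Qed.
Lemma thM_1 p s (A : 'M[R]_(p, s)) : (residue_mx A == 0) = thM 1 A.
Proof.
apply/eqP/thMP => [E a b|h]; first by rewrite -thI1; have := congr1 (fun M : 'M_(p, s) => M a b) E; rewrite !mxE => ->.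
by apply/matrixP => a b; rewrite !mxE; apply/eqP; rewrite thI1.
Qed.
Lemma thMm i p s (A : 'M[R]_(p, s)) : (m <= i)%N -> thM i A -> A = 0.
Proof. by move=> mi /thMP h; apply/matrixP => a b; rewrite [RHS]mxE; apply: thI_big mi (h a b). Qed.

Lemma nilp_fix p s (C : 'M[R]_(p, s)) (E : 'M[R]_s) : residue_mx E = 0 -> C = C *m E -> C = 0.
Proof.
move=> /eqP; rewrite thM_1 => hE CE; apply: (thMm (leqnn m)).
by elim: (m) => [|j IH]; [apply: thM0 | rewrite CE -addn1; apply: thMM].
Qed.

(** Multiplication by X on row vectors is injective by nilpotency, hence bijective since R is
    finite, which gives a left inverse; applying this again to the left inverse makes it
    two-sided. *)
Lemma inv_mx s (X : 'M[R]_s) : residue_mx X \in unitmx -> exists Z, Z *m X = 1%:M /\ X *m Z = 1%:M.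
Proof.
have left s' (Y : 'M[R]_s') : residue_mx Y \in unitmx -> exists Z, Z *m Y = 1%:M.
  move=> uY; have [W pW] := piM_lift (invmx (residue_mx Y)).
  have inj : injective (fun c : 'rV[R]_s' => c *m Y).
    move=> c d /(congr1 (fun u => u *m W)); rewrite -!mulmxA => E.
    apply/eqP; rewrite -subr_eq0; apply/eqP.
    apply: (nilp_fix (E := 1%:M - Y *m W)).
      by rewrite /residue_mx map_mxB map_mx1 -/(residue_mx _) piM_mul pW mulmxV // subrr.
    by rewrite mulmxBr mulmx1 mulmxBl E subrr subr0.
  have [f fK Kf] := injF_bij inj.
  exists (\matrix_i f (delta_mx 0 i)); apply/row_matrixP => i.
  by rewrite row_mul rowK Kf rowE mulmx1.
move=> uX; have [Z ZX] := left _ _ uX; exists Z; split=> //.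
have uZ : residue_mx Z \in unitmx.
  have := congr1 (@residue_mx s s) ZX; rewrite piM_mul /residue_mx map_mx1 => E.
  by case: (mulmx1_unit E).
have [W WZ] := left _ _ uZ.
have -> : X = W by rewrite -[X]mul1mx -WZ -mulmxA ZX mulmx1.
exact: WZ.
Qed.

Lemma right_inverse s n (g : 'M[R]_(s, n)) : row_free (residue_mx g) -> exists h, g *m h = 1%:M.
Proof.
case/row_freeP => hb E; have [h ph] := piM_lift hb.
have [|Z [_ XZ]] := @inv_mx _ (g *m h); first by rewrite piM_mul ph E unitmx1.
by exists (h *m Z); rewrite mulmxA XZ.
Qed.

Lemma unit_pi x : pi x != 0 -> exists y, x * y = 1.
Proof.
move=> px; have [|Z [_ XZ]] := @inv_mx 1 (const_mx x).
  rewrite unitmxE det_mx11 !mxE unitfE; exact: px.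
exists (Z 0 0); move/matrixP/(_ 0 0): XZ; by rewrite !mxE big_ord1 !mxE.
Qed.

(** If c g vanishes modulo N then theta^(m-1) c is killed by g, so injectivity gives theta^(m-1) c =
    0; an entry of c that is a unit would then make theta^(m-1) zero. *)
Lemma inj_row_free s n (g : 'M[R]_(s, n)) :
  injective (fun c : 'rV[R]_s => c *m g) <-> row_free (residue_mx g).
Proof.
split=> [inj|/right_inverse[h gh] c d E]; last first.
  by rewrite -[c]mulmx1 -[d]mulmx1 -gh !mulmxA E.
rewrite -kermx_eq0; apply/eqP/row_matrixP => i; rewrite row0.
set cb := row i _; have cb0 : cb *m residue_mx g = 0.
  by apply/eqP; rewrite -sub_kermx row_sub.
have [c pc] := piM_lift cb; apply/rowP => j; rewrite [RHS]mxE; apply/eqP.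
apply: contraTT isT => cbj.
have : theta ^+ m.-1 *: c = 0.
  apply: inj; rewrite mul0mx -scalemxAl; apply/matrixP => a b; rewrite [LHS]mxE [RHS]mxE.
  have : thM 1 (c *m g) by rewrite -thM_1 piM_mul pc cb0.
  move/thMP/(_ a b) => h; apply: (thI_big (i := m.-1 + 1)).
    by rewrite addn1 prednK // m_gt0.
  by apply: thIM => //; apply/thIP; exists 1; rewrite mul1r.
move/rowP/(_ j); rewrite !mxE => E.
have [|y cy] := @unit_pi (c 0 j).
  by have := cbj; rewrite -pc mxE.
have : theta ^+ m.-1 = 0 by rewrite -[LHS]mulr1 -cy mulrA E mul0r.
by move/eqP; rewrite (negPf (th_lt _)) // prednK // m_gt0.
Qed.

Lemma card_thI_step i : (i < m)%N -> #|[set x | thI i x]| = (#|F| * #|[set x | thI i.+1 x]|)%N.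
Proof.
move=> im; have pex y : exists x, pi x == y by have [x <-] := pi_surj y; exists x.
pose s y := xchoose (pex y); have ps y : pi (s y) = y by apply/eqP/(xchooseP (pex y)).
rewrite -cardsT -cardsX.
pose f (z : F * R) := s z.1 * theta ^+ i + z.2.
rewrite -(card_in_imset (f := f)); last first.
  move=> [y x] [y' x']; rewrite !inE /f /= => hx hx' E.
  have E1 : (s y - s y') * theta ^+ i = x' - x.
    by rewrite mulrBl; apply/eqP; rewrite subr_eq addrAC -subr_eq opprK E addrC.
  have : pi (s y - s y') = 0.
    by apply: (pi_th_coef im); rewrite E1 thID // thIN.
  rewrite rmorphB !ps => /eqP; rewrite subr_eq0 => /eqP yy.
  by move: E; rewrite yy => /addrI ->.
apply: eq_card => x; rewrite inE; apply/thIP/imsetP => [[a ->]|[[y z]]].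
  have [b ab] : exists b, a - s (pi a) = b * theta by apply/pi_ker; rewrite rmorphB ps subrr.
  exists (pi a, b * theta ^+ i.+1); first by rewrite !inE; apply/thIP; exists b.
  by rewrite /f /= exprS mulrA -ab mulrBl addrC subrK.
rewrite !inE /= => /thIP[b ->] ->; exists (s y + b * theta).
by rewrite /f /= mulrDl exprS mulrA.
Qed.

Lemma card_thI i : (i <= m)%N -> #|[set x | thI i x]| = (#|F| ^ (m - i))%N.
Proof.
move=> im; rewrite -{1}(subKn im); elim: (m - i)%N (leq_subr i m) => [|j IH] jm.
  rewrite subn0 expn0 (_ : [set x | _] = [set 0]) ?cards1 //.
  by apply/setP => x; rewrite !inE thIm.
rewrite card_thI_step; last by lia.
by rewrite (_ : (m - j.+1).+1 = m - j)%N ?IH ?expnS //; lia.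
Qed.

Lemma card_ring : #|R| = (#|F| ^ m)%N.
Proof.
rewrite -[in RHS](subn0 m) -card_thI // -cardsT; apply: eq_card => x.
by rewrite !inE thI0.
Qed.

End Filtration.

(** * Free submodules and their reductions *)

Section FreeSubmodules.
Variable R : finNzRingType.

Definition rowspan n s (g : 'M[R]_(s, n)) : {set 'rV[R]_n} := [set c *m g | c : 'rV[R]_s].
Definition injmx s n : {set 'M[R]_(s, n)} := [set g | injectiveb (fun c : 'rV[R]_s => c *m g)].

Lemma rspanP n s (g : 'M[R]_(s, n)) x : reflect (exists c, x = c *m g) (x \in rowspan g).
Proof. by apply: (iffP imsetP) => [[c _ ->]|[c ->]]; exists c. Qed.

Lemma injmxP n s (g : 'M[R]_(s, n)) :
  reflect (injective (fun c : 'rV[R]_s => c *m g)) (g \in injmx s n).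
Proof. by rewrite inE; apply: injectiveP. Qed.

Lemma freeP n s (U : {set 'rV[R]_n}) :
  reflect (exists2 g, g \in injmx s n & U = rowspan g) (free_of_rank s U).
Proof.
apply: (iffP existsP) => [[g /andP[ig /eqP ->]]|[g ig ->]]; exists g; rewrite ?inE //.
by rewrite inE in ig; rewrite ig /rowspan eqxx.
Qed.

Lemma rows_rspan n s r (g : 'M[R]_(s, n)) (A : 'M[R]_(r, n)) :
  (forall i, row i A \in rowspan g) -> exists C, A = C *m g.
Proof.
move=> h; have h' i : exists c, row i A == c *m g.
  by have /rspanP[c ->] := h i; exists c.
exists (\matrix_i xchoose (h' i)); apply/row_matrixP => i.
by rewrite row_mul rowK; apply/eqP/(xchooseP (h' i)).
Qed.

Lemma row_in_rspan n s (g : 'M[R]_(s, n)) i : row i g \in rowspan g.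
Proof. by apply/rspanP; exists (delta_mx 0 i); rewrite rowE. Qed.

Lemma mul_in_rspan n s r (g : 'M[R]_(s, n)) (C : 'M[R]_(r, s)) i : row i (C *m g) \in rowspan g.
Proof. by apply/rspanP; exists (row i C); rewrite row_mul. Qed.

Lemma rspan_sub n s r (g : 'M[R]_(s, n)) (g' : 'M[R]_(r, n)) :
  (forall i, row i g \in rowspan g') -> rowspan g \subset rowspan g'.
Proof.
case/rows_rspan => C ->; apply/subsetP => _ /rspanP[c ->].
by apply/rspanP; exists (c *m C); rewrite mulmxA.
Qed.

Lemma card_rspan n s (g : 'M[R]_(s, n)) : g \in injmx s n -> #|rowspan g| = (#|R| ^ s)%N.
Proof.
by move/injmxP => ig; rewrite card_imset // card_mx mul1n.
Qed.

(** Any two bases of a free submodule differ by an invertible s x s matrix, so each submodule is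
    counted once per such matrix. *)
Lemma card_free_mul n s :
  (#|[set U : {set 'rV[R]_n} | free_of_rank s U]| * #|injmx s s| = #|injmx s n|)%N.
Proof.
rewrite -[RHS]sum1_card (partition_big (fun g => rowspan g) (fun U => free_of_rank s U)) /=; last first.
  by move=> g ig; apply/freeP; exists g.
rewrite -sum_nat_const; apply: eq_big => [U|U]; first by rewrite inE.
rewrite inE => /freeP[g0 ig0 ->]; move/injmxP: (ig0) => inj0.
have injX : injective (fun X : 'M[R]_s => X *m g0).
  move=> X Y E; apply/row_matrixP => i; apply: inj0.
  by rewrite -!row_mul E.
rewrite sum1_card -(card_imset _ injX); apply: eq_card => g.
rewrite [RHS]unfold_in /=; apply/imsetP/andP => [[X /injmxP iX ->]|[/injmxP ig /eqP E]].
  split; first by apply/injmxP => c d; rewrite !mulmxA => /inj0/iX.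
  have [f fK Kf] := injF_bij iX.
  rewrite eqEsubset; apply/andP; split; apply/subsetP => _ /rspanP[c ->]; apply/rspanP.
    by exists (c *m X); rewrite mulmxA.
  by exists (f c); rewrite mulmxA Kf.
have [X gX] : exists X, g = X *m g0.
  by apply: rows_rspan => i; rewrite -E row_in_rspan.
exists X => //; apply/injmxP => c d E'; apply: ig; by rewrite gX !mulmxA E'.
Qed.

End FreeSubmodules.

Section VectorSubspaces.
Variable F : finFieldType.

Definition rowv n s (g : 'M[F]_(s, n)) : {vspace 'rV[F]_n} := limg (linfun (mulmxr g)).

Lemma rspP n s (g : 'M[F]_(s, n)) x : reflect (exists c, x = c *m g) (x \in rowv g).
Proof.
apply: (iffP memv_imgP) => [[c _ ->]|[c ->]]; first by exists c; rewrite lfunE.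
by exists c; rewrite ?memvf // lfunE.
Qed.

(** A field is the case theta = 0, m = 1, so the matrix lemmas over R can be used over F. *)
Lemma unif_field : uniformizer (idfun : {rmorphism F -> F}) 0 1.
Proof.
split => [y|x|| i]; first by exists y.
- by split=> [/= ->|[a ->]]; [exists 0; rewrite mulr0 | rewrite mulr0].
- by rewrite expr1.
- by rewrite ltnS leqn0 => /eqP ->; rewrite expr0 oner_eq0.
Qed.

Lemma injmx_field n s (g : 'M[F]_(s, n)) : (g \in injmx F s n) = row_free g.
Proof.
apply/injmxP/idP => [/(inj_row_free unif_field)|h]; first by rewrite /residue_mx map_mx_id.
by apply/(inj_row_free unif_field); rewrite /residue_mx map_mx_id.
Qed.

Lemma dim_rsp n s (g : 'M[F]_(s, n)) : row_free g -> \dim (rowv g) = s.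
Proof.
rewrite -injmx_field => /injmxP ig; rewrite limg_dim_eq.
  by rewrite dimvf /dim /= mul1n.
apply/eqP; rewrite -subv0; apply/subvP => c; rewrite memv_cap memv_ker lfunE /= memv0.
by move=> /andP[_ /eqP E]; apply/eqP/ig; rewrite E mul0mx.
Qed.

Lemma dim_rV n : \dim {: 'rV[F]_n} = n.
Proof. by rewrite dimvf /dim /= mul1n. Qed.

Lemma vspace_rsp n (W : {vspace 'rV[F]_n}) s : \dim W = s ->
  exists2 g : 'M[F]_(s, n), row_free g & rowv g = W.
Proof.
move=> <-; pose g : 'M[F]_(\dim W, n) := \matrix_i (vbasis W)`_i.
have gE c : c *m g = \sum_i c 0 i *: (vbasis W)`_i.
  by rewrite mulmx_sum_row; apply: eq_bigr => i _; rewrite rowK.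
have fW : free (vbasis W) := basis_free (vbasisP W).
exists g.
  rewrite -injmx_field; apply/injmxP => c d E; apply/rowP => i.
  by rewrite -(coord_sum_free (c 0) i fW) -gE E gE coord_sum_free.
apply/vspaceP => x; apply/rspP/idP => [[c ->]|xW].
  by rewrite gE; apply: rpred_sum => i _; rewrite rpredZ // vbasis_mem ?memt_nth.
exists (\row_i coord (vbasis W) i x); rewrite gE {1}(coord_vbasis xW).
by apply: eq_bigr => i _; rewrite mxE.
Qed.

Lemma card_free_field n s : #|[set U : {set 'rV[F]_n} | free_of_rank s U]|%:R = q_binomial F n s.
Proof.
have := count_sub (fullv : {vspace 'rV[F]_n}) s; rewrite dim_rV => <-; congr (_%:R).
pose f (W : {vspace 'rV[F]_n}) : {set 'rV[F]_n} := [set v | v \in W].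
have f_inj : injective f by move=> W W' /setP E; apply/vspaceP => v; have := E v; rewrite !inE.
rewrite -(card_imset _ f_inj); apply: eq_card => U; rewrite inE.
apply/freeP/imsetP => [[g ig ->]|[W]].
  exists (rowv g); first by rewrite inE subvf andbT dim_rsp // -injmx_field.
  by apply/setP => x; rewrite inE; apply/rspanP/rspP.
rewrite inE subvf andbT => /eqP/vspace_rsp[g gf <-] ->; exists g; first by rewrite injmx_field.
by apply/setP => x; rewrite inE; apply/rspP/rspanP.
Qed.

Lemma gauss_coefE a b : gauss_coef #|F| a b = q_binomial F a b.
Proof.
rewrite /gauss_coef /q_binomial /q_comp /q_fact -prodf_div; apply: eq_bigr => i _.
have c0 : (#|F|%:R - 1 : rat) != 0 by rewrite gt_eqF // qr1_gt0.
have d0 : (#|F|%:R ^+ i.+1 - 1 : rat) != 0.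
  by have := qint_neq0 F (ltn0Sn i); rewrite /q_int mulf_eq0 negb_or => /andP[].
by rewrite qint0 subr0 /q_int invfM invrK mulrACA -[X in X = _]mulr1; congr (_ * _); rewrite mulVf.
Qed.

End VectorSubspaces.

Section Reduction.
Variables (R : finNzRingType) (F : finFieldType) (pi : {rmorphism R -> F}).
Variables (theta : R) (m : nat).
Hypothesis cd : uniformizer pi theta m.
Local Notation q := #|F|.
Local Notation piM := (residue_mx pi).
Local Notation thM := (thM theta).
Local Notation thI := (thI theta).

Lemma injmx_piM n s (g : 'M[R]_(s, n)) : (g \in injmx R s n) = row_free (piM g).
Proof. by apply/injmxP/idP => /(inj_row_free cd). Qed.

Lemma card_piM_fiber n s (A : 'M[F]_(s, n)) :
  #|[set g : 'M[R]_(s, n) | piM g == A]| = (q ^ ((m - 1) * (s * n)))%N.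
Proof.
pose c := #|[set g : 'M[R]_(s, n) | piM g == 0]|.
have fib B : #|[set g : 'M[R]_(s, n) | piM g == B]| = c.
  have [g0 <-] := piM_lift cd B; rewrite /c -[RHS](card_imset _ (addrI g0)).
  apply: eq_card => g; rewrite inE; apply/eqP/imsetP => [E|[x]].
    exists (g - g0); last by rewrite addrC subrK.
    by rewrite inE /residue_mx map_mxB -!/(residue_mx _ _) E subrr.
  by rewrite inE => /eqP E ->; rewrite /residue_mx map_mxD -!/(residue_mx _ _) E addr0.
rewrite fib.
have : (#|{: 'M[R]_(s, n)}| = #|{: 'M[F]_(s, n)}| * c)%N.
  rewrite -[LHS]sum1_card (partition_big (@residue_mx R F pi s n) xpredT) //= -sum_nat_const.
  by apply: eq_bigr => B _; rewrite -(fib B) -sum1_card; apply: eq_bigl => g; rewrite inE.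
rewrite !card_mx (card_ring cd) -expnM => E.
have q0 : (0 < q ^ (s * n))%N by rewrite expn_gt0 ltnW // finNzRing_gt1.
apply/eqP; rewrite -(eqn_pmul2l q0) -E -expnD -mulSn subn1 prednK //.
exact: m_gt0 cd.
Qed.

Lemma card_injmx n s : #|injmx R s n| = (q ^ ((m - 1) * (s * n)) * #|injmx F s n|)%N.
Proof.
rewrite mulnC -sum_nat_const -[LHS]sum1_card.
rewrite (partition_big (@residue_mx R F pi s n) (fun A => A \in injmx F s n)) /=; last first.
  by move=> g; rewrite injmx_piM injmx_field.
apply: eq_bigr => A iA; rewrite -(card_piM_fiber A) -sum1_card; apply: eq_bigl => g.
rewrite inE injmx_piM andbC; case: eqP => //= ->; by rewrite -injmx_field.
Qed.

(** Passing from F to R multiplies the number of injective s x n matrices by q^((m-1)sn) and that of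
    the s x s ones by q^((m-1)s^2); the quotient gives the exponent. *)
Lemma card_free n s : (s <= n)%N ->
  #|[set U : {set 'rV[R]_n} | free_of_rank s U]|%:R = q%:R ^+ ((m - 1) * s * (n - s)) * q_binomial F n s.
Proof.
move=> sn; rewrite -card_free_field -natrX -natrM; congr (_%:R).
have I0 : (0 < #|injmx F s s|)%N.
  by apply/card_gt0P; exists 1%:M; rewrite injmx_field row_free_unit unitmx1.
have q0 e : (0 < q ^ e)%N by rewrite expn_gt0 ltnW // finNzRing_gt1.
have := card_free_mul R n s; rewrite !card_injmx -(card_free_mul F n s) => E.
have eb : (q ^ ((m - 1) * (s * n)) = q ^ ((m - 1) * (s * s)) * q ^ ((m - 1) * s * (n - s)))%N.
  by rewrite -expnD; congr (_ ^ _)%N; rewrite -mulnA -!mulnDr subnKC.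
have aI : (0 < q ^ ((m - 1) * (s * s)) * #|injmx F s s|)%N by rewrite muln_gt0 q0.
apply/eqP; rewrite -(eqn_pmul2r aI) E eb; apply/eqP.
by rewrite [RHS]mulnACA; congr (_ * _)%N; rewrite mulnC.
Qed.

(** Multiplication on the right keeps it compatible with products by a matrix on the left; passing
    it across a matrix on the right twists that matrix, by [scale_rth]. *)
Definition multh i p s (A : 'M[R]_(p, s)) : 'M[R]_(p, s) := map_mx (fun x => x * theta ^+ i) A.

Lemma mul_rth i p s r (A : 'M[R]_(p, s)) (B : 'M[R]_(s, r)) : A *m multh i B = multh i (A *m B).
Proof.
apply/matrixP => a b; rewrite !mxE mulr_suml; apply: eq_bigr => c _.
by rewrite !mxE mulrA.
Qed.

Lemma rth_mul i p s r (A : 'M[R]_(p, s)) (B : 'M[R]_(s, r)) : multh i A *m B = A *m (theta ^+ i *: B).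
Proof.
apply/matrixP => a b; rewrite !mxE; apply: eq_bigr => c _.
by rewrite !mxE mulrA.
Qed.

Lemma rthB i p s (A B : 'M[R]_(p, s)) : multh i (A - B) = multh i A - multh i B.
Proof. by apply/matrixP => a b; rewrite !mxE mulrBl. Qed.

Lemma scale_rth i p s (A : 'M[R]_(p, s)) : exists A', theta ^+ i *: A = multh i A'.
Proof.
have ex x : exists y, theta ^+ i * x == y * theta ^+ i.
  by have [y E] := th_comm cd i x; exists y; rewrite E.
exists (\matrix_(a, b) xchoose (ex (A a b))); apply/matrixP => a b; rewrite !mxE.
exact/eqP/(xchooseP (ex (A a b))).
Qed.

Lemma rth_eq0 i p s (A : 'M[R]_(p, s)) : (i < m)%N -> multh i A = 0 -> piM A = 0.
Proof.
move=> im E; apply/matrixP => a b; rewrite !mxE; apply: (pi_th_eq0 cd im).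
by have := congr1 (fun M : 'M_(p, s) => M a b) E; rewrite !mxE.
Qed.

Lemma rth_step i p s (A : 'M[R]_(p, s)) : piM A = 0 -> thM i.+1 (multh i A).
Proof.
move=> E; apply/thMP => a b; rewrite mxE -add1n; apply: (thIM cd); last first.
  by apply/thIP; exists 1; rewrite mul1r.
by rewrite -(thI1 cd); have := congr1 (fun M : 'M_(p, s) => M a b) E; rewrite !mxE => ->.
Qed.

Section Fiber.
Variables (n k t : nat).
Hypotheses (t0 : (0 < t)%N) (tk : (t <= k)%N) (kn : (k <= n - k)%N).

(* The g in D agree mod theta^i; by bilinear_ekr the reductions of
   (g - d0) / theta^i, for a fixed d0 in D, split D into at most q^((k-t)(n-k))
   classes of elements agreeing mod theta^(i+1). *)
Lemma level_bound j i (D : {set 'M[R]_(k, n)}) (h : 'M[R]_(n, k)) :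
  (i + j = m)%N ->
  (forall g, g \in D -> g *m h = 1%:M) ->
  (forall g g', g \in D -> g' \in D -> thM i (g - g')) ->
  (forall g g', g \in D -> g' \in D ->
     exists C : 'M[R]_(t, k), row_free (piM C) /\ C *m (g - g') = 0) ->
  (#|D| <= q ^ (j * ((k - t) * (n - k))))%N.
Proof.
elim: j i D => [|j IH] i D ij Dh Di DC.
  rewrite mul0n expn0; apply/card_le1_eqP => g g' gD g'D.
  apply/eqP; rewrite -subr_eq0; apply/eqP; apply: (thMm cd (i := i)); [lia | exact: Di].
have [->|[d0 d0D]] := set_0Vmem D; first by rewrite cards0.
have im : (i < m)%N by lia.
(* A chosen quotient of x by theta^i, with default 0 outside the ideal. It is not unique, but for i
   < m its residue is. *)
pose coef (x : R) : R := odflt 0 [pick a | x == a * theta ^+ i].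
have coefE x : thI i x -> x = coef x * theta ^+ i.
  move=> /thIP[a ->]; rewrite /coef; case: pickP => [b /eqP //|/(_ a)].
  by rewrite eqxx.
pose Delta (g : 'M[R]_(k, n)) := map_mx coef (g - d0).
have DE g : g \in D -> g - d0 = multh i (Delta g).
  move=> gD; apply/matrixP => a b; have /thMP/(_ a b)/coefE E := Di g d0 gD d0D.
  by rewrite [RHS]mxE [Delta g a b]mxE.
have DE2 g g' : g \in D -> g' \in D -> g - g' = multh i (Delta g - Delta g').
  move=> gD g'D; rewrite rthB -!DE // opprB addrA subrK //.
pose de g := piM (Delta g).
(* theta^i is moved across h and d0. The twisted matrices satisfy d' h' = 1 modulo N, so h' still
   has rank k there. *)
have [h' Eh'] := scale_rth i h; have [d' Ed'] := scale_rth i d0.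
have rank_h' : \rank (piM h') = k.
  have E : piM (d' *m h' - 1%:M) = 0.
    apply: (rth_eq0 im); rewrite rthB -mul_rth -Eh' -rth_mul -Ed' -scalemxAl Dh //.
    by apply/matrixP => a b; rewrite !mxE; case: (a == b); rewrite ?mulr1 ?mulr0 ?mul1r ?mul0r subrr.
  have E1 : piM d' *m piM h' = 1%:M.
    apply/eqP; rewrite -subr_eq0 -(piM_mul) -(map_mx1 pi) -map_mxB.
    by rewrite -/(residue_mx _ _) E.
  apply/eqP; rewrite eqn_leq rank_leq_col /=.
  by rewrite -{1}(mxrank1 F k) -E1 mxrankM_maxr.
(* All g have the same product with h, so the residues of the quotients lie in the left kernel of
   h', of dimension n - k; in a basis of it they become k x (n-k) matrices. *)
pose l := \rank (kermx (piM h')).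
have lE : l = (n - k)%N by rewrite /l mxrank_ker rank_h'.
pose B := row_base (kermx (piM h')).
have de_ker g : g \in D -> (de g <= B)%MS.
  move=> gD; rewrite (eq_row_base (kermx (piM h'))) sub_kermx -piM_mul; apply/eqP/(rth_eq0 im).
  by rewrite -mul_rth -Eh' -rth_mul -DE // mulmxBl !Dh // subrr.
pose D' := [set de g *m pinvmx B | g in D].
have D'bound : (#|D'| <= q ^ ((k - t) * l))%N.
  apply: (bilinear_ekr t0 tk); first by rewrite -/l lE.
  move=> _ _ /imsetP[g gD ->] /imsetP[g' g'D ->].
  rewrite -mulmxBl.
  have -> : \rank ((de g - de g') *m pinvmx B) = \rank (de g - de g').
    rewrite -{2}(mulmxKpV (_ : (de g - de g') <= B)%MS); last first.
      by rewrite addmx_sub ?de_ker // eqmx_opp de_ker.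
    by rewrite mxrankMfree // row_base_free.
  have [C [Cf C0]] := DC g g' gD g'D.
  have : piM C *m (de g - de g') = 0.
    have -> : de g - de g' = piM (Delta g - Delta g') by rewrite /residue_mx map_mxB.
    by rewrite -piM_mul; apply: (rth_eq0 im); rewrite -mul_rth -DE2.
  by move/mulmx0_rank_max; rewrite (eqP Cf) addnC.
rewrite -[#|D|]sum1_card (partition_big (fun g => de g *m pinvmx B) (fun y => y \in D')) /=; last first.
  by move=> g gD; apply: imset_f.
apply: (@leq_trans (#|D'| * q ^ (j * ((k - t) * (n - k))))); last first.
  by rewrite mulSn expnD leq_mul // -lE.
rewrite -sum_nat_const; apply: leq_sum => y _; rewrite sum1dep_card.
apply: (IH i.+1); first by lia.
- by move=> g; rewrite inE => /andP[/Dh].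
- move=> g g'; rewrite !inE => /andP[gD /eqP gy] /andP[g'D /eqP g'y].
  rewrite DE2 //; apply: rth_step; rewrite /residue_mx map_mxB -!/(residue_mx _ _).
  rewrite -/(de g) -/(de g') -(mulmxKpV (de_ker g gD)) -(mulmxKpV (de_ker g' g'D)) gy g'y.
  by rewrite subrr.
- by move=> g g'; rewrite !inE => /andP[gD _] /andP[g'D _]; apply: DC.
Qed.

Definition red (U : {set 'rV[R]_n}) : {vspace 'rV[F]_n} := <<[seq piM u | u <- enum U]>>%VS.

Lemma red_rspan s (g : 'M[R]_(s, n)) : red (rowspan g) = rowv (piM g).
Proof.
apply/eqP; rewrite eqEsubv; apply/andP; split.
  apply/span_subvP => x /mapP[u]; rewrite mem_enum => /rspanP[c ->] ->.
  by apply/rspP; exists (piM c); rewrite piM_mul.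
apply/subvP => x /rspP[c ->]; have [c' <-] := piM_lift cd c; rewrite -piM_mul.
by apply/memv_span/map_f; rewrite mem_enum; apply/rspanP; exists c'.
Qed.

Lemma dim_red s (U : {set 'rV[R]_n}) : free_of_rank s U -> \dim (red U) = s.
Proof. by case/freeP => g ig ->; rewrite red_rspan dim_rsp // -injmx_piM. Qed.

Lemma mem_red s (U : {set 'rV[R]_n}) x : free_of_rank s U ->
  reflect (exists2 u, u \in U & piM u = x) (x \in red U).
Proof.
move=> fU; apply: (iffP idP); case/freeP: fU => g ig ->; rewrite red_rspan.
  case/rspP => c ->; have [c' <-] := piM_lift cd c.
  by exists (c' *m g); rewrite ?piM_mul //; apply/rspanP; exists c'.
case=> _ /rspanP[c ->] <-; apply/rspP; exists (piM c); by rewrite piM_mul.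
Qed.

Definition meets (U V : {set 'rV[R]_n}) : Prop :=
  exists W : {set 'rV[R]_n}, [/\ free_of_rank t W, W \subset U & W \subset V].

(** With h a right inverse of a basis of one member, every member with the same reduction has a
    basis g normalized by g h = 1, and all these g agree modulo N. A common submodule with basis w =
    C g = C' g' gives C = C' on multiplying by h, hence C (g - g') = 0 with C of rank t. *)
Lemma fiber_bound (G : {set {set 'rV[R]_n}}) (Y : {vspace 'rV[F]_n}) :
  (forall U, U \in G -> free_of_rank k U /\ red U = Y) ->
  (forall U V, U \in G -> V \in G -> meets U V) ->
  (#|G| <= q ^ ((m - 1) * ((k - t) * (n - k))))%N.
Proof.
move=> Gf GG; have [->|[U0 U0G]] := set_0Vmem G; first by rewrite cards0.
have [/freeP[g0 ig0 U0E] Y0] := Gf U0 U0G.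
have [h gh] := right_inverse cd (etrans (esym (injmx_piM g0)) ig0).
pose gof (U : {set 'rV[R]_n}) : 'M[R]_(k, n) := odflt 0 [pick g | (U == rowspan g) && (g *m h == 1%:M)].
have gofP U : U \in G -> U = rowspan (gof U) /\ gof U *m h = 1%:M.
  move=> UG; rewrite /gof; case: pickP => [g /andP[/eqP -> /eqP ->] //|H].
  have [/freeP[g ig UE] YU] := Gf U UG.
  have : rowv (piM g) = rowv (piM g0) by rewrite -!red_rspan -UE -U0E Y0.
  move=> Egg.
  have [X EX] : exists X, piM g = X *m piM g0.
    have h' i : exists c, row i (piM g) == c *m piM g0.
      have : row i (piM g) \in rowv (piM g0) by rewrite -Egg; apply/rspP; exists (delta_mx 0 i); rewrite rowE.
      by case/rspP => c ->; exists c.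
    exists (\matrix_i xchoose (h' i)); apply/row_matrixP => i.
    by rewrite row_mul rowK; apply/eqP/(xchooseP (h' i)).
  have XE : piM (g *m h) = X by rewrite piM_mul EX -mulmxA -piM_mul gh /residue_mx map_mx1 mulmx1.
  have uX : piM (g *m h) \in unitmx.
    rewrite XE -row_free_unit -row_leq_rank; have := ig; rewrite injmx_piM EX => /eqP rk.
    by apply: leq_trans (mxrankM_maxl X (piM g0)); rewrite rk.
  have [Z [Z1 Z2]] := inv_mx cd uX.
  have /negP[] := H (Z *m g); rewrite -mulmxA Z1 eqxx andbT UE eqEsubset.
  apply/andP; split; apply/subsetP => _ /rspanP[c ->]; apply/rspanP.
    by exists (c *m (g *m h)); rewrite mulmxA -(mulmxA c) Z2 mulmx1.
  by exists (c *m Z); rewrite mulmxA.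
have gof_inj : {in G &, injective gof}.
  by move=> U V UG VG E; rewrite (gofP U UG).1 (gofP V VG).1 E.
rewrite -(card_in_imset gof_inj).
have gof_pi U : U \in G -> piM (gof U) = piM g0.
  move=> UG; have [UE Uh] := gofP U UG; have [fU YU] := Gf U UG.
  have Egg : rowv (piM (gof U)) = rowv (piM g0) by rewrite -!red_rspan -UE -U0E YU Y0.
  have h' i : exists c, row i (piM (gof U)) == c *m piM g0.
    have : row i (piM (gof U)) \in rowv (piM g0) by rewrite -Egg; apply/rspP; exists (delta_mx 0 i); rewrite rowE.
    by case/rspP => c ->; exists c.
  have EX : piM (gof U) = (\matrix_i xchoose (h' i)) *m piM g0.
    apply/row_matrixP => i; by rewrite row_mul rowK; apply/eqP/(xchooseP (h' i)).
  have := congr1 (@residue_mx R F pi _ _) Uh; rewrite piM_mul EX -mulmxA -piM_mul gh /residue_mx map_mx1 mulmx1.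
  by move=> ->; rewrite mul1mx.
apply: (level_bound (i := 1) (h := h)).
- by rewrite subnKC // (m_gt0 cd).
- by move=> _ /imsetP[U UG ->]; case: (gofP U UG).
- move=> _ _ /imsetP[U UG ->] /imsetP[V VG ->]; rewrite -(thM_1 cd) /residue_mx map_mxB.
  by rewrite -!/(residue_mx _ _) !gof_pi // subrr.
move=> _ _ /imsetP[U UG ->] /imsetP[V VG ->].
have [W [/freeP[w iw ->] WU WV]] := GG U V UG VG.
have [UE Uh] := gofP U UG; have [VE Vh] := gofP V VG.
have [C EC] : exists C, w = C *m gof U.
  by apply: rows_rspan => i; rewrite -UE (subsetP WU) // row_in_rspan.
have [C' EC'] : exists C, w = C *m gof V.
  by apply: rows_rspan => i; rewrite -VE (subsetP WV) // row_in_rspan.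
have CC : C = C' by rewrite -[C]mulmx1 -Uh mulmxA -EC EC' -mulmxA Vh mulmx1.
exists C; split; last by rewrite mulmxBr -EC {1}EC' CC subrr.
rewrite -row_leq_rank; have := iw; rewrite injmx_piM EC piM_mul => /eqP rk.
by apply: leq_trans (mxrankM_maxl (piM C) (piM (gof U))); rewrite rk.
Qed.

End Fiber.
End Reduction.

(** * Lifting the common subspace *)

Section Levels.
Variables (G Gb H : zmodType) (red : {additive G -> Gb}) (ev : {additive G -> H}).
Variables (J : nat -> H -> Prop) (I : Type) (S : I -> G -> Prop) (tr : I -> I -> Prop).
Variables (U1 U2 : I).
Hypothesis J0 : forall x, J 0 x.
Hypothesis JB : forall i x y, J i x -> J i y -> J i (x - y).
Hypothesis SB : forall U x y, S U x -> S U y -> S U (x - y).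
Hypothesis ker_red : forall i U x, S U x -> red x = 0 ->
  (forall y, S U y -> J i (ev y)) -> J i.+1 (ev x).
Hypothesis tr_lift : forall U V x y, tr U V -> S U x -> S V y -> red x = red y ->
  exists2 z, S U z /\ S V z & red z = red x.
Hypothesis tr_exists : forall U V x y, S U x -> S V y -> red x = red y -> red x != 0 ->
  exists B, [/\ tr U B, tr V B & exists2 b, S B b & red b = red x].
Hypothesis split_red : forall U x, S U x -> exists x1 x2 B b1 b2,
  [/\ S U1 x1, S U2 x2 & red x = red x1 + red x2] /\
  [/\ S B b1, S B b2, red b1 = red x1 & red b2 = red x2].
Hypothesis ev1 : forall x, S U1 x -> ev x = 0.
Hypothesis ev2 : forall x, S U2 x -> ev x = 0.

(* If ev maps every S U into J i, then modulo J (i + 1) the value ev x depends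
   only on red x, even across members, by comparison through a member transversal
   to both; reductions split along U1 and U2, where ev is 0. *)
Lemma ev_levels i U x : S U x -> J i (ev x).
Proof.
have JN j y : J j y -> J j (- y).
  by move=> Jy; rewrite -sub0r; apply: JB => //; rewrite -(subrr y); apply: JB.
have JD j y z : J j y -> J j z -> J j (y + z).
  by move=> Jy Jz; rewrite -[z]opprK; apply: JB => //; apply: JN.
have sub3 (a b c : H) : a - b = (a - c) - (b - c) by rewrite opprB addrA subrK.
elim: i U x => [|i IH] U x Sx; first exact: J0.
have ker V y : S V y -> red y = 0 -> J i.+1 (ev y).
  by move=> Sy y0; apply: (ker_red Sy y0) => z; apply: IH.
have step V W y z : tr V W -> S V y -> S W z -> red y = red z -> J i.+1 (ev y - ev z).
  move=> t Sy Sz E; have [v [Sv Sv'] Ev] := tr_lift t Sy Sz E.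
  have -> : ev y - ev z = ev (y - v) - ev (z - v) by rewrite (raddfB ev y) (raddfB ev z); apply: sub3.
  apply: JB; first by apply: (ker V); [exact: SB | rewrite raddfB Ev subrr].
  by apply: (ker W); [exact: SB | rewrite raddfB Ev E subrr].
have gen V W y z : S V y -> S W z -> red y = red z -> J i.+1 (ev y - ev z).
  move=> Sy Sz E; case: (eqVneq (red y) 0) => y0.
    by apply: JB; [exact: (ker V) | apply: (ker W) => //; rewrite -E].
  have [B [tVB tWB [b Sb Eb]]] := tr_exists Sy Sz E y0.
  rewrite (sub3 _ _ (ev b)).
  by apply: JB; [apply: (step V B) | apply: (step W B); rewrite ?Eb].
have [x1 [x2 [B [b1 [b2 [[S1 S2 E] [Sb1 Sb2 E1 E2]]]]]]] := split_red Sx.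
have Sb : S B (b1 + b2).
  rewrite -[b2]opprK; apply: SB => //; rewrite -sub0r; apply: SB => //.
  by rewrite -(subrr b1); apply: SB.
have -> : ev x = (ev x - ev (b1 + b2)) + ((ev b1 - ev x1) + (ev b2 - ev x2)).
  by rewrite (ev1 S1) (ev2 S2) !subr0 raddfD subrK.
apply: (JD); first by apply: (gen U B); rewrite // raddfD E1 E2.
by apply: (JD); [apply: (gen B U1) | apply: (gen B U2)].
Qed.

End Levels.

Section Lifting.
Variables (R : finNzRingType) (F : finFieldType) (pi : {rmorphism R -> F}).
Variables (theta : R) (m : nat).
Hypothesis cd : uniformizer pi theta m.
Local Notation piM := (residue_mx pi).
Local Notation thM := (thM theta).
Variables (n k t : nat).
Local Notation V := 'rV[R]_n.
Local Notation red := (@red R F pi n).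
Local Notation meets := (@meets R n t).
Hypotheses (t0 : (0 < t)%N) (tk : (t < k)%N) (kn : (2 * k <= n)%N).

Lemma piMB p s (A B : 'M[R]_(p, s)) : piM (A - B) = piM A - piM B.
Proof. exact: map_mxB. Qed.
Lemma piMD p s (A B : 'M[R]_(p, s)) : piM (A + B) = piM A + piM B.
Proof. exact: map_mxD. Qed.

Lemma row_piM p s (A : 'M[R]_(p, s)) i : row i (piM A) = piM (row i A).
Proof. by apply/rowP => j; rewrite !mxE. Qed.

(** Lift a basis of the sum of the reductions to rows of G in U1 + U2. They span |R|^(2k-t)
    elements, and |U1 + U2| |W| <= |U1| |U2| shows that U1 + U2 has no more; so the sum is free. *)
Lemma exists_sum_span (U1 U2 W : {set V}) : free_of_rank k U1 -> free_of_rank k U2 ->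
  free_of_rank t W -> W \subset U1 -> W \subset U2 -> \dim (red U1 :&: red U2) = t ->
  exists G : 'M[R]_(2 * k - t, n),
    [/\ row_free (piM G), U1 \subset rowspan G, U2 \subset rowspan G
      & rowv (piM G) = (red U1 + red U2)%VS].
Proof.
move=> fU1 fU2 fW WU1 WU2 dT.
pose S := [set u + v | u in U1, v in U2].
have dY : \dim (red U1 + red U2) = (2 * k - t)%N.
  have := dimv_sum_cap (red U1) (red U2); rewrite dT (dim_red cd fU1) (dim_red cd fU2); clear -tk; lia.
have [Gb Gbf GbE] := vspace_rsp dY.
have ex i : exists r, (r \in S) && (piM r == row i Gb).
  have : row i Gb \in (red U1 + red U2)%VS.
    by rewrite -GbE; apply/rspP; exists (delta_mx 0 i); rewrite rowE.
  case/memv_addP => _ /(mem_red cd _ fU1)[u uU <-] [_ /(mem_red cd _ fU2)[v vU <-] ->].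
  by exists (u + v); rewrite piMD eqxx andbT; apply/imset2P; exists u v.
pose G := \matrix_i xchoose (ex i).
have GS i : row i G \in S by rewrite rowK; case/andP: (xchooseP (ex i)).
have GE : piM G = Gb.
  by apply/row_matrixP => i; rewrite row_piM rowK; case/andP: (xchooseP (ex i)) => _ /eqP.
have [/freeP[g1 ig1 U1E] /freeP[g2 ig2 U2E]] := (fU1, fU2).
have SD c d x y : x \in S -> y \in S -> c *: x + d *: y \in S.
  rewrite /S U1E U2E => /imset2P[_ _ /rspanP[c1 ->] /rspanP[d1 ->] ->].
  move=> /imset2P[_ _ /rspanP[c2 ->] /rspanP[d2 ->] ->].
  apply/imset2P; exists ((c *: c1 + d *: c2) *m g1) ((c *: d1 + d *: d2) *m g2).
  - by apply/rspanP; exists (c *: c1 + d *: c2).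
  - by apply/rspanP; exists (c *: d1 + d *: d2).
  by rewrite !mulmxDl -!scalemxAl !scalerDr addrACA.
have S0 : 0 \in S.
  by apply/imset2P; exists 0 0; rewrite ?addr0 // ?U1E ?U2E; apply/rspanP; exists 0; rewrite mul0mx.
have GsubS : rowspan G \subset S.
  apply/subsetP => _ /rspanP[c ->]; rewrite mulmx_sum_row.
  apply: (big_ind (fun x => x \in S)) => [//|x y xS yS|i _].
    by have := SD 1 1 x y xS yS; rewrite !scale1r.
  by have := SD (c 0 i) 0 _ _ (GS i) S0; rewrite scaler0 addr0.
have cR : (0 < #|R|)%N by apply/card_gt0P; exists 0.
have card_S : (#|S| * #|R| ^ t <= #|R| ^ (2 * k))%N.
  have [/freeP[w iw WE]] := fW.
  rewrite -(card_rspan iw) -WE mul2n -addnn expnD -{1}(card_rspan ig1) -(card_rspan ig2) -U1E -U2E.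
  have exS x : x \in S -> exists p : V * V, [&& p.1 \in U1, p.2 \in U2 & x == p.1 + p.2].
    by case/imset2P => u v uU vU ->; exists (u, v); rewrite uU vU /=.
  pose f x : V * V := odflt (0, 0) [pick p : V * V | [&& p.1 \in U1, p.2 \in U2 & x == p.1 + p.2]].
  have fP x : x \in S -> [/\ (f x).1 \in U1, (f x).2 \in U2 & x = (f x).1 + (f x).2].
    move=> xS; rewrite /f; case: pickP => [p /and3P[? ? /eqP]|H] //.
    by have [p] := exS x xS; rewrite H.
  (* A chosen decomposition of x as a sum from U1 and U2, shifted by an element of W: injective,
     since adding the components recovers x. *)
  pose F2 (z : V * V) := ((f z.1).1 + z.2, (f z.1).2 - z.2).
  have F2_inj : {in setX S W &, injective F2}.
    move=> [x w1] [y w2]; rewrite !inE /= => /andP[xS _] /andP[yS _] [E1 E2].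
    have [_ _ Ex] := fP x xS; have [_ _ Ey] := fP y yS.
    have xy : x = y.
      rewrite Ex Ey; transitivity (((f x).1 + w1) + ((f x).2 - w1)).
        by rewrite addrACA subrr addr0.
      by rewrite E1 E2 addrACA subrr addr0.
    by move: E1; rewrite xy => /addrI ->.
  rewrite -!cardsX -(card_in_imset F2_inj); apply: subset_leq_card.
  apply/subsetP => z /imsetP[[x w1] xw ->]; move: xw; rewrite inE /= => /andP[xS wW].
  have [f1 f2 _] := fP x xS.
  have [cl1 cl2] : (forall a b, a \in U1 -> b \in U1 -> a + b \in U1) /\
                   (forall a b, a \in U2 -> b \in U2 -> a - b \in U2).
    rewrite U1E U2E; split=> a b /rspanP[c ->] /rspanP[d ->]; apply/rspanP.
      by exists (c + d); rewrite mulmxDl.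
    by exists (c - d); rewrite mulmxBl.
  by rewrite inE /= cl1 ?cl2 // (subsetP WU1, subsetP WU2).
have iG : G \in injmx R (2 * k - t) n by rewrite (injmx_piM cd) GE.
have SE : rowspan G = S.
  apply/eqP; rewrite eqEcard GsubS /= (card_rspan iG).
  rewrite -(leq_pmul2r (_ : 0 < #|R| ^ t)%N) ?expn_gt0 ?cR //.
  by apply: leq_trans card_S _; rewrite -expnD subnK //; clear -tk; lia.
have U10 : 0 \in U1 by rewrite U1E; apply/rspanP; exists 0; rewrite mul0mx.
have U20 : 0 \in U2 by rewrite U2E; apply/rspanP; exists 0; rewrite mul0mx.
exists G; split; rewrite ?GE // SE; apply/subsetP => u uU; apply/imset2P.
  by exists u 0; rewrite ?addr0.
by exists 0 u; rewrite ?add0r.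
Qed.

Definition annihilator (f : 'cV[F]_n) : {vspace 'rV[F]_n} := lker (linfun (mulmxr f)).

Lemma annP (f : 'cV[F]_n) x : (x \in annihilator f) = (x *m f == 0).
Proof. by rewrite memv_ker lfunE. Qed.

Lemma dim_ann_cap (f : 'cV[F]_n) (Y : {vspace 'rV[F]_n}) :
  (\dim Y <= (\dim (Y :&: annihilator f)).+1)%N.
Proof.
rewrite -[X in (X <= _)%N](limg_ker_dim (linfun (mulmxr f)) Y) -[X in (_ <= X)%N]addn1 leq_add2l.
by rewrite (leq_trans (dimvS (subvf _))) // dim_rV.
Qed.

(* ev_levels is applied to the annihilators of the members, in column vectors,
   with ev f = b f for a basis b of the intersection T of two members. *)
Lemma pencil_lift (Fam : {set {set V}}) (Tb : {vspace 'rV[F]_n}) : \dim Tb = t ->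
  (forall U, U \in Fam -> free_of_rank k U) ->
  (forall U U', U \in Fam -> U' \in Fam -> meets U U') ->
  (forall U, U \in Fam -> (Tb <= red U)%VS) ->
  (forall B, \dim B = k -> (Tb <= B)%VS -> exists2 U, U \in Fam & red U = B) ->
  exists2 T, free_of_rank t T & forall U, U \in Fam -> T \subset U.
Proof.
move=> dT ff mt sub sur.
have [B1 [dB1 TB1 _ _ _]] : exists B, [/\ \dim B = (\dim Tb + (k - t))%N, (Tb <= B)%VS,
     (B <= fullv)%VS, (B :&: Tb = Tb)%VS & (B :&: Tb = Tb)%VS].
  apply: common_complement; rewrite ?subvf ?subvv ?dim_rV ?dT //; clear -tk kn; lia.
have [B2 [dB2 TB2 _ B12 _]] : exists B, [/\ \dim B = (\dim Tb + (k - t))%N, (Tb <= B)%VS,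
     (B <= fullv)%VS, (B :&: B1 = Tb)%VS & (B :&: B1 = Tb)%VS].
  apply: common_complement; rewrite ?subvf ?subvv ?dim_rV ?dB1 ?dT //; clear -tk kn; lia.
rewrite dT subnKC ?(ltnW tk) // in dB1 dB2.
have [U1 U1F E1] := sur B1 dB1 TB1; have [U2 U2F E2] := sur B2 dB2 TB2.
have [T [fT TU1 TU2]] := mt U1 U2 U1F U2F.
exists T => //.
have [b ib TE] := freeP _ _ fT.
(* S U is the annihilator of U. Transversal pairs are those whose reductions meet in dimension
   exactly t, which makes their sum free by [exists_sum_span]. *)
pose S (U : {set V}) (f : 'cV[R]_n) := U \in Fam /\ forall u, u \in U -> u *m f = 0.
pose tr (U U' : {set V}) := U \in Fam /\ U' \in Fam /\ \dim (red U :&: red U') = t.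
pose redc := [the {additive 'cV[R]_n -> 'cV[F]_n} of map_mx pi].
pose ev := [the {additive 'cV[R]_n -> 'cV[R]_t} of mulmx b].
have perp_ann U f : S U f -> (red U <= annihilator (piM f))%VS.
  move=> [UF h]; apply/subvP => x /(mem_red cd _ (ff U UF))[u uU <-].
  by rewrite annP -piM_mul h // /residue_mx map_mx0.
have perp_lift U (f : 'cV[F]_n) : U \in Fam -> (red U <= annihilator f)%VS ->
    exists2 f', S U f' & piM f' = f.
  move=> UF h; have [g ig UE] := freeP _ _ (ff U UF).
  have [hg gh] := right_inverse cd (etrans (esym (injmx_piM cd g)) ig).
  have [f0 Ef0] := piM_lift cd f.
  exists (f0 - hg *m (g *m f0)).
    split=> // u; rewrite UE => /rspanP[c ->].
    by rewrite mulmxBr -!mulmxA [g *m (hg *m _)]mulmxA gh mul1mx subrr.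
  rewrite piMB 2!piM_mul Ef0 (_ : piM g *m f = 0) ?mulmx0 ?subr0 //.
  apply/row_matrixP => i; rewrite row_mul row0; apply/eqP; rewrite -annP (subvP h) //.
  by rewrite UE (red_rspan cd); apply/rspP; exists (delta_mx 0 i); rewrite rowE.
have levels i U f : S U f -> thM i (ev f).
  apply: (@ev_levels _ _ _ redc ev (fun i x => thM i x) _ S tr U1 U2) => //.
  - by move=> x; apply: thM0.
  - by move=> j x y hx hy; apply: thMD => //; apply: thMN.
  - move=> W x y [WF hx] [_ hy]; split=> // u uW.
    by rewrite mulmxBr hx // hy // subrr.
  - move=> j W f' [WF hf] f0 IH.
    have [g ig WE] := freeP _ _ (ff W WF).
    have [hg gh] := right_inverse cd (etrans (esym (injmx_piM cd g)) ig).
    (* The columns of P annihilate W, so b P is already at level j; writing f' = P f' with f' zero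
       modulo N gains one level. *)
    pose P := 1%:M - hg *m g.
    have gP : g *m P = 0 by rewrite mulmxBr mulmx1 mulmxA gh mul1mx subrr.
    have gf : g *m f' = 0.
      apply/row_matrixP => a; rewrite row_mul row0; apply: hf; by rewrite WE row_in_rspan.
    have Pf : P *m f' = f' by rewrite mulmxBl mul1mx -mulmxA gf mulmx0 subr0.
    rewrite /ev /= -Pf mulmxA -addn1; apply: (thMM cd); last by rewrite -(thM_1 cd); apply/eqP.
    apply/thMP => a c; have SP : S W (col c P).
      split=> // u; rewrite WE => /rspanP[d ->].
      by rewrite colE -!mulmxA [g *m (P *m _)]mulmxA gP mul0mx mulmx0.
    by have /thMP/(_ a 0) := IH _ SP; rewrite /ev /= colE mulmxA -colE mxE.
  - move=> W W' x y [WF [WF' dWW]] [_ hx] [_ hy] E.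
    (* With G a basis of W + W', the vector G x reduces to 0, so subtracting hG (G x) makes x
       annihilate both members without changing its reduction. *)
    have [W0 [fW0 W0W W0W']] := mt W W' WF WF'.
    have [G [Gf WG WG' GE]] := exists_sum_span (ff W WF) (ff W' WF') fW0 W0W W0W' dWW.
    have [hG Gh] := right_inverse cd Gf.
    have Sx : S W x by [].
    have Sy : S W' y by [].
    exists (x - hG *m (G *m x)).
      split; split=> // u.
        move/(subsetP WG)/rspanP => [c ->].
        by rewrite mulmxBr -!mulmxA [G *m (hG *m _)]mulmxA Gh mul1mx subrr.
      move/(subsetP WG')/rspanP => [c ->].
      by rewrite mulmxBr -!mulmxA [G *m (hG *m _)]mulmxA Gh mul1mx subrr.
    rewrite /redc /= -/(residue_mx pi _) piMB 2!piM_mul (_ : piM G *m piM x = 0) ?mulmx0 ?subr0 //.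
    apply/row_matrixP => a; rewrite row_mul row0; apply/eqP; rewrite -annP.
    have : row a (piM G) \in (red W + red W')%VS.
      by rewrite -GE; apply/rspP; exists (delta_mx 0 a); rewrite rowE.
    apply: subvP; rewrite subv_add (perp_ann _ _ Sx) /=.
    have -> : piM x = piM y by exact: E.
    exact: perp_ann.
  - move=> W W' x y Sx Sy E _.
    have [WF hx] := Sx; have [WF' hy] := Sy.
    have Exy : piM y = piM x by rewrite /residue_mx; symmetry; exact: E.
    have s1 := perp_ann _ _ Sx; have s2 := perp_ann _ _ Sy; rewrite Exy in s2.
    (* There is room for a common complement inside the annihilator of x, of dimension at least n -
       1: k + (k - t) <= n - 1 because t > 0. *)
    have dA := dim_ann_cap (piM x) fullv; rewrite capfv dim_rV in dA.
    have [B [dB TB BA BW BW']] : exists B, [/\ \dim B = (\dim Tb + (k - t))%N, (Tb <= B)%VS,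
       (B <= annihilator (piM x))%VS, (B :&: red W = Tb)%VS & (B :&: red W' = Tb)%VS].
      apply: common_complement; rewrite ?sub // (dim_red cd (ff _ _)) //.
        by clear -t0 tk kn dA; move: dA; lia.
      by clear -t0 tk kn dA; move: dA; lia.
    rewrite dT subnKC ?(ltnW tk) // in dB.
    have [U' U'F E'] := sur B dB TB.
    exists U'; split.
    + by split=> //; split=> //; rewrite E' capvC BW.
    + by split=> //; split=> //; rewrite E' capvC BW'.
    by apply: perp_lift; rewrite ?E'.
  - move=> W x Sx; have [WF hx] := Sx; have s1 := perp_ann _ _ Sx.
    set f0 := piM x in s1.
    (* f1 is f0 applied to the B2-component. On B2 it agrees with f0; on B1 that component lies in
       B1 :&: B2 = Tb, where f0 vanishes. So f1 kills B1 and f0 - f1 kills B2. *)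
    pose p2 := addv_pi2 B1 B2.
    pose f1 : 'cV[F]_n := \col_j (p2 (delta_mx 0 j) *m f0) 0 0.
    have f1E y : y *m f1 = p2 y *m f0.
      rewrite {2}[y]row_sum_delta linear_sum mulmx_suml; apply/matrixP => a c.
      rewrite !ord1 mxE summxE; apply: eq_bigr => j _.
      by rewrite linearZ -scalemxAl !mxE.
    have TW := sub W WF.
    have B1f1 : (B1 <= annihilator f1)%VS.
      apply/subvP => y yB1; rewrite annP f1E.
      have yE := addv_pi1_pi2 (subvP (addvSl B1 B2) _ yB1).
      have : p2 y \in Tb.
        rewrite -B12 memv_cap memv_pi2 /=.
        have -> : p2 y = y - addv_pi1 B1 B2 y by rewrite -[X in X - _]yE addrAC subrr add0r.
        by rewrite rpredB // memv_pi1.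
      by move/(subvP TW)/(subvP s1); rewrite annP.
    have B2f2 : (B2 <= annihilator (f0 - f1))%VS.
      apply/subvP => y yB2; rewrite annP mulmxBr f1E addv_pi2_id // subrr //.
    have Tf1 : (Tb <= annihilator f1)%VS by apply: subv_trans B1f1.
    have Tf2 : (Tb <= annihilator (f0 - f1))%VS by apply: subv_trans B2f2.
    have dA := dim_ann_cap f1 fullv; rewrite capfv dim_rV in dA.
    have dA2 := dim_ann_cap (f0 - f1) (annihilator f1).
    have TA : (Tb <= annihilator f1 :&: annihilator (f0 - f1))%VS by rewrite (@subv_cap F) Tf1.
    (* The two functionals cut out codimension at most 2, and k <= n - 2, so one member serves
       both. *)
    have [B [dB TB BA _ _]] : exists B, [/\ \dim B = (\dim Tb + (k - t))%N, (Tb <= B)%VS,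
       (B <= annihilator f1 :&: annihilator (f0 - f1))%VS, (B :&: Tb = Tb)%VS & (B :&: Tb = Tb)%VS].
      apply: common_complement; rewrite ?subvv ?dT //; clear -t0 tk kn dA dA2; move: dA dA2; lia.
    rewrite dT subnKC ?(ltnW tk) // in dB.
    have [U' U'F E'] := sur B dB TB.
    have B1f := B1f1; have B2f := B2f2; rewrite -E1 in B1f; rewrite -E2 in B2f.
    have [x1 S1 Ex1] := perp_lift U1 f1 U1F B1f.
    have [x2 S2 Ex2] := perp_lift U2 (f0 - f1) U2F B2f.
    have [b1 Sb1 Eb1] : exists2 f', S U' f' & piM f' = f1.
      by apply: perp_lift; rewrite // E' (subv_trans BA) // capvSl.
    have [b2 Sb2 Eb2] : exists2 f', S U' f' & piM f' = f0 - f1.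
      by apply: perp_lift; rewrite // E' (subv_trans BA) // capvSr.
    exists x1, x2, U', b1, b2; rewrite /redc /= -!/(residue_mx pi _) Ex1 Ex2 Eb1 Eb2 -/f0.
    by split; split=> //; rewrite addrC subrK.
  - move=> x [_ h]; apply/row_matrixP => a; rewrite /ev /= row_mul row0; apply: h.
    by rewrite (subsetP TU1) // TE row_in_rspan.
  - move=> x [_ h]; apply/row_matrixP => a; rewrite /ev /= row_mul row0; apply: h.
    by rewrite (subsetP TU2) // TE row_in_rspan.
move=> U UF; have [g ig UE] := freeP _ _ (ff U UF).
have [hg gh] := right_inverse cd (etrans (esym (injmx_piM cd g)) ig).
have gP : g *m (1%:M - hg *m g) = 0 by rewrite mulmxBr mulmx1 mulmxA gh mul1mx subrr.
(* Level m is zero, so b = (b hg) g and the rows of b are combinations of the rows of g. *)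
have bP : b *m (1%:M - hg *m g) = 0.
  apply/matrixP => a c; rewrite [RHS]mxE.
  have SP : S U (col c (1%:M - hg *m g)).
    split=> // u; rewrite UE => /rspanP[d ->].
    by rewrite colE -!mulmxA [g *m (_ *m _)]mulmxA gP mul0mx mulmx0.
  have := thMm cd (leqnn m) (levels m U _ SP); rewrite /ev /= colE mulmxA -colE => /matrixP/(_ a 0).
  by rewrite mxE [RHS]mxE.
rewrite TE UE; apply: rspan_sub => a; apply/rspanP; exists (row a b *m hg).
rewrite -mulmxA -row_mul; congr row; apply/eqP; rewrite -subr_eq0 -{1}[b]mulmx1 -mulmxBr.
by rewrite bP.
Qed.

(* ev_levels is applied to the members themselves; ev is multiplication by the
   projector killing the sum of two members. *)
Lemma dual_lift (Fam : {set {set V}}) (Yb : {vspace 'rV[F]_n}) : \dim Yb = (2 * k - t)%N ->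
  (forall U, U \in Fam -> free_of_rank k U) ->
  (forall U U', U \in Fam -> U' \in Fam -> meets U U') ->
  (forall U, U \in Fam -> (red U <= Yb)%VS) ->
  (forall B, \dim B = k -> (B <= Yb)%VS -> exists2 U, U \in Fam & red U = B) ->
  exists2 Y, free_of_rank (2 * k - t) Y & forall U, U \in Fam -> U \subset Y.
Proof.
move=> dY ff mt sub sur.
have dred U : U \in Fam -> \dim (red U) = k by move=> UF; rewrite (dim_red cd (ff U UF)).
have [|B1 B1Y dB1] := @exists_subspace _ _ Yb k; first by rewrite dY; clear -tk; lia.
have [|A1 A1B dA1] := @exists_subspace _ _ B1 (k - t); first by rewrite dB1; clear; lia.
have A1Y := subv_trans A1B B1Y.
have [B2 [dB2 _ B2Y B2A _]] : exists B, [/\ \dim B = (\dim (0 : {vspace 'rV[F]_n}) + k)%N, (0 <= B)%VS,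
     (B <= Yb)%VS, (B :&: A1 = 0)%VS & (B :&: A1 = 0)%VS].
  apply: common_complement; rewrite ?sub0v ?dA1 ?dY //; clear -tk; lia.
rewrite dimv0 add0n in dB2.
(* B avoids a (k-t)-space of C, so the intersection has dimension at most t; both lie in Yb, of
   dimension 2k - t, so it is at least t. *)
have cap_t B C A : \dim B = k -> \dim C = k -> (B <= Yb)%VS -> (C <= Yb)%VS ->
    (A <= C)%VS -> \dim A = (k - t)%N -> (B :&: A = 0)%VS -> \dim (B :&: C) = t.
  move=> dB dC BY CY AC dA BA.
  have s1 := dimv_sum_cap B C; have s2 := dimv_sum_cap (B :&: C) A.
  have s3 : (\dim (B + C) <= \dim Yb)%N by rewrite dimvS // subv_add BY.
  have s4 : (\dim (B :&: C + A) <= \dim C)%N by rewrite dimvS // subv_add capvSr.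
  have s5 : (B :&: C :&: A = 0)%VS.
    by apply/eqP; rewrite -subv0 -BA capvS // capvSl.
  rewrite s5 dimv0 in s2.
  by clear -s1 s2 s3 s4 dB dC dA dY tk; lia.
have dT : \dim (B2 :&: B1) = t by apply: (cap_t _ _ A1).
have [U1 U1F E1] := sur B2 dB2 B2Y; have [U2 U2F E2] := sur B1 dB1 B1Y.
have [W [fW WU1 WU2]] := mt U1 U2 U1F U2F.
have dT' : \dim (red U1 :&: red U2) = t by rewrite E1 E2.
have [G [Gf UG1 UG2 GE]] := exists_sum_span (ff _ U1F) (ff _ U2F) fW WU1 WU2 dT'.
have [H GH] := right_inverse cd Gf.
have EY : Yb = (red U1 + red U2)%VS.
  apply/eqP; rewrite eq_sym eqEdim subv_add E1 E2 B1Y B2Y /= dY.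
  by have := dimv_sum_cap B2 B1; rewrite dT dB1 dB2; clear; lia.
exists (rowspan G); first by apply/freeP; exists G; rewrite // (injmx_piM cd).
pose P := 1%:M - H *m G.
have GP : G *m P = 0 by rewrite mulmxBr mulmx1 mulmxA GH mul1mx subrr.
pose S (U : {set V}) (u : V) := U \in Fam /\ u \in U.
pose tr (U U' : {set V}) := U \in Fam /\ U' \in Fam /\ \dim (red U :&: red U') = t.
pose redc := [the {additive V -> 'rV[F]_n} of map_mx pi].
pose ev := [the {additive V -> V} of mulmxr P].
have evG (U : {set V}) (u : V) : U \subset rowspan G -> u \in U -> u *m P = 0.
  by move=> UG uU; have /rspanP[c ->] := subsetP UG u uU; rewrite -mulmxA GP mulmx0.
have Sred U u : S U u -> piM u \in red U.
  by move=> [UF uU]; apply/(mem_red cd _ (ff U UF)); exists u.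
have levels i U u : S U u -> thM i (ev u).
  apply: (@ev_levels _ _ _ redc ev (fun i x => thM i x) _ S tr U1 U2) => //.
  - by move=> x; apply: thM0.
  - by move=> j x y hx hy; apply: thMD => //; apply: thMN.
  - move=> U' x y [UF xU] [_ yU]; split=> //.
    have [g ig UE] := freeP _ _ (ff U' UF); move: xU yU; rewrite UE.
    move=> /rspanP[c ->] /rspanP[d ->]; apply/rspanP; exists (c - d).
    by rewrite mulmxBl.
  - move=> j U' x [UF xU] x0 IH.
    have [g ig UE] := freeP _ _ (ff U' UF).
    have [h gh] := right_inverse cd (etrans (esym (injmx_piM cd g)) ig).
    (* The coordinates x h vanish modulo N, while the rows of g lie in U' and are at level j by
       induction; the product gains one level. *)
    have xE : x = x *m h *m g.
      by move: xU; rewrite UE => /rspanP[c ->]; rewrite -(mulmxA c) gh mulmx1.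
    rewrite /ev /= xE -mulmxA -add1n; apply: (thMM cd).
      by rewrite -(thM_1 cd) piM_mul (_ : piM x = 0) ?mul0mx.
    apply/thMP => a b; have Sg : S U' (row a g) by rewrite /S UE row_in_rspan -UE.
    by have /thMP/(_ 0 b) := IH _ Sg; rewrite /ev /= -row_mul mxE.
  - move=> U' U'' x y [UF [UF' dUU]] [_ xU] [_ yU] E.
    have [W0 [fW0 W0U W0U']] := mt U' U'' UF UF'.
    have dW0 := dim_red cd fW0.
    have sW0 (Z : {set V}) : Z \in Fam -> W0 \subset Z -> (red W0 <= red Z)%VS.
      move=> ZF WZ; apply/subvP => v /(mem_red cd _ fW0)[w wW <-].
      by apply/(mem_red cd _ (ff _ ZF)); exists w => //; apply: (subsetP WZ).
    (* Equality by dimension, so a vector in both reductions lifts to the common submodule W0. *)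
    have WE : red W0 = (red U' :&: red U'')%VS.
      by apply/eqP; rewrite eqEdim (@subv_cap F) !sW0 //= dUU dW0.
    have : piM x \in red W0.
      rewrite WE memv_cap (Sred U') //= (_ : piM x = piM y) ?(Sred U'') //; exact: E.
    case/(mem_red cd _ fW0) => z zW zE; exists z; last exact: zE.
    by split; split=> //; apply: (subsetP W0U) || apply: (subsetP W0U').
  - move=> U' U'' x y Sx Sy E x0.
    have [UF xU] := Sx; have [UF' yU] := Sy.
    have xr := Sred _ _ Sx; have yr := Sred _ _ Sy.
    have Exy : piM y = piM x by symmetry; exact: E.
    rewrite Exy in yr.
    have dx : \dim <[piM x]>%VS = 1 by rewrite dim_vline (_ : piM x != 0).
    have xcap (Z : {vspace 'rV[F]_n}) : piM x \in Z -> (<[piM x]> <= Z)%VS by rewrite memvE.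
    have ex (Z : {set V}) : Z \in Fam -> piM x \in red Z ->
        exists A, [/\ (A <= red Z)%VS, \dim A = (k - t)%N & (A :&: <[piM x]> = 0)%VS].
      move=> ZF xZ.
      have [A [dA _ AZ Ax _]] : exists B, [/\ \dim B = (\dim (0 : {vspace 'rV[F]_n}) + (k - t))%N,
         (0 <= B)%VS, (B <= red Z)%VS, (B :&: <[piM x]> = 0)%VS & (B :&: <[piM x]> = 0)%VS].
        apply: common_complement; rewrite ?sub0v ?xcap ?dx ?dred //; clear -t0 tk; lia.
      by exists A; rewrite dA dimv0.
    (* C1 and C2 are (k-t)-spaces of the two reductions avoiding the line of x. A k-space B through
       x that meets each Ci + <x> in that line only meets Ci trivially, hence is transversal to both
       by [cap_t]. *)
    have [C1 [C1U dC1 C1x]] := ex U' UF xr; have [C2 [C2U dC2 C2x]] := ex U'' UF' yr.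
    have dCx (C : {vspace 'rV[F]_n}) : \dim C = (k - t)%N -> (\dim (C + <[piM x]>) + (k - 1) <= \dim Yb)%N.
      by move=> dC; have := dimv_add_leqif C <[piM x]>; rewrite dx dC dY => -[+ _]; clear -t0 tk; lia.
    have [B [dB xB BY BC1 BC2]] : exists B, [/\ \dim B = (\dim <[piM x]> + (k - 1))%N,
        (<[piM x]> <= B)%VS, (B <= Yb)%VS, (B :&: (C1 + <[piM x]>) = <[piM x]>)%VS
        & (B :&: (C2 + <[piM x]>) = <[piM x]>)%VS].
      apply: common_complement; rewrite ?addvSr ?dCx ?subv_add //.
        by rewrite (subv_trans C1U) ?sub // xcap // (subvP (sub _ UF)).
      by rewrite (subv_trans C2U) ?sub // xcap // (subvP (sub _ UF)).
    rewrite dx subnKC ?(leq_ltn_trans _ tk) // in dB.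
    have cap0 (C : {vspace 'rV[F]_n}) : (C :&: <[piM x]> = 0)%VS -> (B :&: (C + <[piM x]>) = <[piM x]>)%VS ->
        (B :&: C = 0)%VS.
      move=> Cx BC; apply/eqP; rewrite -subv0 -Cx (@subv_cap F) capvSr -BC.
      by rewrite capvS // addvSl.
    have [Z ZF ZE] := sur B dB BY.
    exists Z; split.
    + split; [exact: UF | split; [exact: ZF | rewrite capvC ZE]].
      exact: (cap_t _ _ _ dB (dred _ UF) BY (sub _ UF) C1U dC1 (cap0 _ C1x BC1)).
    + split; [exact: UF' | split; [exact: ZF | rewrite capvC ZE]].
      exact: (cap_t _ _ _ dB (dred _ UF') BY (sub _ UF') C2U dC2 (cap0 _ C2x BC2)).
    have : piM x \in red Z by rewrite ZE (subvP xB) // memv_line.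
    by case/(mem_red cd _ (ff _ ZF)) => b bZ Eb; exists b.
  - move=> U' x Sx; have [UF xU] := Sx.
    have : piM x \in Yb by rewrite (subvP (sub _ UF)) // Sred.
    rewrite EY => /memv_addP[y1 y1U [y2 y2U E]].
    have [x1 x1U Ex1] := mem_red cd _ (ff _ U1F) y1U.
    have [x2 x2U Ex2] := mem_red cd _ (ff _ U2F) y2U.
    (* Since k >= 2, a single k-space of Yb contains both components. *)
    have [B [BY dB yB]] : exists B, [/\ (B <= Yb)%VS, \dim B = k & (<[y1]> + <[y2]> <= B)%VS].
      have dL : (\dim (<[y1]> + <[y2]>) <= 2)%N.
        have := dimv_add_leqif <[y1]> <[y2]>; rewrite !dim_vline => -[+ _].
        by case: (y1 != 0); case: (y2 != 0); clear; lia.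
      have LY : (<[y1]> + <[y2]> <= Yb)%VS.
        by rewrite subv_add -!memvE EY (subvP (addvSl _ _) _ y1U) (subvP (addvSr _ _) _ y2U).
      have [L1 L2] : (\dim (<[y1]> + <[y2]>) <= k)%N /\ (k <= 2 * k - t)%N.
        by clear -dL t0 tk; lia.
      have [||B [dB LB BY _ _]] := @common_complement _ _ (k - \dim (<[y1]> + <[y2]>)) _ _ _ Yb
        (subvv (<[y1]> + <[y2]>)%VS) (subvv _) LY LY; rewrite ?subnKC // ?dY //.
      by exists B; rewrite dB subnKC.
    have [Z ZF ZE] := sur B dB BY.
    have mB (y : 'rV[F]_n) : (<[y]> <= B)%VS -> exists2 b, b \in Z & piM b = y.
      by rewrite -memvE -ZE => /(mem_red cd _ (ff _ ZF)).
    move: yB; rewrite subv_add => /andP[/mB[b1 b1Z Eb1] /mB[b2 b2Z Eb2]].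
    exists x1, x2, Z, b1, b2; rewrite /redc /= -!/(residue_mx pi _) Ex1 Ex2 Eb1 Eb2.
    by split; split.
  - by move=> x [_]; apply: evG.
  - by move=> x [_]; apply: evG.
move=> U UF; apply/subsetP => u uU; apply/rspanP; exists (u *m H).
have := thMm cd (leqnn m) (levels m U u (conj UF uU)).
by rewrite /ev /= mulmxBr mulmx1 mulmxA => /eqP; rewrite subr_eq0 => /eqP.
Qed.

End Lifting.

(** * Intersecting families of free submodules *)

Section FreeEKR.
Variables (R : finNzRingType) (F : finFieldType) (pi : {rmorphism R -> F}).
Variables (theta : R) (m : nat).
Hypothesis cd : uniformizer pi theta m.
Local Notation q := #|F|.
Variables (n k t : nat).
Local Notation V := 'rV[R]_n.
Local Notation red := (@red R F pi n).
Local Notation meets := (@meets R n t).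
Hypotheses (t0 : (0 < t)%N) (tk : (t < k)%N) (kn : (2 * k <= n)%N).

(** Intersecting families only constrain distinct members; this supplies the diagonal. *)
Lemma meets_refl (U : {set V}) : free_of_rank k U -> meets U U.
Proof.
case/freeP => g ig UE; pose C : 'M[R]_(t, k) := pid_mx t.
exists (rowspan (C *m g)).
have sub : rowspan (C *m g) \subset U by rewrite UE; apply: rspan_sub => i; apply: mul_in_rspan.
split=> //; apply/freeP; exists (C *m g) => //.
rewrite (injmx_piM cd) piM_mul /row_free mxrankMfree; last by rewrite -(injmx_piM cd).
by rewrite /residue_mx map_pid_mx rank_pid_mx // ltnW.
Qed.

Lemma red_sub s s' (U U' : {set V}) : free_of_rank s U -> free_of_rank s' U' ->
  U \subset U' -> (red U <= red U')%VS.
Proof.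
move=> fU fU' UU; apply/subvP => x /(mem_red cd _ fU)[u uU <-].
by apply/(mem_red cd _ fU'); exists u => //; apply: (subsetP UU).
Qed.

Variable Fam : {set {set V}}.
Hypothesis ff : forall U, U \in Fam -> free_of_rank k U.
Hypothesis mt : forall U U', U \in Fam -> U' \in Fam -> meets U U'.

Let A := red @: Fam.

Lemma tint_red : @tint F _ k t A.
Proof.
split=> [_ /imsetP[U UF ->]|_ _ /imsetP[U UF ->] /imsetP[U' UF' ->]].
  by rewrite (dim_red cd (ff UF)).
have [W [fW WU WU']] := mt UF UF'; rewrite -(dim_red cd fW); apply: dimvS.
by rewrite (@subv_cap F) (red_sub fW (ff UF) WU) (red_sub fW (ff UF') WU').
Qed.

Lemma card_Fam_red : (#|Fam| <= #|A| * q ^ ((m - 1) * ((k - t) * (n - k))))%N.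
Proof.
rewrite -[#|Fam|]sum1_card (partition_big red (fun Y => Y \in A)) /=; last first.
  by move=> U UF; apply: imset_f.
rewrite -sum_nat_const; apply: leq_sum => Y _; rewrite sum1dep_card.
apply: (fiber_bound cd (t := t) (k := k) t0 (ltnW tk) _ (Y := Y)).
- by clear -kn; lia.
- by move=> U; rewrite inE => /andP[/ff fU /eqP].
by move=> U U'; rewrite !inE => /andP[UF _] /andP[UF' _]; apply: mt.
Qed.

Let bnd : rat := q%:R ^+ ((m - 1) * (k - t) * (n - k)) * q_binomial F (n - t) (k - t).

Let qe_gt0 e : (0 : rat) < q%:R ^+ e.
Proof. by rewrite exprn_gt0 // ltr0n ltnW // finNzRing_gt1. Qed.

Let card_Fam_le : #|Fam|%:R <= q%:R ^+ ((m - 1) * (k - t) * (n - k)) * #|A|%:R :> rat.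
Proof. by rewrite mulrC -mulnA -natrX -natrM ler_nat card_Fam_red. Qed.

Let card_A_le : #|A|%:R <= q_binomial F (n - t) (k - t).
Proof. by have := field_ekr_bound (vT := 'rV[F]_n) _ tk tint_red; rewrite dim_rV; apply. Qed.

Lemma free_ekr_bound : #|Fam|%:R <= bnd.
Proof. by apply: le_trans card_Fam_le _; rewrite ler_pM2l. Qed.

End FreeEKR.

Section FreeEKRExtremal.
Variables (R : finNzRingType) (F : finFieldType) (pi : {rmorphism R -> F}).
Variables (theta : R) (m : nat).
Hypothesis cd : uniformizer pi theta m.
Local Notation q := #|F|.
Variables (n k t : nat).
Local Notation V := 'rV[R]_n.
Local Notation red := (@red R F pi n).
Local Notation meets := (@meets R n t).
Hypotheses (t0 : (0 < t)%N) (tk : (t < k)%N) (kn : (2 * k <= n)%N).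

Lemma card_free_sub d (Y : {set V}) : free_of_rank d Y ->
  (#|[set U : {set V} | free_of_rank k U && (U \subset Y)]| <=
   #|[set U : {set 'rV[R]_d} | free_of_rank k U]|)%N.
Proof.
case/freeP => g ig ->; pose f (U : {set 'rV[R]_d}) : {set V} := [set c *m g | c in U].
apply: leq_trans (leq_imset_card f _); apply: subset_leq_card.
apply/subsetP => U; rewrite inE => /andP[/freeP[u iu ->] /subsetP sub].
have [C uE] : exists C, u = C *m g.
  by apply: rows_rspan => i; apply: sub; apply: row_in_rspan.
apply/imsetP; exists (rowspan C).
  rewrite inE; apply/freeP; exists C => //; apply/injmxP => c d' E.
  by move/injmxP: iu; apply; rewrite uE !mulmxA E.
apply/setP => x; apply/rspanP/imsetP => [[c ->]|[_ /rspanP[c ->] ->]].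
  by exists (c *m C); [apply/rspanP; exists c | rewrite uE mulmxA].
by exists c; rewrite uE mulmxA.
Qed.

Variable Fam : {set {set V}}.
Hypothesis ff : forall U, U \in Fam -> free_of_rank k U.
Hypothesis mt : forall U U', U \in Fam -> U' \in Fam -> meets U U'.
Hypothesis cF : #|Fam|%:R = q%:R ^+ ((m - 1) * (k - t) * (n - k)) * q_binomial F (n - t) (k - t).

Theorem free_ekr_extremal :
  (exists2 T, free_of_rank t T &
     forall U, U \in Fam = free_of_rank k U && (T \subset U)) \/
  ((2 * k = n)%N /\ exists2 Y, free_of_rank (2 * k - t) Y &
     forall U, U \in Fam = free_of_rank k U && (U \subset Y)).
Proof.
have qe : (0 : rat) < q%:R ^+ ((m - 1) * (k - t) * (n - k)).
  by rewrite exprn_gt0 // ltr0n ltnW // finNzRing_gt1.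
have tA := tint_red cd ff mt.
have kn' : (2 * k <= \dim {: 'rV[F]_n})%N by rewrite dim_rV.
(* The fibre bound leaves no slack: the reductions must already attain the bound over F. *)
have cA : #|red @: Fam|%:R = q_binomial F (\dim {: 'rV[F]_n} - t) (k - t).
  apply/eqP; rewrite eq_le field_ekr_bound //= dim_rV -(ler_pM2l qe) -cF.
  by rewrite mulrC -mulnA -natrX -natrM ler_nat (card_Fam_red cd t0 tk kn).
have ma U : U \in Fam -> red U \in red @: Fam by apply: imset_f.
case: (field_ekr_extremal kn' tk tA cA t0) => [[Tb dT TE]|[nE [Yb dY YE]]]; [left | right].
  have [|B dB TB|T fT TU] := pencil_lift cd t0 tk kn dT ff mt.
  - by move=> U /ma; rewrite TE => /andP[].
  - by have /imsetP[U UF ->] : B \in red @: Fam; [rewrite TE dB eqxx | exists U].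
  exists T => // U.
  suff -> : Fam = [set U : {set V} | free_of_rank k U && (T \subset U)] by rewrite inE.
  apply/eqP; rewrite eqEcard; apply/andP; split.
    by apply/subsetP => U' UF; rewrite inE ff // TU.
  rewrite -(ler_nat rat) cF; apply: (free_ekr_bound cd t0 tk kn).
    by move=> U'; rewrite inE => /andP[].
  by move=> U1 U2; rewrite !inE => /andP[_ TU1] /andP[_ TU2]; exists T.
rewrite dim_rV in nE; split=> //.
have [|B dB BY|Y fY UY] := dual_lift cd t0 tk dY ff mt.
- by move=> U /ma; rewrite YE => /andP[].
- by have /imsetP[U UF ->] : B \in red @: Fam; [rewrite YE dB eqxx | exists U].
exists Y => // U.
suff -> : Fam = [set U : {set V} | free_of_rank k U && (U \subset Y)] by rewrite inE.
apply/eqP; rewrite eqEcard; apply/andP; split.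
  by apply/subsetP => U' UF; rewrite inE ff // UY.
(* For n = 2k the free rank-k submodules of R^(2k-t) number exactly the bound, by the symmetry of
   the Gaussian coefficient. *)
apply: leq_trans (card_free_sub fY) _.
have k2 : (k <= 2 * k - t)%N by clear -tk; lia.
rewrite -(ler_nat rat) cF (card_free cd k2).
have -> : (k - t = 2 * k - t - k)%N by clear -tk; lia.
rewrite -nE gbin_sym //.
have -> : (2 * k - k = k)%N by clear; lia.
by rewrite mulnAC.
Qed.

End FreeEKRExtremal.

(** * Shapes and subspaces of the Hjelmslev geometry *)

Section Shapes.
Variable R : finNzRingType.

Lemma submodule_free n s (U : {set 'rV[R]_n}) : free_of_rank s U -> submodule U.
Proof.
case/freeP => g _ ->; apply/and3P; split.
- by apply/rspanP; exists 0; rewrite mul0mx.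
- apply/forall_inP => _ /rspanP[c ->]; apply/forall_inP => _ /rspanP[d ->].
  by apply/rspanP; exists (c + d); rewrite mulmxDl.
- apply/forallP => a; apply/forall_inP => _ /rspanP[c ->].
  by apply/rspanP; exists (a *: c); rewrite -scalemxAl.
Qed.

(** As N^m = 0, the kernel condition for the shape m^s is injectivity of the parametrization. *)
Lemma has_shape_free (N : {set R}) m n s (U : {set 'rV[R]_n}) :
  ideal_exp N m = [set 0] -> (0 < m)%N -> has_shape N m (nseq s m) U = free_of_rank s U.
Proof.
move=> Nm m0; rewrite /has_shape.
have -> : is_shape m (nseq s m).
  rewrite /is_shape all_nseq m0 leqnn orbT andbT.
  by case: s => //= s; elim: s => //= s IH; rewrite /geq /= leqnn.
rewrite -[in RHS](size_nseq s m) /=; apply: eq_existsb => g; rewrite andbC; congr (_ && _).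
apply/forallP/injectiveP => [h c d E|inj c].
  have /eqP := h (c - d); rewrite mulmxBl E subrr eqxx => /esym/forallP h0.
  apply/rowP => j; apply/eqP; rewrite -subr_eq0; have := h0 j.
  by rewrite nth_nseq -[X in (_ < X)%N](size_nseq s m) ltn_ord Nm inE !mxE.
apply/eqP; transitivity (c == 0).
  by apply/eqP/eqP => [E|->]; [apply: inj; rewrite E mul0mx | rewrite mul0mx].
apply/eqP/forallP => [-> j|h].
  by rewrite nth_nseq -[X in (_ < X)%N](size_nseq s m) ltn_ord Nm inE mxE.
apply/rowP => j; have := h j.
by rewrite nth_nseq -[X in (_ < X)%N](size_nseq s m) ltn_ord Nm inE mxE => /eqP.
Qed.

Lemma subspace_of_shape_free (N : {set R}) m n s (S : {set {set 'rV[R]_n}}) :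
  ideal_exp N m = [set 0] -> (0 < m)%N ->
  reflect (exists2 U, free_of_rank s U & S = points_of U)
          (subspace_of_shape N m (nseq s m) S).
Proof.
move=> Nm m0; apply: (iffP existsP) => [[U /and3P[_ hs /eqP ->]]|[U fU ->]]; exists U => //.
  by rewrite -(has_shape_free s U Nm m0).
by rewrite (submodule_free fU) has_shape_free // fU eqxx.
Qed.

Lemma Hjelmslev_free n d (S : {set {set 'rV[R]_n}}) :
  reflect (exists2 U, free_of_rank d.+1 U & S = points_of U) (Hjelmslev_subspace d S).
Proof.
apply: (iffP existsP) => [[U /andP[fU /eqP ->]]|[U fU ->]]; exists U => //.
by rewrite fU eqxx.
Qed.

(** Each row of a basis spans a point, so a free submodule is generated by its points. *)
Lemma points_of_sub n s s' (U U' : {set 'rV[R]_n}) : free_of_rank s U -> free_of_rank s' U' ->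
  (points_of U \subset points_of U') = (U \subset U').
Proof.
move=> fU fU'; apply/idP/idP => [sub|UU]; last first.
  by apply/subsetP => P; rewrite !inE => /andP[-> /subset_trans->].
case/freeP: fU sub => g /injmxP ig ->; case/freeP: fU' => g' _ -> sub.
apply: rspan_sub => i.
suff /(subsetP sub) : rowspan (row i g) \in points_of (rowspan g).
  rewrite inE => /andP[_ /subsetP]; apply; apply/rspanP; exists 1%:M; by rewrite mul1mx.
rewrite inE rspan_sub ?andbT; last by move=> j; rewrite [row i g]rowE mul_in_rspan.
apply/freeP; exists (row i g) => //; apply/injmxP => c d /=.
rewrite rowE !mulmxA => /ig E; have := congr1 (fun M => M *m (delta_mx i 0 : 'cV_s)) E.
rewrite /= -!mulmxA mul_delta_mx => {}E; apply/rowP => j; rewrite ord1.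
by move/matrixP/(_ 0 0): E; rewrite !mxE !big_ord1 !mxE !eqxx !mulr1.
Qed.

Lemma points_of_inj n s (U U' : {set 'rV[R]_n}) : free_of_rank s U -> free_of_rank s U' ->
  points_of U = points_of U' -> U = U'.
Proof.
move=> fU fU' E; apply/eqP.
by rewrite eqEsubset -(points_of_sub fU fU') -(points_of_sub fU' fU) E subxx.
Qed.

End Shapes.

Theorem theorem3p3 (R : finNzRingType) (N : {set R}) (m q n t k : nat)
  (hR : chain_ring R) (hN : maximal_ideal N) (hm : nilpotency_index N m)
  (hq : residue_field N q)
  (hn : (3 <= n)%N) (ht : (1 <= t)%N) (htk : (t < k)%N) (hkn : (2 * k <= n)%N)
  (F : {set {set {set 'rV[R]_n}}})
  (hF : intersecting_family N m (nseq t m) (nseq k m) F) :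
  let bound : rat :=
    q%:R ^+ ((m - 1) * (k - t) * (n - k)) * gauss_coef q (n - t) (k - t) in
  [/\ #|F|%:R <= bound,
      bound = #|[set U : {set 'rV[R]_(n - t)} | free_of_rank (k - t) U]|%:R
    & #|F|%:R = bound ->
      (exists T : {set {set 'rV[R]_n}},
         Hjelmslev_subspace (t - 1) T /\
         forall S, S \in F <-> Hjelmslev_subspace (k - 1) S /\ T \subset S)
      \/
      ((2 * k)%N = n /\
       exists T : {set {set 'rV[R]_n}},
         Hjelmslev_subspace (2 * k - t - 1) T /\
         forall S, S \in F <-> Hjelmslev_subspace (k - 1) S /\ S \subset T)].
Proof.
have [K [pi [<- pi_surj pi_ker]]] := hq; have [Nm _] := hm.
have [theta [ker_theta nil_theta theta_neq0]] := chain_ring_uniformizer pi_surj pi_ker hR hm.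
have cd : uniformizer pi theta m by split.
have m0 := m_gt0 cd; have [hFk hFt] := hF.
(* Point sets are replaced by the submodules they come from; [points_of] is injective on free
   submodules of rank k, so the cardinality is kept. *)
pose Fam := [set U : {set 'rV[R]_n} | free_of_rank k U & points_of U \in F].
have ff U : U \in Fam -> free_of_rank k U by rewrite inE => /andP[].
have FE : F = @points_of R n @: Fam.
  apply/setP => S; apply/idP/imsetP => [SF|[U]]; last by rewrite inE => /andP[_ ?] ->.
  have /(subspace_of_shape_free _ _ Nm m0)[U fU SE] := hFk S SF.
  by exists U; rewrite // inE fU -SE.
have cF : #|F| = #|Fam|.
  by rewrite FE card_in_imset // => U U' /ff fU /ff fU'; apply: points_of_inj fU fU'.
have mt U U' : U \in Fam -> U' \in Fam -> meets t U U'.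
  move=> UF UF'; case: (eqVneq U U') => [<-|/eqP UU']; first by apply: (meets_refl cd htk (ff U UF)).
  have /hFt h : points_of U \in F by rewrite FE imset_f.
  have /h{h} h : points_of U' \in F by rewrite FE imset_f.
  have [|_ [/(subspace_of_shape_free _ _ Nm m0)[W fW ->]]] := h.
    by move/(points_of_inj (ff U UF) (ff U' UF')).
  rewrite subsetI (points_of_sub fW (ff U UF)) (points_of_sub fW (ff U' UF')) => /andP[WU WU'].
  by exists W.
have Hj d S : (0 < d)%N -> reflect (exists2 U, free_of_rank d U & S = @points_of R n U)
    (Hjelmslev_subspace (d - 1) S).
  by case: d => // d _; rewrite subn1; apply: Hjelmslev_free.
have k0 : (0 < k)%N := leq_ltn_trans (leq0n t) htk.
move=> bound.
have bE : bound = #|K|%:R ^+ ((m - 1) * (k - t) * (n - k)) * q_binomial K (n - t) (k - t).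
  by rewrite -gauss_coefE.
split.
- by rewrite cF bE; apply: (free_ekr_bound cd ht htk hkn ff mt).
- have kt : (k - t <= n - t)%N by clear -hkn; lia.
  rewrite (card_free cd kt) bE; congr (_ ^+ (_ * _) * _).
  by clear -hkn htk; lia.
rewrite bE cF => /(free_ekr_extremal cd ht htk hkn ff mt)[[T fT TE]|[nE [Y fY YE]]].
  left; exists (points_of T); split; first by apply/Hj => //; exists T.
  move=> S; rewrite FE; split.
    case/imsetP => U UF ->; split; first by apply/Hj => //; exists U; rewrite ?ff.
    by rewrite (points_of_sub fT (ff U UF)); move: UF; rewrite TE => /andP[].
  case=> /(Hj _ _ k0)[U fU ->]; rewrite (points_of_sub fT fU) => TU.
  by apply: imset_f; rewrite TE fU.
right; split=> //; exists (points_of Y); split.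
  by apply/Hj; [clear -htk; lia | exists Y].
move=> S; rewrite FE; split.
  case/imsetP => U UF ->; split; first by apply/Hj => //; exists U; rewrite ?ff.
  by rewrite (points_of_sub (ff U UF) fY); move: UF; rewrite YE => /andP[].
case=> /(Hj _ _ k0)[U fU ->]; rewrite (points_of_sub fU fY) => UY.
by apply: imset_f; rewrite YE fU.
Qed.
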